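(* For a bounded interval $I\subset\mathbb R$ consider the distribution $\lambda_I(f)=\int_If(x)\,dx$. Then: (i) $\lambda_I$ extends to a bounded linear functional on $\mathscr B=B^{-1}_{\infty,1}(\mathbb R)$, with operator norm $O(1+|I|)$ (the implicit constant being independent of $I$). (ii) For every $h\in\mathscr H^{\mathrm{ext}}$ the linear functional $f\mapsto\langle f,h\rangle$ is bounded on $\mathscr B$, with operator norm bounded uniformly in $h\in\mathscr H^{\mathrm{ext}}$. (iii) If $f\in\mathscr B$ and $\langle f,h\rangle=0$ for all $h\in\mathscr H$, then $f=0$.
   Context: Let $\eta_0\in C_c^\infty(\mathbb R)$ be supported in $\{|\xi|<3/4\}$ with $\eta_0(\xi)=1$ for $|\xi|\le 1/2$. For $f\in\mathcal S'(\mathbb R)$ let $\widehat{\Delta_0f}=\eta_0\widehat f$ and $\widehat{\Delta_kf}(\xi)=(\eta_0(2^{-k}\xi)-\eta_0(2^{-k+1}\xi))\widehat f(\xi)$, $k\ge1$, so $f=\sum_{k\ge0}\Delta_kf$ in $\mathcal S'$. $\mathscr B:=B^{-1}_{\infty,1}(\mathbb R)$ is the Besov space of $f\in\mathcal S'(\mathbb R)$ with $\|f\|_{\mathscr B}=\sum_{k\ge0}2^{-k}\|\Delta_kf\|_\infty<\infty$. The extension of $\lambda_I$ to $\mathscr B$ is $\lambda_I(f)=\langle f,\mathbf 1_I\rangle:=\sum_{k\ge0}\int_I\Delta_kf(x)\,dx$ (part (i) includes convergence of this series). For $h$ a finite linear combination of indicator functions of bounded intervals, $\langle f,h\rangle$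 is defined by linearity. Let $h=\mathbf 1_{[0,1/2)}-\mathbf 1_{[1/2,1)}$. The Haar system is $\mathscr H=\{h_{j,\mu}:j\ge-1,\mu\in\mathbb Z\}$ with $h_{j,\mu}(x)=h(2^jx-\mu)$ for $j\ge0$ and $h_{-1,\mu}=\mathbf 1_{[\mu,\mu+1)}$. The extended Haar system is $\mathscr H^{\mathrm{ext}}=\{\widetilde h_{j,\nu}:j\ge-1,\nu\in\mathbb Z\}$ with $\widetilde h_{j,\nu}(x)=h(2^jx-\nu/2)$ for $j\ge0$ and $\widetilde h_{-1,\nu}=\mathbf 1_{[\nu,\nu+1)}$. *)

(* Defs.v *)
From HB Require Import structures.
From mathcomp Require Import all_boot all_order all_algebra.
From mathcomp Require Import complex.
From mathcomp Require Import all_classical all_reals all_analysis.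

Set Implicit Arguments.
Unset Strict Implicit.
Unset Printing Implicit Defensive.

Import Order.TTheory GRing.Theory Num.Theory.
Import numFieldNormedType.Exports.

Local Open Scope classical_set_scope.
Local Open Scope ring_scope.

(* Derivatives, integrals and limits of [R[i]]-valued objects are taken on real
   and imaginary parts; [cabs] is the modulus as an element of [R] (the library
   norm of [R[i]] takes its values in [R[i]]). *)

Section ComplexFunctions.
Variable R : realType.
Implicit Types (f g : R -> R[i]) (A : set R).

Definition cabs (z : R[i]) : R := Normc.normc z.

Definition re f : R -> R := fun x => complex.Re (f x).
Definition im f : R -> R := fun x => complex.Im (f x).

Definition cderiv (n : nat) f : R -> R[i] :=
  fun x => Complex (derive1n n (re f) x) (derive1n n (im f) x).

Definition csmooth f := forall (n : nat) (x : R),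
  derivable (derive1n n (re f)) x 1 /\ derivable (derive1n n (im f)) x 1.

Definition cintegrable A f :=
  (@lebesgue_measure R).-integrable A (EFin \o re f) /\
  (@lebesgue_measure R).-integrable A (EFin \o im f).

Definition cint A f : R[i] :=
  Complex (Rintegral (@lebesgue_measure R) A (re f))
          (Rintegral (@lebesgue_measure R) A (im f)).

Definition cis_cvg_series (z : nat -> R[i]) :=
  cvgn (series (fun k => complex.Re (z k))) /\
  cvgn (series (fun k => complex.Im (z k))).

Definition cseries (z : nat -> R[i]) : R[i] :=
  Complex (limn (series (fun k => complex.Re (z k))))
          (limn (series (fun k => complex.Im (z k)))).

Definition supp f : set R := closure [set x | f x != 0].
Definition Ccinfty f := csmooth f /\ compact (supp f).

Definition seminorm (m n : nat) f : \bar R :=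
  ereal_sup [set (`|x| ^+ m * cabs (cderiv n f x))%:E | x in [set: R]].

Definition schwartz f :=
  csmooth f /\ forall m n : nat, (seminorm m n f < +oo)%E.

(* A distribution is given by a functional on all functions of which only the
   restriction to Schwartz functions is meaningful: two distributions are the
   same when they agree on every Schwartz function, see [deq]. *)
Definition distr := (R -> R[i]) -> R[i].
Implicit Types u v : distr.

Definition deq u v := forall phi, schwartz phi -> u phi = v phi.
Definition dzero : distr := fun _ => 0.
Definition dlin (a : R[i]) u v : distr := fun phi => a * u phi + v phi.

Definition tempered u :=
  (forall (a : R[i]) phi psi, schwartz phi -> schwartz psi ->
     u (fun x => a * phi x + psi x) = a * u phi + u psi) /\
  (exists (N : nat) (M : R), forall phi, schwartz phi ->
     ((cabs (u phi))%:E <=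
      M%:E * \sum_(m < N) \sum_(n < N) seminorm m n phi)%E).

Definition expi (t : R) : R[i] := Complex (cos t) (sin t).

(* Normalization: [fourier f xi = \int f(x) e^{-2 i pi x xi} dx]. *)
Definition fourier f : R -> R[i] :=
  fun xi => cint setT (fun x => f x * expi (- (2 * pi * x * xi))).
Definition ifourier f : R -> R[i] :=
  fun x => cint setT (fun xi => f xi * expi (2 * pi * x * xi)).

Definition dfourier u : distr := fun phi => u (fourier phi).
Definition difourier u : distr := fun phi => u (ifourier phi).
Definition dmul (m : R -> R[i]) u : distr := fun phi => u (fun x => m x * phi x).

Definition dfun g : distr := fun phi => cint setT (fun x => g x * phi x).

(* [u] is represented by the function [g], which is then locally integrable and
   unique up to a null set. *)
Definition has_density u g :=
  [/\ measurable_fun setT (re g), measurable_fun setT (im g),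
      (forall phi, schwartz phi -> cintegrable setT (fun x => g x * phi x)) &
      deq u (dfun g)].

Definition density u : R -> R[i] := xget (fun=> 0) [set g | has_density u g].

(* The infimum is over functions equal almost everywhere, so it is the [L^oo]
   norm of [u]; it is [+oo] if [u] is not a function. *)
Definition dLinfty u : \bar R :=
  ereal_inf [set Lnorm (@lebesgue_measure R) +oo%E (EFin \o cabs \o g)
            | g in [set g | has_density u g]].

End ComplexFunctions.

Section Besov.
Variables (R : realType) (eta0 : R -> R[i]).
Implicit Types (f : distr R) (I : interval R).

Definition lp_symbol (k : nat) (xi : R) : R[i] :=
  if k is k'.+1 then eta0 (xi / 2 ^+ k) - eta0 (xi / 2 ^+ k') else eta0 xi.

Definition lp_piece (k : nat) f : distr R :=
  difourier (dmul (lp_symbol k) (dfourier f)).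

Definition besov_norm f : \bar R :=
  (\sum_(0 <= k <oo) (2 ^- k)%:E * dLinfty (lp_piece k f))%E.

Definition besov f := tempered f /\ (besov_norm f < +oo)%E.

Definition linear_on_besov (L : distr R -> R[i]) :=
  forall (a : R[i]) f g, besov f -> besov g ->
    L (dlin a f g) = a * L f + L g.

Definition operator_norm (L : distr R -> R[i]) : \bar R :=
  ereal_sup [set (cabs (L f))%:E
            | f in [set f | besov f /\ (besov_norm f <= 1)%E]].

Definition bounded_itv I := bounded_set ([set` I] : set R).

Definition itv_length I : R := fine (lebesgue_measure ([set` I] : set R)).

Definition lambda_term I f (k : nat) : R[i] :=
  cint [set` I] (density (lp_piece k f)).

Definition lambda I f : R[i] := cseries (lambda_term I f).

Definition step_fun (s : seq (R[i] * interval R)) : R -> R[i] :=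
  fun x => \sum_(p <- s) p.1 * \1_([set` p.2] : set R) x.

Definition step_repr (h : R -> R[i]) (s : seq (R[i] * interval R)) :=
  (forall p, p \in s -> bounded_itv p.2) /\ h = step_fun s.

(* [<f, h> = \sum c_i lambda_{I_i}(f)] for [h = \sum c_i 1_{I_i}], computed on a
   chosen representation of [h]; for [f] in the Besov space the value does not
   depend on that choice. *)
Definition pairing f (h : R -> R[i]) : R[i] :=
  \sum_(p <- xget [::] [set s | step_repr h s]) p.1 * lambda p.2 f.

End Besov.

Section Haar.
Variable R : realType.

Definition haar_mother : R -> R[i] :=
  fun x => \1_(`[0, 2^-1[ : set R) x - \1_(`[2^-1, 1[ : set R) x.

Definition haar_father (mu : int) : R -> R[i] :=
  \1_(`[mu%:~R, mu%:~R + 1[ : set R).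

Definition haar (j mu : int) : R -> R[i] :=
  if j == -1 then haar_father mu
  else fun x => haar_mother (2 ^ j * x - mu%:~R).

Definition haar_ext (j nu : int) : R -> R[i] :=
  if j == -1 then haar_father nu
  else fun x => haar_mother (2 ^ j * x - nu%:~R / 2).

Definition haar_system : set (R -> R[i]) :=
  [set h | exists j mu : int, -1 <= j /\ h = haar j mu].

Definition haar_ext_system : set (R -> R[i]) :=
  [set h | exists j nu : int, -1 <= j /\ h = haar_ext j nu].

End Haar.

(* Main.v *)
Require Import Defs.
From mathcomp Require Import all_boot all_order all_algebra.
From mathcomp Require Import complex.
From mathcomp Require Import all_classical all_reals all_analysis.
From mathcomp Require Import measurable_realfun ess_sup_inf.
From mathcomp Require Import ring lra.
Set Implicit Arguments.
Unset Strict Implicit.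
Unset Printing Implicit Defensive.
Import Order.TTheory GRing.Theory Num.Theory.
Import numFieldNormedType.Exports.
Local Open Scope classical_set_scope.
Local Open Scope ring_scope.

(** The functional [lambda I] is the sum over [k] of the integrals over [I] of the
    Littlewood-Paley pieces of [f].  The piece of index [k] is a bounded function [g_k],
    of size [lp_norm eta f k], and its frequencies are of order [2 ^+ k].  A function of
    high frequency oscillates, and its integral over an interval is governed by the two
    endpoints and not by the length: it is at most a constant times
    [2 ^- k * lp_norm eta f k] for [k >= 1] ([lp_piece_cint]).  For [k = 0] the trivial
    bound by [|I| * lp_norm eta f 0] is used.  The sum of these bounds over [k] is at
    most a constant times [1 + |I|] times the Besov norm, which gives convergence of
    the series and boundedness of [lambda I] ([lambdaP]).

    The estimate is proved by duality.  A multiplier that vanishes at the origin acts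
    on a test function as a convolution with its derivative, and after rescaling to
    frequency [2 ^+ k] this gains [2 ^- k] ([L1norm_multiplier]).  The test functions are
    smooth approximations of the indicator function of the interval, whose derivatives
    are bounded in [L^1] uniformly ([approx_indic_deriv]).

    For Schwartz functions the partial sums of the decomposition converge boundedly, so
    the functional is the integral ([lambda_dfun]).  An element of the extended Haar
    system is a combination of at most two indicator functions of intervals of length
    at most [1], so boundedness of the pairing follows as soon as the pairing is known
    to be independent of the representation ([pairing_repr]).

    Now let all Haar coefficients of [f] vanish.  The coefficients at the coarsest scale
    give [lambda I f = 0] for the integer intervals of length [1], and induction on the
    scale gives it for all dyadic intervals: the two halves of a dyadic interval have
    values with sum [0] and difference [0] ([dyadic_vanish]).  The value of [lambda] on
    short intervals is small ([itv_functional_small]), so it vanishes on all intervals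
    ([itv_functional_vanish]).  In other words the formal primitive of [f] is zero.
    To conclude that [f] is zero, recover [f phi] as the limit of the integrals of
    [(g_0 + .. + g_n) * phi] ([lp_piece_cvg]) and integrate by parts; the primitives of
    the partial sums tend to [0] and grow at most linearly, so the limit is [0] by
    dominated convergence ([besov_vanish]).

    The tools from Fourier analysis are built for families of functions with bounds
    uniform in an index.  Inversion rests on Hadamard's lemma ([hadamard]) and on the
    Gaussian ([cint_FT]). *)

(** * Complex-valued functions of a real variable *)

Section Modulus.
Variable R : realType.
Local Notation C := R[i].
Implicit Types z w : C.

Lemma cabs_ge0 z : 0 <= cabs z.
Proof. by case: z => a b; rewrite /cabs /= sqrtr_ge0. Qed.

Lemma cabs0 : cabs (0 : C) = 0.
Proof. exact: Normc.normc0. Qed.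

Lemma cabsM z w : cabs (z * w) = cabs z * cabs w.
Proof. exact: Normc.normcM. Qed.

Lemma cabsD z w : cabs (z + w) <= cabs z + cabs w.
Proof. exact: le_normcD. Qed.

Lemma cabsN z : cabs (- z) = cabs z.
Proof. exact: normcN. Qed.

Lemma cabsB z w : cabs (z - w) <= cabs z + cabs w.
Proof. by rewrite -(cabsN w) cabsD. Qed.

Lemma cabs_eq0 z : cabs z = 0 -> z = 0.
Proof. exact: Normc.eq0_normc. Qed.

Lemma cabs_real (x : R) : cabs (Complex x 0) = `|x|.
Proof. by rewrite /cabs /= expr0n addr0 sqrtr_sqr. Qed.

Lemma cabs1 : cabs (1 : C) = 1.
Proof. exact: Normc.normc1. Qed.

Lemma cabs_Re z : `|complex.Re z| <= cabs z.
Proof. by case: z => a b; rewrite /cabs /= -sqrtr_sqr ler_wsqrtr// lerDl sqr_ge0. Qed.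

Lemma cabs_Im z : `|complex.Im z| <= cabs z.
Proof. by case: z => a b; rewrite /cabs /= -sqrtr_sqr ler_wsqrtr// lerDr sqr_ge0. Qed.

Lemma cabs_le_ReIm z : cabs z <= `|complex.Re z| + `|complex.Im z|.
Proof.
case: z => a b; rewrite -[leRHS]ger0_norm ?addr_ge0// -sqrtr_sqr /cabs /=.
by rewrite ler_wsqrtr// sqrrD !real_normK ?num_real// addrAC lerDl mulrn_wge0 ?mulr_ge0.
Qed.

Lemma cabs_expi (t : R) : cabs (expi t) = 1.
Proof. by rewrite /cabs /= cos2Dsin2 sqrtr1. Qed.

Lemma expi0 : expi 0 = 1 :> C.
Proof. by rewrite /expi cos0 sin0. Qed.

Lemma expiD (s t : R) : expi (s + t) = expi s * expi t.
Proof.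
by apply/eqP; rewrite eq_complex /= cosD sinD; apply/andP; split=> //; apply/eqP; ring.
Qed.

Lemma ReD z w : complex.Re (z + w) = complex.Re z + complex.Re w.
Proof. by case: z w => [? ?] []. Qed.
Lemma ImD z w : complex.Im (z + w) = complex.Im z + complex.Im w.
Proof. by case: z w => [? ?] []. Qed.
Lemma ReN z : complex.Re (- z) = - complex.Re z.
Proof. by case: z => [? ?]. Qed.
Lemma ImN z : complex.Im (- z) = - complex.Im z.
Proof. by case: z => [? ?]. Qed.
Lemma ReM z w : complex.Re (z * w) =
  complex.Re z * complex.Re w - complex.Im z * complex.Im w.
Proof. by case: z w => [? ?] []. Qed.
Lemma ImM z w : complex.Im (z * w) =
  complex.Re z * complex.Im w + complex.Im z * complex.Re w.
Proof. by case: z w => [? ?] []. Qed.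

Lemma complex_ext z w :
  complex.Re z = complex.Re w -> complex.Im z = complex.Im w -> z = w.
Proof. by case: z w => [? ?] [? ?] /= -> ->. Qed.

Lemma Re_sum (I : Type) (r : seq I) (F : I -> C) :
  complex.Re (\sum_(i <- r) F i) = \sum_(i <- r) complex.Re (F i).
Proof.
by elim: r => [|i r IH]; rewrite ?big_nil// !big_cons ReD IH.
Qed.

Lemma Im_sum (I : Type) (r : seq I) (F : I -> C) :
  complex.Im (\sum_(i <- r) F i) = \sum_(i <- r) complex.Im (F i).
Proof.
by elim: r => [|i r IH]; rewrite ?big_nil// !big_cons ImD IH.
Qed.

Lemma cabs_sum (I : Type) (r : seq I) (F : I -> C) :
  cabs (\sum_(i <- r) F i) <= \sum_(i <- r) cabs (F i).
Proof.
elim: r => [|i r IH]; first by rewrite !big_nil cabs0.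
by rewrite !big_cons (le_trans (cabsD _ _))// lerD2l.
Qed.

End Modulus.

Definition rc (R : realType) (x : R) : R[i] := Complex x 0.

Section RealScalars.
Variable R : realType.
Implicit Types x y : R.

Lemma rcD x y : rc (x + y) = rc x + rc y.
Proof. by apply: complex_ext => //=; rewrite addr0. Qed.
Lemma rcN x : rc (- x) = - rc x.
Proof. by apply: complex_ext => //=; rewrite oppr0. Qed.
Lemma rcM x y : rc (x * y) = rc x * rc y.
Proof. by apply: complex_ext; rewrite ?ReM ?ImM /=; ring. Qed.
Lemma rc0 : rc 0 = 0 :> R[i].
Proof. by []. Qed.
Lemma rc1 : rc 1 = 1 :> R[i].
Proof. by []. Qed.
Lemma rcX x n : rc (x ^+ n) = rc x ^+ n.
Proof. by elim: n => [|n IH]; rewrite ?expr0// !exprS rcM IH. Qed.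
Lemma rc_nat n : rc n%:R = n%:R :> R[i].
Proof. by elim: n => // n IH; rewrite -!natr1 rcD IH. Qed.
Lemma cabs_rc x : cabs (rc x) = `|x|.
Proof. exact: cabs_real. Qed.
Lemma rc_eq0 x : (rc x == 0) = (x == 0).
Proof. by rewrite eq_complex /= eqxx andbT. Qed.

End RealScalars.

Section Derivative.
Variable R : realType.
Local Notation C := R[i].
Implicit Types (f g : R -> C).

Definition cD f f' := forall x : R,
  is_derive x (1:R) (re f) (re f' x) /\ is_derive x (1:R) (im f) (im f' x).

Lemma cD_cst (z : C) : cD (fun=> z) (fun=> 0).
Proof. by move=> x; split; exact: is_derive_cst. Qed.

Lemma cDD f f' g g' : cD f f' -> cD g g' ->
  cD (fun x => f x + g x) (fun x => f' x + g' x).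
Proof.
move=> df dg x; have [? ?] := df x; have [? ?] := dg x; split.
- rewrite (_ : re _ = re f + re g); last by apply/funext => y; rewrite /re ReD.
  by rewrite /re ReD; exact: is_deriveD.
- rewrite (_ : im _ = im f + im g); last by apply/funext => y; rewrite /im ImD.
  by rewrite /im ImD; exact: is_deriveD.
Qed.

Lemma is_deriveM_val (u v : R -> R) (x du dv : R) :
  is_derive x (1:R) u du -> is_derive x (1:R) v dv ->
  is_derive x (1:R) (u * v) (u x * dv + v x * du).
Proof. by move=> ? ?; exact: is_deriveM. Qed.

Lemma cDM f f' g g' : cD f f' -> cD g g' ->
  cD (fun x => f x * g x) (fun x => f' x * g x + f x * g' x).
Proof.
move=> df dg x; have [d1 d2] := df x; have [d3 d4] := dg x; split.
- rewrite (_ : re _ = re f * re g - im f * im g); last first.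
    by apply/funext => y; rewrite /re ReM.
  apply: (is_derive_eq (is_deriveB (is_deriveM_val d1 d3) (is_deriveM_val d2 d4))).
  by rewrite /re /im ReD !ReM; ring.
- rewrite (_ : im _ = re f * im g + im f * re g); last first.
    by apply/funext => y; rewrite /im ImM.
  apply: (is_derive_eq (is_deriveD (is_deriveM_val d1 d4) (is_deriveM_val d2 d3))).
  by rewrite /re /im ImD !ImM; ring.
Qed.

Lemma cDext f f' g g' : f =1 g -> f' =1 g' -> cD f f' -> cD g g'.
Proof. by move=> /funext <- /funext <-. Qed.

Lemma cDZ (z : C) f f' : cD f f' -> cD (fun x => z * f x) (fun x => z * f' x).
Proof.
move=> df; apply: cDext (cDM (cD_cst z) df) => // x.
by rewrite mul0r add0r.
Qed.

Lemma cDN f f' : cD f f' -> cD (fun x => - f x) (fun x => - f' x).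
Proof. by move=> df; apply: cDext (cDZ (-1) df) => x; rewrite mulN1r. Qed.

Lemma cDB f f' g g' : cD f f' -> cD g g' ->
  cD (fun x => f x - g x) (fun x => f' x - g' x).
Proof. by move=> df dg; apply: cDD => //; exact: cDN. Qed.

Lemma is_derive_affine (a b x : R) : is_derive x (1:R) (fun y : R => a * y + b) a.
Proof.
have d := is_deriveD (is_deriveZ a (is_derive_id x (1:R))) (is_derive_cst b x (1:R)).
by apply: (is_derive_eq d); rewrite addr0 /GRing.scale /= mulr1.
Qed.

Lemma cD_affine f f' (a b : R) : cD f f' ->
  cD (fun x => f (a * x + b)) (fun x => rc a * f' (a * x + b)).
Proof.
move=> df x; have [d1 d2] := df (a * x + b).
have d3 := is_derive_affine a b x.
split.
- apply: (is_derive_eq (is_derive1_comp (f := re f) (g := fun y => a * y + b) d1 d3)).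
  by rewrite /re ReM /=; ring.
- apply: (is_derive_eq (is_derive1_comp (f := im f) (g := fun y => a * y + b) d2 d3)).
  by rewrite /im ImM /=; ring.
Qed.

Lemma cD_rc : cD (@rc R) (fun=> 1).
Proof. by move=> x; split; [exact: is_derive_id|exact: is_derive_cst]. Qed.

Lemma cD_expi (a : R) :
  cD (fun x => expi (a * x)) (fun x => Complex 0 a * expi (a * x)).
Proof.
move=> x; have d := is_derive_affine a 0 x; split.
- rewrite (_ : re _ = cos \o (fun y => a * y + 0)); last first.
    by apply/funext => y; rewrite /= addr0.
  apply: (is_derive_eq (is_derive1_comp (is_derive_cos _) d)).
  by rewrite /re ReM /= addr0; ring.
- rewrite (_ : im _ = sin \o (fun y => a * y + 0)); last first.
    by apply/funext => y; rewrite /= addr0.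
  apply: (is_derive_eq (is_derive1_comp (is_derive_sin _) d)).
  by rewrite /im ImM /= addr0; ring.
Qed.

Lemma cD_continuous f f' : cD f f' -> continuous (re f) /\ continuous (im f).
Proof.
move=> df; split=> x; have [d1 d2] := df x.
- by apply/differentiable_continuous/derivable1_diffP; case: d1.
- by apply/differentiable_continuous/derivable1_diffP; case: d2.
Qed.

Lemma cD_unique f f' f'' : cD f f' -> cD f f'' -> f' = f''.
Proof.
move=> d1 d2; apply/funext => x; have [[_ r1] [_ i1]] := d1 x.
by have [[_ r2] [_ i2]] := d2 x; apply: complex_ext; rewrite -/(re _ _) -/(im _ _) -?r1 -?r2 -?i1 -?i2.
Qed.

(** Used for functions defined by cases: on a neighbourhood of each point they agree
    with a function known to be differentiable. *)
Lemma cD_near f f' : (forall x : R, exists g g', [/\ cD g g',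
    \forall y \near x, g y = f y & f' x = g' x]) -> cD f f'.
Proof.
move=> H x; have [g [g' [dg fg f'g']]] := H x; have [d1 d2] := dg x.
split.
- rewrite /re f'g'; apply: near_eq_is_derive d1.
  by near=> y; rewrite /re; congr (complex.Re _); near: y.
- rewrite /im f'g'; apply: near_eq_is_derive d2.
  by near=> y; rewrite /im; congr (complex.Im _); near: y.
Unshelve. all: by end_near. Qed.

End Derivative.

(** * Families of smooth functions with uniform bounds *)

Section Families.
Variable R : realType.
Local Notation C := R[i].

Definition wt (x : R) : R := 1 + `|x|.

Lemma wt_ge1 x : 1 <= wt x. Proof. by rewrite /wt lerDl. Qed.
Lemma wt_gt0 x : 0 < wt x. Proof. exact: lt_le_trans (wt_ge1 x). Qed.
Lemma wt_ge0 x : 0 <= wt x. Proof. exact/ltW/wt_gt0. Qed.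
Lemma norm_le_wt x : `|x| <= wt x. Proof. by rewrite /wt lerDr. Qed.
Lemma wtX_ge1 x n : 1 <= wt x ^+ n. Proof. by rewrite exprn_ege1// wt_ge1. Qed.
Lemma wtX_gt0 x n : 0 < wt x ^+ n. Proof. by rewrite exprn_gt0// wt_gt0. Qed.
Lemma wtX_ge0 x n : 0 <= wt x ^+ n. Proof. exact/ltW/wtX_gt0. Qed.

Lemma wt_shift x y : wt x <= wt (x + y) * wt y.
Proof.
have h : `|x| <= `|x + y| + `|y|.
  by rewrite -{1}(addrK y x) (le_trans (ler_normB _ _)).
rewrite /wt; apply: (@le_trans _ _ (1 + (`|x + y| + `|y|))); first by rewrite lerD2l.
have := mulr_ge0 (normr_ge0 (x + y)) (normr_ge0 y); lra.
Qed.

Lemma wtX_le x m : wt x ^+ m <= 2 ^+ m * (1 + `|x| ^+ m).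
Proof.
have [x1|x1] := leP `|x| 1.
- apply: (@le_trans _ _ (2 ^+ m)).
    by rewrite lerXn2r ?nnegrE ?wt_ge0// /wt; lra.
  by rewrite ler_peMr ?exprn_ge0// lerDl exprn_ge0.
- apply: (@le_trans _ _ ((2 * `|x|) ^+ m)).
    by rewrite lerXn2r ?nnegrE ?wt_ge0 ?mulr_ge0// /wt; lra.
  by rewrite exprMn ler_wpM2l ?exprn_ge0// lerDr.
Qed.

Section OverIndex.
Variable T : Type.
Implicit Types (Phi Psi : T -> R -> C) (P : (T -> R -> C) -> Prop).

Definition ucD Phi Psi := forall t, cD (Phi t) (Psi t).

Definition udec Phi := forall m, exists2 K : R, 0 <= K &
  forall t x, wt x ^+ m * cabs (Phi t x) <= K.

Definition umod Phi := exists p, exists2 K : R, 0 <= K &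
  forall t x, cabs (Phi t x) <= K * wt x ^+ p.

Definition ubdd Phi := exists2 K : R, 0 <= K & forall t x, cabs (Phi t x) <= K.

(** [G n] is the [n]-th derivative.  Functions come in families indexed by [T], with
    bounds independent of the index: stability of a class of families under an
    operation is then also the continuity of that operation, which is how uniform
    seminorm bounds are obtained without ever writing a seminorm. *)
Definition uchain P Phi := exists G : nat -> T -> R -> C,
  G 0%N = Phi /\ forall n, ucD (G n) (G n.+1) /\ P (G n).

Lemma uchain_bound P Phi : uchain P Phi -> P Phi.
Proof. by case=> G [<-] /(_ 0%N)[]. Qed.

Lemma uchain_deriv P Phi : uchain P Phi ->
  exists2 Phi', ucD Phi Phi' & uchain P Phi'.
Proof.
case=> G [<- H]; exists (G 1%N); first by case: (H 0%N).
by exists (fun n => G n.+1); split=> // n; exact: H.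
Qed.

Lemma uchain_sub P Q Phi : (forall Psi, P Psi -> Q Psi) ->
  uchain P Phi -> uchain Q Phi.
Proof.
move=> PQ [G [G0 H]]; exists G; split=> // n; have [? /PQ] := H n.
by split.
Qed.

(** Coinduction: no explicit formula for the higher derivatives is needed, only
    a class of functions that is stable under one differentiation. *)
Lemma uchain_coind P (S : (T -> R -> C) -> Prop) :
  (forall Phi, S Phi -> P Phi /\ exists2 Phi', ucD Phi Phi' & S Phi') ->
  forall Phi, S Phi -> uchain P Phi.
Proof.
move=> H Phi SPhi.
have nxt (s : {Psi | S Psi}) : {s' : {Psi | S Psi} | ucD (sval s) (sval s')}.
  apply: cid; case: s => Psi SPsi; have [_ [Psi' d SPsi']] := H _ SPsi.
  by exists (exist _ Psi' SPsi').
pose G n := iter n (fun s => sval (nxt s)) (exist _ Phi SPhi).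
exists (fun n => sval (G n)); split=> // n; split.
- by rewrite /G iterS; exact: (svalP (nxt _)).
- by case: (G n) => Psi /= /H[].
Qed.

Lemma uchain_cons P Phi Phi' :
  P Phi -> ucD Phi Phi' -> uchain P Phi' -> uchain P Phi.
Proof.
move=> PPhi d [G [G0 H]].
exists (fun n => if n is n'.+1 then G n' else Phi); split=> // -[|n].
- by rewrite G0.
- exact: H.
Qed.

Lemma uchain_add P Phi Psi :
  (forall A B, P A -> P B -> P (fun t x => A t x + B t x)) ->
  uchain P Phi -> uchain P Psi -> uchain P (fun t x => Phi t x + Psi t x).
Proof.
move=> PD [G [<- HG]] [K [<- HK]].
exists (fun n t x => G n t x + K n t x); split=> // n.
have [dG PG] := HG n; have [dK PK] := HK n.
by split=> [t|]; [exact: cDD|exact: PD].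
Qed.

Inductive sum_of_products (P Q : (T -> R -> C) -> Prop) : (T -> R -> C) -> Prop :=
| SumProd1 A B : uchain P A -> uchain Q B ->
    sum_of_products P Q (fun t x => A t x * B t x)
| SumProdD Phi Psi : sum_of_products P Q Phi -> sum_of_products P Q Psi ->
    sum_of_products P Q (fun t x => Phi t x + Psi t x).

(** By the product rule the sums of products are stable under differentiation,
    which replaces the Leibniz formula. *)
Lemma uchain_mul (P Q S : (T -> R -> C) -> Prop) Phi Psi :
  (forall A B, S A -> S B -> S (fun t x => A t x + B t x)) ->
  (forall A B, P A -> Q B -> S (fun t x => A t x * B t x)) ->
  uchain P Phi -> uchain Q Psi -> uchain S (fun t x => Phi t x * Psi t x).
Proof.
move=> SD SM hPhi hPsi.
apply: (@uchain_coind S (sum_of_products P Q)); last exact: SumProd1.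
move=> Xi; elim=> {Xi} [A B hA hB|X Y _ [SX [X' dX hX]] _ [SY [Y' dY hY]]].
- split; first by apply: SM; exact: uchain_bound.
  have [A' dA hA'] := uchain_deriv hA; have [B' dB hB'] := uchain_deriv hB.
  exists (fun t x => A' t x * B t x + A t x * B' t x).
    by move=> t; exact: cDM.
  by apply: SumProdD; exact: SumProd1.
- split; first exact: SD.
  exists (fun t x => X' t x + Y' t x); last exact: SumProdD.
  by move=> t; exact: cDD.
Qed.

Lemma udecD Phi Psi : udec Phi -> udec Psi -> udec (fun t x => Phi t x + Psi t x).
Proof.
move=> h1 h2 m; have [K1 K10 k1] := h1 m; have [K2 K20 k2] := h2 m.
exists (K1 + K2); first exact: addr_ge0.
move=> t x; apply: (le_trans _ (lerD (k1 t x) (k2 t x))).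
by rewrite -mulrDr ler_wpM2l ?wtX_ge0// cabsD.
Qed.

Lemma ubddD Phi Psi : ubdd Phi -> ubdd Psi -> ubdd (fun t x => Phi t x + Psi t x).
Proof.
move=> [K1 K10 k1] [K2 K20 k2]; exists (K1 + K2); first exact: addr_ge0.
by move=> t x; rewrite (le_trans (cabsD _ _))// lerD.
Qed.

Lemma ubddM Phi Psi : ubdd Phi -> ubdd Psi -> ubdd (fun t x => Phi t x * Psi t x).
Proof.
move=> [K1 K10 k1] [K2 K20 k2]; exists (K1 * K2); first exact: mulr_ge0.
by move=> t x; rewrite cabsM ler_pM ?cabs_ge0.
Qed.

Lemma umod_udec Phi Psi : umod Phi -> udec Psi -> udec (fun t x => Phi t x * Psi t x).
Proof.
move=> [p [K1 K10 k1]] h2 m; have [K2 K20 k2] := h2 (m + p)%N.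
exists (K1 * K2); first exact: mulr_ge0.
move=> t x; rewrite cabsM.
apply: (@le_trans _ _ (wt x ^+ m * ((K1 * wt x ^+ p) * cabs (Psi t x)))).
  by rewrite ler_wpM2l ?wtX_ge0// ler_wpM2r ?cabs_ge0.
rewrite (_ : _ * _ = K1 * (wt x ^+ (m + p) * cabs (Psi t x))); last first.
  by rewrite exprD; ring.
by rewrite ler_wpM2l.
Qed.

Lemma ubdd_umod Phi : ubdd Phi -> umod Phi.
Proof. by move=> [K K0 k]; exists 0%N, K => // t x; rewrite expr0 mulr1. Qed.

Definition usch := uchain udec.

Lemma usch_add Phi Psi : usch Phi -> usch Psi -> usch (fun t x => Phi t x + Psi t x).
Proof. by apply: uchain_add; exact: udecD. Qed.

Lemma usch_mul Phi Psi : uchain umod Phi -> usch Psi ->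
  usch (fun t x => Phi t x * Psi t x).
Proof. by apply: uchain_mul; [exact: udecD|exact: umod_udec]. Qed.

Lemma ubdd_mul Phi Psi : uchain ubdd Phi -> uchain ubdd Psi ->
  uchain ubdd (fun t x => Phi t x * Psi t x).
Proof. by apply: uchain_mul; [exact: ubddD|exact: ubddM]. Qed.

Lemma ubdd_cst (z : T -> C) (K : R) : (forall t, cabs (z t) <= K) ->
  uchain ubdd (fun t (_ : R) => z t).
Proof.
move=> zK; apply: (@uchain_coind ubdd (fun Phi => exists z : T -> C,
    (exists K, forall t, cabs (z t) <= K) /\ Phi = fun t _ => z t)); last first.
  by exists z; split=> //; exists K.
move=> _ [{}z [[{}K {}zK] ->]]; split.
  exists (Num.max K 0); first by rewrite le_max lexx orbT.
  by move=> t x; rewrite le_max zK.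
exists (fun _ _ => 0); first by move=> t; exact: cD_cst.
by exists (fun=> 0); split=> //; exists 0 => t; rewrite cabs0.
Qed.

Lemma umod_cst (z : C) : uchain umod (fun (_ : T) (_ : R) => z).
Proof. by apply: (uchain_sub ubdd_umod); exact: (@ubdd_cst _ (cabs z)). Qed.

Lemma umod_rc : uchain umod (fun (_ : T) x => rc x).
Proof.
apply: (@uchain_cons _ _ (fun _ _ => 1)); last exact: umod_cst.
- exists 1%N, 1 => // t x; rewrite cabs_rc expr1 mul1r; exact: norm_le_wt.
- by move=> t; exact: cD_rc.
Qed.

Lemma usch_mulz (z : C) Phi : usch Phi -> usch (fun t x => z * Phi t x).
Proof. by move=> ?; apply: usch_mul => //; exact: umod_cst. Qed.

Lemma usch_mulrc Phi : usch Phi -> usch (fun t x => rc x * Phi t x).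
Proof. by move=> ?; apply: usch_mul => //; exact: umod_rc. Qed.

Lemma usch_sub Phi Psi : usch Phi -> usch Psi -> usch (fun t x => Phi t x - Psi t x).
Proof.
move=> h1 h2; rewrite (_ : (fun t x => _) = fun t x => Phi t x + -1 * Psi t x).
  by apply: usch_add => //; exact: usch_mulz.
by apply/funext => t; apply/funext => x; rewrite mulN1r.
Qed.

Lemma usch_shift Phi (y : R) : usch Phi -> usch (fun t x => Phi t (x + y)).
Proof.
move=> [G [<- H]]; exists (fun n t x => G n t (x + y)); split=> // n.
have [dG PG] := H n; split.
  move=> t; apply: cDext (cD_affine 1 y (dG t)) => x; first by rewrite mul1r.
  by rewrite mul1r rc1 mul1r.
move=> m; have [K K0 k] := PG m; exists (wt y ^+ m * K).
  by rewrite mulr_ge0// wtX_ge0.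
move=> t x; apply: (@le_trans _ _ (wt y ^+ m * (wt (x + y) ^+ m * cabs (G n t (x + y))))).
  rewrite mulrA -exprMn ler_wpM2r ?cabs_ge0// lerXn2r ?nnegrE ?mulr_ge0 ?wt_ge0//.
  by rewrite mulrC wt_shift.
by rewrite ler_wpM2l// wtX_ge0.
Qed.

Lemma cD_vanish (A : R) (f f' : R -> C) : cD f f' ->
  (forall x, A < `|x| -> f x = 0) -> forall x, A < `|x| -> f' x = 0.
Proof.
move=> d v x Ax.
have d0 : cD (fun=> 0 : C) (fun y => if A < `|y| then f' y else 0).
  move=> y; rewrite /re /im; case: ifPn => [Ay|_]; last exact: (cD_cst 0 y).
  have nr : \forall z \near y, A < `|z|.
    have cn : {for y, continuous (fun z : R => `|z|)} by exact: norm_continuous.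
    exact: (cvgr_gt _ cn).
  have [d1 d2] := d y; split.
  - apply: (near_eq_is_derive _ d1); near=> z; rewrite /re v//; near: z; exact: nr.
  - apply: (near_eq_is_derive _ d2); near=> z; rewrite /im v//; near: z; exact: nr.
by have /(congr1 (@^~ x)) := cD_unique d0 (cD_cst 0); rewrite Ax.
Unshelve. all: by end_near. Qed.

(** The derivatives vanish wherever the function vanishes on an open set, so on the
    remaining compact set every weight is bounded. *)
Lemma usch_compact (A : R) Phi : uchain ubdd Phi ->
  (forall t x, A < `|x| -> Phi t x = 0) -> usch Phi.
Proof.
move=> h v; apply: (@uchain_coind _ (fun Phi => uchain ubdd Phi /\
  forall t x, A < `|x| -> Phi t x = 0)) => // {h v}{}Phi [h v]; split.
  move=> m; have [K K0 k] := uchain_bound h.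
  exists ((1 + `|A|) ^+ m * K); first by rewrite mulr_ge0// exprn_ge0// addr_ge0.
  move=> t x; have [Ax|xA] := ltP A `|x|.
    by rewrite v// cabs0 mulr0 mulr_ge0// exprn_ge0// addr_ge0.
  rewrite ler_pM ?wtX_ge0 ?cabs_ge0// lerXn2r ?nnegrE ?wt_ge0 ?addr_ge0//.
  by rewrite /wt lerD2l (le_trans xA)// ler_norm.
have [Phi' d h'] := uchain_deriv h; exists Phi' => //; split=> // t.
exact: cD_vanish (d t) (v t).
Qed.

End OverIndex.

Lemma usch_at T U (g : U -> T) (Phi : T -> R -> C) :
  usch Phi -> usch (fun u => Phi (g u)).
Proof.
move=> [G [<- H]]; exists (fun n u => G n (g u)); split=> // n.
have [dG PG] := H n; split=> [u|]; first exact: dG.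
by move=> m; have [K K0 k] := PG m; exists K.
Qed.

(** The [n]-th derivative only acquires the factor [a t ^+ n]. *)
Lemma ubdd_affine T (A : R -> C) (a b : T -> R) (K : R) :
  uchain (@ubdd unit) (fun=> A) -> (forall t, `|a t| <= K) ->
  uchain (@ubdd T) (fun t x => A (a t * x + b t)).
Proof.
move=> [G [G0 H]] aK.
exists (fun n t x => rc (a t) ^+ n * G n tt (a t * x + b t)); split.
  by apply/funext => t; apply/funext => x; rewrite expr0 mul1r G0.
move=> n; have [dG [L L0 l]] := H n; split.
  move=> t; apply: cDext (cDZ (rc (a t) ^+ n) (cD_affine (a t) (b t) (dG tt))) => x //.
  by rewrite mulrA -exprSr.
exists (`|K| ^+ n * L); first by rewrite mulr_ge0// exprn_ge0.
move=> t x; rewrite cabsM -rcX cabs_rc normrX ler_pM ?exprn_ge0 ?cabs_ge0//.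
by rewrite lerXn2r ?nnegrE// (le_trans (aK t))// ler_norm.
Qed.

End Families.

(** * Schwartz functions *)

Section Schwartz.
Variable R : realType.
Local Notation C := R[i].

(** Schwartz functions by decay against the weights [wt x ^+ m] and chains of
    derivatives, the form in which the closure properties above apply; [schP] below
    identifies them with [schwartz]. *)
Definition sch (f : R -> C) := usch (fun _ : unit => f).

Lemma csmooth_cD (f : R -> C) n : csmooth f -> cD (cderiv n f) (cderiv n.+1 f).
Proof.
move=> sf x; have [d1 d2] := sf n x.
split.
- change (is_derive x (1:R) (derive1n n (re f)) (derive1n n.+1 (re f) x)).
  by rewrite derive1nS derive1E; exact: DeriveDef d1 erefl.
- change (is_derive x (1:R) (derive1n n (im f)) (derive1n n.+1 (im f) x)).
  by rewrite derive1nS derive1E; exact: DeriveDef d2 erefl.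
Qed.

(** Chains of derivatives are unique, so they are the iterated derivatives. *)
Lemma chain_cderiv (G : nat -> R -> C) : (forall n, cD (G n) (G n.+1)) ->
  csmooth (G 0%N) /\ forall n, cderiv n (G 0%N) = G n.
Proof.
move=> dG.
have E n : derive1n n (re (G 0%N)) = re (G n) /\ derive1n n (im (G 0%N)) = im (G n).
  elim: n => [//|n [IHr IHi]]; rewrite !derive1nS IHr IHi.
  by split; apply/funext => x; rewrite derive1E; have [[_ r] [_ i]] := dG n x.
split=> n.
- move=> x; rewrite (E n).1 (E n).2.
  by have [[r _] [i _]] := dG n x; split; [exact: r|exact: i].
- apply/funext => x; rewrite /cderiv; have [-> ->] := E n.
  by rewrite /re /im; case: (G n x).
Qed.

Lemma usch_schwartz T (Phi : T -> R -> C) : usch Phi ->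
  (forall t, schwartz (Phi t)) /\
  (forall m n, exists2 K : R, 0 <= K & forall t, (seminorm m n (Phi t) <= K%:E)%E).
Proof.
move=> [G [<- H]].
have sm t : csmooth (G 0%N t) /\ forall n, cderiv n (G 0%N t) = G n t.
  by apply: (@chain_cderiv (fun n => G n t)) => n; have [] := H n.
have bd m n : exists2 K : R, 0 <= K & forall t, (seminorm m n (G 0%N t) <= K%:E)%E.
  have [_ /(_ m) [K K0 k]] := H n; exists K => // t; apply: ge_ereal_sup => _ [x _ <-].
  rewrite lee_fin; have [_ ->] := sm t; apply: le_trans (k t x).
  by rewrite ler_wpM2r ?cabs_ge0// lerXn2r ?nnegrE ?wt_ge0// norm_le_wt.
split=> // t; split; first by have [] := sm t.
by move=> m n; have [K K0 /(_ t)/le_lt_trans] := bd m n; apply; rewrite ltry.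
Qed.

Lemma schP f : schwartz f <-> sch f.
Proof.
split=> [[sm dc]|/usch_schwartz[/(_ tt)]//].
exists (fun n _ => cderiv n f); split.
  by apply/funext => _; apply/funext => x; rewrite /cderiv /= /re /im; case: (f x).
move=> n; split=> [_|m]; first exact: csmooth_cD.
have bd p : exists2 K : R, 0 <= K & forall x, `|x| ^+ p * cabs (cderiv n f x) <= K.
  have := dc p n; rewrite /seminorm.
  set S := ereal_sup _ => Soo.
  have le x : ((`|x| ^+ p * cabs (cderiv n f x))%:E <= S)%E.
    by apply: ereal_sup_ubound; exists x.
  have S0 : (0 <= S)%E.
    by apply: le_trans (le 0); rewrite lee_fin mulr_ge0 ?exprn_ge0 ?cabs_ge0.
  have Sfin : S \is a fin_num by rewrite ge0_fin_numE.
  exists (fine S) => [|x]; first exact: fine_ge0.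
  by rewrite -lee_fin fineK.
have [K0 K00 k0] := bd 0%N; have [Km Km0 km] := bd m.
exists (2 ^+ m * (K0 + Km)); first by rewrite mulr_ge0 ?addr_ge0 ?exprn_ge0.
move=> _ x; apply: le_trans (ler_wpM2r (cabs_ge0 _) (wtX_le x m)) _.
rewrite -mulrA ler_wpM2l ?exprn_ge0// mulrDl lerD//.
by have := k0 x; rewrite expr0.
Qed.

Lemma sch_deriv f : sch f -> exists2 f', cD f f' & sch f'.
Proof.
move=> /uchain_deriv[F d h]; exists (F tt); first exact: d.
exact: (usch_at (fun _ : unit => tt) h).
Qed.

Lemma usch_sch T (Phi : T -> R -> C) t : usch Phi -> sch (Phi t).
Proof. by move=> h; exact: (usch_at (fun _ : unit => t) h). Qed.

Lemma sch_bound f m : sch f -> exists2 K : R, 0 <= K &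
  forall x, wt x ^+ m * cabs (f x) <= K.
Proof. by move=> /uchain_bound/(_ m)[K K0 k]; exists K => // x; exact: (k tt). Qed.

End Schwartz.

(** * Integration of complex-valued functions *)

Section ComplexMeasurable.
Context d (T : measurableType d) (R : realType).
Local Notation C := R[i].
Implicit Types (f g : T -> C) (A : set T).

Definition cmeas A f := measurable_fun A (fun x => complex.Re (f x)) /\
  measurable_fun A (fun x => complex.Im (f x)).

Lemma cmeasD A f g : cmeas A f -> cmeas A g -> cmeas A (fun x => f x + g x).
Proof.
move=> [f1 f2] [g1 g2]; split.
- by under eq_fun do rewrite ReD; exact: measurable_funD.
- by under eq_fun do rewrite ImD; exact: measurable_funD.
Qed.

Lemma cmeasM A f g : cmeas A f -> cmeas A g -> cmeas A (fun x => f x * g x).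
Proof.
move=> [f1 f2] [g1 g2]; split.
- by under eq_fun do rewrite ReM; apply: measurable_funB; exact: measurable_funM.
- by under eq_fun do rewrite ImM; apply: measurable_funD; exact: measurable_funM.
Qed.

Lemma cmeas_cst A (z : C) : cmeas A (fun=> z).
Proof. by split; exact: measurable_cst. Qed.

Lemma cmeas_rc A (f : T -> R) : measurable_fun A f -> cmeas A (fun x => rc (f x)).
Proof. by move=> mf; split=> //; exact: measurable_cst. Qed.

Lemma cmeas_cabs A f : measurable A -> cmeas A f ->
  measurable_fun A (fun x => cabs (f x)).
Proof.
move=> mA [f1 f2].
rewrite (_ : (fun x => _) = fun x => Num.sqrt ((complex.Re (f x)) ^+ 2 + (complex.Im (f x)) ^+ 2)).
  apply: (measurableT_comp (continuous_measurable_fun (@sqrt_continuous R))).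
  by apply: measurable_funD; exact: measurable_funX.
by apply/funext => x; rewrite /cabs; case: (f x).
Qed.

End ComplexMeasurable.

Section ComplexIntegral.
Variable R : realType.
Local Notation C := R[i].
Local Notation mu := (@lebesgue_measure R).
Implicit Types (f g : R -> C) (A : set R).

Lemma cD_cmeas f f' : cD f f' -> cmeas setT f.
Proof.
by move=> /cD_continuous[c1 c2]; split; exact: continuous_measurable_fun.
Qed.

Lemma cintegrable_meas A f : measurable A -> cintegrable A f -> cmeas A f.
Proof.
move=> mA [/integrableP[m1 _] /integrableP[m2 _]].
by split; exact/measurable_EFinP.
Qed.

Lemma cintegrable_dom A f (G : R -> R) : measurable A -> cmeas A f ->
  mu.-integrable A (EFin \o G) -> (forall x, A x -> cabs (f x) <= G x) ->
  cintegrable A f.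
Proof.
move=> mA [m1 m2] iG fG.
have H (u : R -> R) : measurable_fun A u ->
    (forall x, A x -> `|u x| <= cabs (f x)) -> mu.-integrable A (EFin \o u).
  move=> mu_ uf; apply: le_integrable iG => //; first exact/measurable_EFinP.
  move=> x Ax; rewrite /= lee_fin.
  by rewrite (le_trans (uf _ Ax))// (le_trans (fG _ Ax))// ler_norm.
by split; apply: H => // x _; rewrite ?cabs_Re ?cabs_Im.
Qed.

Lemma cintegrable_cabs A f : measurable A -> cintegrable A f ->
  mu.-integrable A (EFin \o (fun x => cabs (f x))).
Proof.
move=> mA fi; have mf := cintegrable_meas mA fi; case: fi => i1 i2.
have i12 := integrableD (mu := mu) mA (integrable_norm i1) (integrable_norm i2).
apply: le_integrable i12 => //.
  by apply/measurable_EFinP; exact: cmeas_cabs.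
move=> x Ax; rewrite lee_fin [leLHS]ger0_norm ?cabs_ge0// [leRHS]ger0_norm ?addr_ge0 ?normr_ge0//.
exact: cabs_le_ReIm.
Qed.

Lemma cintegrableD A f g : measurable A -> cintegrable A f -> cintegrable A g ->
  cintegrable A (fun x => f x + g x).
Proof.
move=> mA [f1 f2] [g1 g2]; split.
- apply: eq_integrable (integrableD (mu := mu) mA f1 g1) => // x _.
  by rewrite /= /re ReD.
- apply: eq_integrable (integrableD (mu := mu) mA f2 g2) => // x _.
  by rewrite /= /im ImD.
Qed.

Lemma cintegrableZ A z f : measurable A -> cintegrable A f ->
  cintegrable A (fun x => z * f x).
Proof.
move=> mA fi; apply: (@cintegrable_dom _ _ (fun x => cabs z * cabs (f x))) => //.
- by apply: cmeasM; [exact: cmeas_cst|exact: cintegrable_meas].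
- exact: (integrableZl (mu := mu) mA (cabs z) (cintegrable_cabs mA fi)).
- by move=> x _; rewrite cabsM.
Qed.

Lemma cintD A f g : measurable A -> cintegrable A f -> cintegrable A g ->
  cint A (fun x => f x + g x) = cint A f + cint A g.
Proof.
move=> mA [f1 f2] [g1 g2]; rewrite /cint; apply: complex_ext => /=.
- by rewrite -RintegralD//; apply: eq_Rintegral => x _; rewrite /re ReD.
- by rewrite -RintegralD//; apply: eq_Rintegral => x _; rewrite /im ImD.
Qed.

Lemma integrableZR A k (u : R -> R) : measurable A -> mu.-integrable A (EFin \o u) ->
  mu.-integrable A (EFin \o (fun x => k * u x)).
Proof. by move=> mA ui; exact: (integrableZl (mu := mu) mA k ui). Qed.

Lemma cintZ A z f : measurable A -> cintegrable A f ->
  cint A (fun x => z * f x) = z * cint A f.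
Proof.
move=> mA [f1 f2]; case: z => a b; rewrite /cint; apply: complex_ext => /=.
- rewrite -!RintegralZl// -RintegralB//; try exact: integrableZR.
  by apply: eq_Rintegral => x _; rewrite /re ReM.
- rewrite -!RintegralZl// -RintegralD//; try exact: integrableZR.
  by apply: eq_Rintegral => x _; rewrite /im ImM.
Qed.

Lemma cintZr A z f : measurable A -> cintegrable A f ->
  cint A (fun x => f x * z) = cint A f * z.
Proof.
move=> mA fi; rewrite mulrC -cintZ//; congr cint.
by apply/funext => x; rewrite mulrC.
Qed.

Lemma cintB A f g : measurable A -> cintegrable A f -> cintegrable A g ->
  cint A (fun x => f x - g x) = cint A f - cint A g.
Proof.
move=> mA fi gi; rewrite -[- cint A g]mulN1r -cintZ// -cintD//.
  by congr cint; apply/funext => x; rewrite mulN1r.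
exact: cintegrableZ.
Qed.

Lemma cintegrable_sum A (I : Type) (r : seq I) (F : I -> R -> C) : measurable A ->
  (forall i, cintegrable A (F i)) -> cintegrable A (fun x => \sum_(i <- r) F i x).
Proof.
move=> mA Fi; elim: r => [|i r IH].
  under eq_fun do rewrite big_nil.
  by split; exact: integrable0.
under eq_fun do rewrite big_cons.
exact: cintegrableD.
Qed.

Lemma cint_sum A (I : Type) (r : seq I) (F : I -> R -> C) : measurable A ->
  (forall i, cintegrable A (F i)) ->
  cint A (fun x => \sum_(i <- r) F i x) = \sum_(i <- r) cint A (F i).
Proof.
move=> mA Fi; elim: r => [|i r IH].
  rewrite big_nil; under eq_fun do rewrite big_nil.
  by rewrite /cint; apply: complex_ext => /=; rewrite Rintegral_cst// mul0r.
rewrite big_cons; under eq_fun do rewrite big_cons.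
by rewrite cintD// ?IH//; exact: cintegrable_sum.
Qed.

Lemma eq_cint A f g : (forall x, A x -> f x = g x) -> cint A f = cint A g.
Proof.
move=> fg; rewrite /cint; congr Complex; apply: eq_Rintegral => x;
  by rewrite inE => Ax; rewrite /re /im fg.
Qed.

Lemma eq_cintegrable A f g : measurable A -> (forall x, A x -> f x = g x) ->
  cintegrable A f -> cintegrable A g.
Proof.
move=> mA fg [f1 f2]; split; [move: f1|move: f2]; apply: eq_integrable => // x;
  by rewrite inE => Ax; rewrite /= /re /im fg.
Qed.

(** Real and imaginary parts are estimated separately; the resulting factor two is
    harmless because no constant below needs to be sharp. *)
Lemma cabs_cint_le A f (G : R -> R) : measurable A -> cintegrable A f ->
  mu.-integrable A (EFin \o G) -> (forall x, A x -> cabs (f x) <= G x) ->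
  cabs (cint A f) <= 2 * Rintegral mu A G.
Proof.
move=> mA fi iG fG; case: (fi) => f1 f2.
apply: (le_trans (cabs_le_ReIm _)).
have H (u : R -> R) : mu.-integrable A (EFin \o u) ->
    (forall x, A x -> `|u x| <= cabs (f x)) -> `|Rintegral mu A u| <= Rintegral mu A G.
  move=> ui uf; apply: (le_trans (le_normr_Rintegral (mu := mu) mA ui)).
  apply: le_Rintegral => //; first exact: integrable_norm.
  by move=> x Ax; rewrite (le_trans (uf _ Ax))// fG.
have h1 := H _ f1 (fun x _ => cabs_Re (f x)).
have h2 := H _ f2 (fun x _ => cabs_Im (f x)).
by rewrite /cint /= mulr_natl mulr2n lerD.
Qed.

Lemma cint_setT_restrict A f : measurable A ->
  cint A f = cint setT (fun x => f x * rc (\1_A x)).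
Proof.
move=> mA; rewrite /cint; congr Complex; rewrite Rintegral_mkcond;
  apply: eq_Rintegral => x _; rewrite /patch /re /im ?ReM ?ImM indicE /=;
  by case: (x \in A); rewrite /= ?mulr1 ?mulr0 ?subr0 ?addr0 ?add0r.
Qed.

Lemma cintegrable_setT_restrict A f : measurable A ->
  cintegrable A f -> cintegrable setT (fun x => f x * rc (\1_A x)).
Proof.
move=> mA [f1 f2]; split.
- move/(integrable_mkcond (mu := mu) _ mA).1: f1; apply: eq_integrable => // x _.
  rewrite /patch /= /re ReM /= indicE.
  by case: (x \in A); rewrite /= ?mulr1 ?mulr0 ?subr0 ?addr0.
- move/(integrable_mkcond (mu := mu) _ mA).1: f2; apply: eq_integrable => // x _.
  rewrite /patch /= /im ImM /= indicE.
  by case: (x \in A); rewrite /= ?mulr1 ?mulr0 ?subr0 ?addr0 ?add0r.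
Qed.

Lemma cintegrableS A B f : measurable A -> measurable B -> A `<=` B ->
  cintegrable B f -> cintegrable A f.
Proof. by move=> mA mB AB [i1 i2]; split; [move: i1|move: i2]; exact: integrableS. Qed.

Definition ccvg (z : nat -> C) (l : C) := (fun n => cabs (z n - l)) @ \oo --> (0:R).

Lemma ccvg_Re z l : ccvg z l -> (fun n => complex.Re (z n)) @ \oo --> complex.Re l.
Proof.
move=> zl; apply/cvgrPdist_le => e e0; move/cvgr0Pnorm_le : zl => /(_ _ e0).
apply: filterS => n; rewrite ger0_norm ?cabs_ge0//; apply: le_trans.
by rewrite distrC -ReN -ReD cabs_Re.
Qed.

Lemma ccvg_Im z l : ccvg z l -> (fun n => complex.Im (z n)) @ \oo --> complex.Im l.
Proof.
move=> zl; apply/cvgrPdist_le => e e0; move/cvgr0Pnorm_le : zl => /(_ _ e0).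
apply: filterS => n; rewrite ger0_norm ?cabs_ge0//; apply: le_trans.
by rewrite distrC -ImN -ImD cabs_Im.
Qed.

Lemma ccvg_ReIm (z : nat -> C) (l : C) :
  (fun n => complex.Re (z n)) @ \oo --> complex.Re l ->
  (fun n => complex.Im (z n)) @ \oo --> complex.Im l -> ccvg z l.
Proof.
move=> h1 h2.
have h : (fun n => `|complex.Re (z n) - complex.Re l| +
    `|complex.Im (z n) - complex.Im l|) @ \oo --> (0 : R).
  have n0 : (0 : R) = `|0 : R| + `|0 : R| by rewrite normr0 addr0.
  by rewrite n0; apply: cvgD; apply: cvg_norm; apply/subr_cvg0.
apply: (squeeze_cvgr _ (cvg_cst 0) h).
near=> n; rewrite cabs_ge0 /=; apply: (le_trans (cabs_le_ReIm _)).
by rewrite ReD ImD ReN ImN.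
Unshelve. all: by end_near. Qed.

Lemma ccvg_unique z l l' : ccvg z l -> ccvg z l' -> l = l'.
Proof.
move=> h1 h2; apply: complex_ext.
- exact: (cvg_unique _ (ccvg_Re h1) (ccvg_Re h2)).
- exact: (cvg_unique _ (ccvg_Im h1) (ccvg_Im h2)).
Qed.

Lemma ccvg_bound z l (e : nat -> R) : (forall n, cabs (z n - l) <= e n) ->
  e @ \oo --> (0:R) -> ccvg z l.
Proof.
move=> h he; apply: (squeeze_cvgr _ (cvg_cst 0) he).
by apply: nearW => n; rewrite cabs_ge0 h.
Qed.

Lemma ccvg_cst l : ccvg (fun=> l) l.
Proof. by rewrite /ccvg subrr cabs0; exact: cvg_cst. Qed.

Lemma ccvgD y z l m : ccvg y l -> ccvg z m -> ccvg (fun n => y n + z n) (l + m).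
Proof.
move=> h1 h2; apply: ccvg_ReIm.
- under eq_fun do rewrite ReD; rewrite ReD.
  by apply: cvgD; exact: ccvg_Re.
- under eq_fun do rewrite ImD; rewrite ImD.
  by apply: cvgD; exact: ccvg_Im.
Qed.

Lemma ccvgZ w z l : ccvg z l -> ccvg (fun n => w * z n) (w * l).
Proof.
move=> h; rewrite /ccvg; under eq_fun do rewrite -mulrBr cabsM.
by rewrite -(mulr0 (cabs w)); apply: cvgM => //; exact: cvg_cst.
Qed.

Lemma ccvgZr w z l : ccvg z l -> ccvg (fun n => z n * w) (l * w).
Proof.
by move=> /(ccvgZ w); rewrite mulrC; under eq_fun do rewrite mulrC.
Qed.

Lemma ccvg_le z l (K : R) : ccvg z l -> (forall n, cabs (z n) <= K) -> cabs l <= K.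
Proof.
move=> h zK; apply/ler_addgt0Pr => e e0.
move/cvgr0Pnorm_lt : h => /(_ _ e0)[N _ /(_ N (leqnn _))] hN.
rewrite -(subKr (z N) l); apply: (le_trans (cabsB _ _)).
by rewrite lerD// ltW// (le_lt_trans _ hN)// ger0_norm ?cabs_ge0.
Qed.

Lemma cint_dct A (F : nat -> R -> C) f (G : R -> R) : measurable A ->
  (forall n, cmeas A (F n)) -> (forall x, A x -> ccvg (F ^~ x) (f x)) ->
  mu.-integrable A (EFin \o G) -> (forall n x, A x -> cabs (F n x) <= G x) ->
  cintegrable A f /\ ccvg (fun n => cint A (F n)) (cint A f).
Proof.
move=> mA mF Ff iG FG.
have H (u : nat -> R -> R) (v : R -> R) : (forall n, measurable_fun A (u n)) ->
    (forall x, A x -> u ^~ x @ \oo --> v x) ->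
    (forall n x, A x -> `|u n x| <= cabs (F n x)) ->
    mu.-integrable A (EFin \o v) /\
    (fun n => Rintegral mu A (u n)) @ \oo --> Rintegral mu A v.
  move=> mu_ uv uF.
  have mv : measurable_fun A v by apply: (measurable_fun_cvg mu_).
  have [||||iv _ cv] := @dominated_convergence _ _ _ mu A mA (fun n => EFin \o u n)
    (EFin \o v) (EFin \o G) _ _ _ iG _.
  - by move=> n; apply/measurable_EFinP; exact: mu_.
  - by apply/measurable_EFinP; exact: mv.
  - by apply: aeW => x Ax; apply: cvg_EFin; [exact: nearW|exact: uv].
  - by apply: aeW => x n Ax; rewrite lee_fin (le_trans (uF n x Ax))// FG.
  split=> //; apply: fine_cvg; rewrite fineK//.
  exact: integrable_fin_num.
have [i1 c1] := H _ _ (fun n => (mF n).1) (fun x Ax => ccvg_Re (Ff x Ax))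
  (fun n x _ => cabs_Re _).
have [i2 c2] := H _ _ (fun n => (mF n).2) (fun x Ax => ccvg_Im (Ff x Ax))
  (fun n x _ => cabs_Im _).
by split=> //; exact: ccvg_ReIm.
Qed.

End ComplexIntegral.

(** * Integrals over the real line *)

Section RealLine.
Variable R : realType.
Local Notation C := R[i].
Local Notation mu := (@lebesgue_measure R).
Implicit Types (f g : R -> C).

(** An integrable function with an explicit integral that dominates [wt x ^- 2], hence
    all rapidly decreasing functions. *)
Definition maj (x : R) : R := (1 + x ^+ 2)^-1.

Lemma maj_gt0 x : 0 < maj x.
Proof. by rewrite invr_gt0 ltr_wpDr ?sqr_ge0. Qed.

Lemma maj_ge0 x : 0 <= maj x. Proof. exact/ltW/maj_gt0. Qed.

Lemma maj_integrable : mu.-integrable setT (EFin \o maj).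
Proof.
have cm : continuous maj by exact: continuous_oneDsqrV.
apply/integrableP; split.
  by apply/measurable_EFinP; exact: continuous_measurable_fun.
under eq_integral => x _ do rewrite /= ger0_norm ?maj_ge0//.
rewrite ge0_symfun_integralT//; [|exact: maj_ge0|]; last first.
  by move=> x; rewrite /maj /= sqrrN.
rewrite -set_itvcy integral0y_oneDsqr -EFinM; exact: ltry.
Qed.

Lemma wt2_maj x : (wt x ^+ 2)^-1 <= maj x.
Proof.
rewrite /maj lef_pV2 ?posrE ?wtX_gt0 ?ltr_wpDr ?sqr_ge0//.
by rewrite /wt sqrrD expr1n mul1r real_normK ?num_real//; have := normr_ge0 x; lra.
Qed.

Lemma wt_le_maj (z : C) x (K : R) : wt x ^+ 2 * cabs z <= K -> cabs z <= K * maj x.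
Proof.
move=> h; apply: (@le_trans _ _ (K * (wt x ^+ 2)^-1)).
  by rewrite ler_pdivlMr ?wtX_gt0// mulrC.
rewrite ler_wpM2l ?wt2_maj//; apply: le_trans h.
by rewrite mulr_ge0 ?wtX_ge0 ?cabs_ge0.
Qed.

Definition L1dom f := cmeas setT f /\ exists2 K : R, 0 <= K & forall x, cabs (f x) <= K * maj x.

Lemma majZ_integrable (K : R) : mu.-integrable setT (EFin \o (fun x => K * maj x)).
Proof. by apply: integrableZR => //; exact: maj_integrable. Qed.

Lemma L1dom_integrable f : L1dom f -> cintegrable setT f.
Proof.
move=> [mf [K K0 fK]]; apply: (cintegrable_dom _ mf (majZ_integrable K)) => //.
Qed.

Lemma sch_cmeas f : sch f -> cmeas setT f.
Proof. by move=> /sch_deriv[f' df _]; exact: cD_cmeas df. Qed.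

Lemma sch_L1dom f : sch f -> L1dom f.
Proof.
move=> h; split; first exact: sch_cmeas.
have [K K0 k] := sch_bound 2 h; exists K => // x.
exact: wt_le_maj.
Qed.

Lemma sch_integrable f : sch f -> cintegrable setT f.
Proof. by move/sch_L1dom/L1dom_integrable. Qed.

Lemma L1domM f g (K : R) : cmeas setT g -> (forall x, cabs (g x) <= K) ->
  L1dom f -> L1dom (fun x => f x * g x).
Proof.
move=> mg gK [mf [L L0 fL]]; split; first exact: cmeasM.
have K0 : 0 <= K by apply: le_trans (gK 0); exact: cabs_ge0.
exists (K * L); first exact: mulr_ge0.
move=> x; rewrite cabsM [K * L]mulrC mulrAC.
by rewrite ler_pM ?cabs_ge0.
Qed.

(** Domination by a product makes [H] jointly integrable.  The measurability of the
    inner integral is needed when it is later integrated against something else. *)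
Lemma cint_fubini (H : R * R -> C) (G1 G2 : R -> R) :
  cmeas setT H ->
  mu.-integrable setT (EFin \o G1) -> mu.-integrable setT (EFin \o G2) ->
  (forall x y, cabs (H (x, y)) <= G1 x * G2 y) ->
  cmeas setT (fun y => cint setT (fun x => H (x, y))) /\
  cint setT (fun x => cint setT (fun y => H (x, y))) =
  cint setT (fun y => cint setT (fun x => H (x, y))).
Proof.
move=> [m1 m2] i1 i2 HG.
have F (h : R * R -> R) : measurable_fun setT h ->
    (forall z, `|h z| <= cabs (H z)) ->
    measurable_fun setT (fun y => Rintegral mu setT (fun x => h (x, y))) /\
    Rintegral mu setT (fun x => Rintegral mu setT (fun y => h (x, y))) =
    Rintegral mu setT (fun y => Rintegral mu setT (fun x => h (x, y))).
  move=> mh hH.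
  have mG1 : measurable_fun setT (fun x => `|G1 x|%:E).
    by apply/measurable_EFinP; apply: measurableT_comp => //; case/integrableP: i1 => /measurable_EFinP.
  have mG2 : measurable_fun setT (fun x => `|G2 x|%:E).
    by apply/measurable_EFinP; apply: measurableT_comp => //; case/integrableP: i2 => /measurable_EFinP.
  have hG x y : `|h (x, y)| <= `|G1 x| * `|G2 y|.
    by rewrite (le_trans (hH _))// (le_trans (HG _ _))// -normrM ler_norm.
  have ih : (mu \x mu)%E.-integrable setT (EFin \o h).
    apply/integrable12ltyP; first exact/measurable_EFinP.
    apply: (@le_lt_trans _ _ (\int[mu]_x (`|G1 x|%:E * \int[mu]_y `|G2 y|%:E))%E).
      apply: ge0_le_integral => //.
      - by move=> x _; exact: integral_ge0.
      - apply: (@measurable_fun_fubini_tonelli_F _ _ _ _ _ mu (fun z => `|(EFin \o h) z|%E)) => //.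
        by apply: measurableT_comp => //; exact/measurable_EFinP.
      - by apply: emeasurable_funM => //; exact: measurable_cst.
      - move=> x _; rewrite -ge0_integralZl//; apply: ge0_le_integral => //.
        + apply: measurableT_comp => //; apply/measurable_EFinP.
          exact: (measurableT_comp mh (pair1_measurable x)).
        + exact: emeasurable_funM.
        + by move=> y _; rewrite /= -EFinM lee_fin hG.
    rewrite ge0_integralZr//; last exact: integral_ge0.
    move/integrableP: i1 => [_ l1]; move/integrableP: i2 => [_ l2].
    by rewrite lte_mul_pinfty// ?integral_ge0// ge0_fin_numE// integral_ge0.
  split; first exact: (measurableT_comp (@fine_measurable R setT measurableT) (measurable_fubini_G ih)).
  have := @Fubini _ _ _ _ R mu mu (EFin \o h) ih.
  have /integrable12ltyP ih1 := ih; have /integrable21ltyP ih2 := ih.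
  rewrite /Rintegral => E; congr fine.
  have ii x : mu.-integrable setT (EFin \o (fun y => h (x, y))).
    apply: (@le_integrable _ _ _ mu setT _ _ (EFin \o (fun y => `|G1 x| * `|G2 y|))).
    - exact: measurableT.
    - apply/measurable_EFinP; exact: (measurableT_comp mh (pair1_measurable x)).
    - by move=> y _; rewrite /= lee_fin [leRHS]ger0_norm ?mulr_ge0.
    - by apply: integrableZR => //; exact: integrable_norm.
  have jj y : mu.-integrable setT (EFin \o (fun x => h (x, y))).
    apply: (@le_integrable _ _ _ mu setT _ _ (EFin \o (fun x => `|G2 y| * `|G1 x|))).
    - exact: measurableT.
    - apply/measurable_EFinP; exact: (measurableT_comp mh (pair2_measurable y)).
    - by move=> x _; rewrite /= lee_fin [leRHS]ger0_norm ?mulr_ge0// mulrC.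
    - by apply: integrableZR => //; exact: integrable_norm.
  transitivity (\int[mu]_x \int[mu]_y (EFin \o h) (x, y))%E.
    by apply: eq_integral => x _; rewrite fineK//; exact: (integrable_fin_num _ (ii x)).
  rewrite E; apply: eq_integral => y _; rewrite fineK//; exact: (integrable_fin_num _ (jj y)).
have [n1 e1] := F (fun z => complex.Re (H z)) m1 (fun z => cabs_Re _).
have [n2 e2] := F (fun z => complex.Im (H z)) m2 (fun z => cabs_Im _).
split; first exact: (conj n1 n2).
by apply: complex_ext; [exact: e1|exact: e2].
Qed.

Lemma ge0_integral_affine (G : R -> R) (a b : R) : 0 < a -> continuous G ->
  (forall x, 0 <= G x) ->
  (\int[mu]_x (G (a * x + b))%:E = a^-1%:E * \int[mu]_x (G x)%:E)%E.
Proof.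
move=> a0 cG G0; pose F x := a * x + b.
have dF x : is_derive x (1:R) F a by exact: is_derive_affine.
have F' : derive1 F = cst a by apply/funext => x; rewrite derive1E; exact: derive_val.
have cF : continuous F.
  by move=> x; apply/differentiable_continuous/derivable1_diffP; case: (dF x).
rewrite (@increasing_ge0_integration_by_substitutionT _ F G)//.
- rewrite F' -ge0_integralZl//.
  + apply: eq_integral => x _; rewrite /= -EFinM; congr EFin.
    change (G (F x) = a^-1 * (G (F x) * a)).
    by rewrite [RHS]mulrC -mulrA divff ?gt_eqF// mulr1.
  + apply/measurable_EFinP; apply: measurable_funM => //.
    apply: continuous_measurable_fun => x; apply: continuous_comp; first exact: cF.
    exact: cG.
  + by move=> x _; rewrite lee_fin; apply: mulr_ge0; [exact: G0|exact: ltW].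
  + by rewrite lee_fin invr_ge0 ltW.
- by move=> x y xy; rewrite /F ltrD2r ltr_pM2l.
- by rewrite F'; exact: cst_continuous.
- by rewrite F'; exact: is_cvg_cst.
- by rewrite F'; exact: is_cvg_cst.
- apply/cvgrNyPle => M; exists ((M - b) / a); split; first exact: num_real.
  by move=> x /ltW; rewrite ler_pdivlMr// mulrC lerBrDr.
- apply/cvgryPge => M; exists ((M - b) / a); split; first exact: num_real.
  by move=> x /ltW; rewrite ler_pdivrMr// mulrC lerBlDr.
Qed.

(** The substitution rule is available for nonnegative integrands: apply it to [`|g|]
    and to [`|g| + g]. *)
Lemma Rintegral_affine (g : R -> R) (a b : R) : 0 < a -> continuous g ->
  mu.-integrable setT (EFin \o g) ->
  mu.-integrable setT (EFin \o (fun x => g (a * x + b))) /\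
  Rintegral mu setT (fun x => g (a * x + b)) = a^-1 * Rintegral mu setT g.
Proof.
move=> a0 cg ig.
have S (G : R -> R) : continuous G -> (forall x, 0 <= G x) ->
    (\int[mu]_x (G (a * x + b))%:E = a^-1%:E * \int[mu]_x (G x)%:E)%E.
  by move=> cG G0; exact: ge0_integral_affine.
have cs (G : R -> R) : continuous G -> continuous (fun x => G (a * x + b)).
  move=> cG x; apply: continuous_comp; last exact: cG.
  by apply: cvgD; [apply: cvgM; [exact: cvg_cst|exact: cvg_id]|exact: cvg_cst].
have cn : continuous (fun x => `|g x|).
  by move=> x; apply: continuous_comp; [exact: cg|exact: norm_continuous].
have is1 : mu.-integrable setT (EFin \o (fun x => g (a * x + b))).
  apply/integrableP; split.
    by apply/measurable_EFinP; apply: continuous_measurable_fun; exact: cs.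
  rewrite /= (S (fun x => `|g x|))// lte_mul_pinfty ?lee_fin ?invr_ge0 ?ltW//.
  by case/integrableP: ig.
split=> //.
have cp : continuous (fun x => `|g x| + g x) by move=> x; apply: cvgD; [exact: cn|exact: cg].
have p0 x : 0 <= `|g x| + g x by have := ler_norm (- g x); rewrite normrN; lra.
have Fi (G : R -> R) : mu.-integrable setT (EFin \o G) ->
    (\int[mu]_x (G x)%:E)%E = (Rintegral mu setT G)%:E.
  by move=> Gi; rewrite fineK//; exact: (integrable_fin_num _ Gi).
have ii := integrable_norm ig.
have E1 : Rintegral mu setT (fun x => `|g (a * x + b)|) =
    a^-1 * Rintegral mu setT (fun x => `|g x|).
  by rewrite {1}/Rintegral (S (fun x => `|g x|))// (Fi (fun x => `|g x|))// -EFinM.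
have ip : mu.-integrable setT (EFin \o (fun x => `|g x| + g x)).
  exact: (integrableD (mu := mu) measurableT ii ig).
have E2 : Rintegral mu setT (fun x => `|g (a * x + b)| + g (a * x + b)) =
    a^-1 * Rintegral mu setT (fun x => `|g x| + g x).
  rewrite {1}/Rintegral (S (fun x => `|g x| + g x))//.
  by rewrite (Fi (fun x => `|g x| + g x))// -EFinM.
move: E2; rewrite RintegralD//; last exact: (integrable_norm is1).
rewrite E1 RintegralD// mulrDr.
exact: addrI.
Qed.

Definition ccont f := continuous (re f) /\ continuous (im f).

Lemma cint_affine f (a b : R) : 0 < a -> ccont f -> cintegrable setT f ->
  cint setT (fun x => f (a * x + b)) = rc a^-1 * cint setT f.
Proof.
move=> a0 [c1 c2] [i1 i2]; apply: complex_ext; rewrite ?ReM ?ImM /= mul0r ?subr0 ?addr0.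
- by have [_ <-] := Rintegral_affine b a0 c1 i1.
- by have [_ <-] := Rintegral_affine b a0 c2 i2.
Qed.

Lemma cint_shift f (y : R) : ccont f -> cintegrable setT f ->
  cint setT (fun x => f (x + y)) = cint setT f.
Proof.
move=> cf fi; have := cint_affine y ltr01 cf fi.
by rewrite invr1 rc1 mul1r => <-; apply: eq_cint => x _; rewrite mul1r.
Qed.

Lemma cint_FTC f f' (a b : R) : a < b -> cD f f' -> ccont f' ->
  cint `[a, b] f' = f b - f a.
Proof.
move=> ab df [c1 c2].
have F (u v : R -> R) : (forall x : R, is_derive x (1:R) u (v x)) -> continuous v ->
    Rintegral mu `[a, b] v = u b - u a.
  move=> d c; rewrite /Rintegral (@continuous_FTC2 _ v u)//.
  - exact: continuous_subspaceT.
  - have cu : continuous u.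
      by move=> x; apply/differentiable_continuous/derivable1_diffP; case: (d x).
    split.
    + by move=> x _; case: (d x).
    + exact/cvg_at_right_filter/cu.
    + exact/cvg_at_left_filter/cu.
  - by move=> x _; rewrite derive1E; case: (d x).
rewrite /cint; apply: complex_ext => /=; rewrite ?ReD ?ReN ?ImD ?ImN.
- by apply: (F (re f)) => // x; case: (df x).
- by apply: (F (im f)) => // x; case: (df x).
Qed.

Lemma cint_exhaust f (A : set R) (B : nat -> set R) : measurable A ->
  (forall n, measurable (B n)) -> (forall n, B n `<=` A) ->
  (forall x, A x -> \forall n \near \oo, B n x) ->
  cintegrable A f -> ccvg (fun n => cint (B n) f) (cint A f).
Proof.
move=> mA mB BA BAx fi.
have iA := cintegrable_setT_restrict mA fi.
have mf := cintegrable_meas mA fi.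
pose F n x := f x * rc (\1_(B n) x : R).
have E n : cint (B n) f = cint A (F n).
  rewrite (cint_setT_restrict _ (mB n)) (cint_setT_restrict _ mA).
  apply: eq_cint => x _; rewrite /F -mulrA -rcM; congr (_ * rc _).
  rewrite !indicE; have [xB|] := boolP (x \in B n); rewrite ?mul0r// mul1r.
  by rewrite mem_set//; apply: (BA n); exact: (set_mem xB).
under eq_fun do rewrite E.
have iG := cintegrable_cabs mA fi.
apply: (cint_dct (F := F) mA _ _ iG _).2.
- move=> n; apply: cmeasM => //; apply: cmeas_rc.
  by apply: measurable_funTS; exact/measurable_indicP.
- move=> x Ax; apply: cvg_near_cst; have := BAx x Ax; apply: filterS => n Bx.
  by rewrite /F indicE mem_set// rc1 mulr1 subrr cabs0.
- move=> n x Ax; rewrite /F cabsM cabs_rc ler_piMr ?cabs_ge0// indicE.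
  by case: (_ \in _); rewrite ?normr1 ?normr0.
Qed.

End RealLine.

Section SchwartzIntegral.
Variable R : realType.
Local Notation C := R[i].
Local Notation mu := (@lebesgue_measure R).
Implicit Types (f g : R -> C).

Lemma sch_ccont f : sch f -> ccont f.
Proof. by move=> /sch_deriv[f' df _]; exact: cD_continuous df. Qed.

Lemma sch_shift f y : sch f -> sch (fun x => f (x + y)).
Proof. exact: usch_shift. Qed.

Lemma sch_vanish f (u : nat -> R) : sch f -> (forall n, n.+1%:R <= wt (u n)) ->
  ccvg (fun n => f (u n)) 0.
Proof.
move=> sf un; have [K K0 k] := sch_bound 1 sf.
apply: (@ccvg_bound _ _ _ (fun n => K * n.+1%:R^-1)); last first.
  by rewrite -(mulr0 K); apply: cvgM; [exact: cvg_cst|exact: cvg_harmonic].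
move=> n; rewrite subr0 ler_pdivlMr ?ltr0n// mulrC.
apply: le_trans (k (u n)); rewrite expr1 ler_wpM2r ?cabs_ge0//; exact: un.
Qed.

Lemma sch_int_right f f' (x : R) : sch f -> cD f f' -> sch f' ->
  cint `[x, +oo[ f' = - f x.
Proof.
move=> sf df sf'.
have h1 : ccvg (fun n => cint `[x, n.+1%:R + x] f') (cint `[x, +oo[ f').
  apply: cint_exhaust => //.
  - by move=> n y /=; rewrite !in_itv /= andbT => /andP[].
  - move=> y /=; rewrite in_itv /= andbT => xy.
    near=> n; rewrite /= in_itv /= xy /= -lerBlDr.
    apply: (@le_trans _ _ n%:R); last by rewrite ler_nat.
    by near: n; exact: nbhs_infty_ger.
  - by apply: cintegrableS (sch_integrable sf').
apply: ccvg_unique h1 _; rewrite -[- f x]add0r.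
under eq_fun do rewrite (cint_FTC _ df (sch_ccont sf')) ?ltrDr ?ltr0n//.
apply: ccvgD; last exact: ccvg_cst.
apply: (sch_vanish (sch_shift x sf)) => n.
by rewrite /wt ger0_norm// -natr1; lra.
Unshelve. all: by end_near. Qed.

Lemma sch_int_deriv f f' : sch f -> cD f f' -> sch f' -> cint setT f' = 0.
Proof.
move=> sf df sf'.
have h1 : ccvg (fun n => cint `[- n.+1%:R, n.+1%:R] f') (cint setT f').
  apply: cint_exhaust => //.
  - move=> y _; near=> n; rewrite /= in_itv /= -ler_norml.
    apply: (@le_trans _ _ n%:R); last by rewrite ler_nat.
    by near: n; exact: nbhs_infty_ger.
  - exact: sch_integrable.
apply: ccvg_unique h1 _; rewrite -[0]addr0 -{2}oppr0.
under eq_fun do rewrite (cint_FTC _ df (sch_ccont sf')) ?gt0_cp// ?ltr0n//.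
have v (u : nat -> R) : (forall n, `|u n| = n.+1%:R) -> ccvg (fun n => f (u n)) 0.
  by move=> un; apply: sch_vanish => // n; rewrite /wt un; lra.
apply: ccvgD; first by apply: v => n; rewrite ger0_norm.
have := ccvgZ (-1) (v (fun n => - n.+1%:R) _).
rewrite mulN1r oppr0; under eq_fun do rewrite mulN1r.
by apply => n; rewrite normrN ger0_norm.
Unshelve. all: by end_near. Qed.

(** Differentiation under the integral sign. *)
Lemma cD_cint (A : set R) (F F' : R -> R -> C) (G : R -> R) : measurable A ->
  (forall y, A y -> cD (F^~ y) (F'^~ y)) ->
  (forall x, cintegrable A (F x)) -> mu.-integrable A (EFin \o G) ->
  (forall x y, A y -> cabs (F' x y) <= G y) ->
  cD (fun x => cint A (F x)) (fun x => cint A (F' x)).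
Proof.
move=> mA dF iF iG F'G x.
have H (u u' : R -> R -> R) :
    (forall y, A y -> forall x : R, is_derive x (1:R) (u^~ y) (u' x y)) ->
    (forall x, mu.-integrable A (EFin \o (u x))) ->
    (forall x y, A y -> `|u' x y| <= G y) ->
    is_derive x (1:R) (fun x => Rintegral mu A (u x)) (Rintegral mu A (u' x)).
  move=> du iu u'G.
  have xI : `]x - 1, x + 1[%classic x by rewrite /= in_itv /=; apply/andP; split; lra.
  have E z y : A y -> partial1of2 u z y = u' z y.
    by move=> Ay; rewrite partial1of2E; case: (du y Ay z).
  have d1 : forall z y, `]x - 1, x + 1[%classic z -> A y -> derivable (u^~ y) z 1.
    by move=> z y _ Ay; case: (du y Ay z).
  have d2 : forall z y, `]x - 1, x + 1[%classic z -> A y -> `|partial1of2 u z y| <= `|G y|.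
    by move=> z y _ Ay; rewrite E// (le_trans (u'G _ _ Ay))// ler_norm.
  have iG' := integrable_norm iG.
  have n0 : forall y, 0 <= `|G y| by [].
  have i1 : forall z, `]x - 1, x + 1[%classic z -> mu.-integrable A (EFin \o u z).
    by move=> z _; exact: iu.
  have D := derivable_under_integral (mu := mu) mA xI i1 d1 n0 iG' d2.
  have D' := differentiation_under_integral (mu := mu) mA xI i1 d1 n0 iG' d2.
  apply: (DeriveDef D); rewrite -derive1E D'.
  by apply: eq_Rintegral => y; rewrite inE => Ay; exact: E.
split.
- apply: (H (fun x y => complex.Re (F x y)) (fun x y => complex.Re (F' x y))).
  + by move=> y Ay z; case: (dF y Ay z).
  + by move=> z; case: (iF z).
  + by move=> z y Ay; rewrite (le_trans (cabs_Re _))// F'G.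
- apply: (H (fun x y => complex.Im (F x y)) (fun x y => complex.Im (F' x y))).
  + by move=> y Ay z; case: (dF y Ay z).
  + by move=> z; case: (iF z).
  + by move=> z y Ay; rewrite (le_trans (cabs_Im _))// F'G.
Qed.

End SchwartzIntegral.

(** * The Fourier transform on Schwartz functions *)

Section FourierTransform.
Variable R : realType.
Local Notation C := R[i].
Local Notation mu := (@lebesgue_measure R).
Implicit Types (f g : R -> C).

(** Both transforms at once: [c = - (2 * pi)] and [c = 2 * pi]. *)
Definition FT (c : R) f : R -> C := fun x =>
  cint setT (fun y => f y * expi (c * y * x)).

Lemma cD_expi_lin (c x : R) :
  cD (fun y => expi (c * y * x)) (fun y => Complex 0 (c * x) * expi (c * y * x)).
Proof. by apply: cDext (cD_expi (c * x)) => y; rewrite mulrAC. Qed.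

Lemma cmeas_expi (c x : R) : cmeas setT (fun y => expi (c * y * x)).
Proof. exact: cD_cmeas (cD_expi_lin c x). Qed.

Lemma FT_integrand c f x : L1dom f -> L1dom (fun y => f y * expi (c * y * x)).
Proof.
by apply: L1domM; [exact: cmeas_expi|move=> y; rewrite cabs_expi].
Qed.

Lemma FT_bound c f (K : R) : cmeas setT f -> (forall x, cabs (f x) <= K * maj x) ->
  forall x, cabs (FT c f x) <= 2 * (K * Rintegral mu setT (@maj R)).
Proof.
move=> mf fK x.
have K0 : 0 <= K.
  have := fK 0; rewrite /maj expr0n addr0 invr1 mulr1; apply: le_trans.
  exact: cabs_ge0.
rewrite -RintegralZl//; last exact: maj_integrable.
apply: cabs_cint_le => //; first last.
- by move=> y _; rewrite cabsM cabs_expi mulr1.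
- exact: majZ_integrable.
- by apply: L1dom_integrable; apply: FT_integrand; split=> //; exists K.
Qed.

Lemma FT_cD c f : L1dom f -> L1dom (fun y => rc y * f y) ->
  cD (FT c f) (FT c (fun y => Complex 0 c * (rc y * f y))).
Proof.
move=> Lf Lyf; have [myf [K K0 k]] := Lyf.
apply: (@cD_cint _ setT (fun x y => f y * expi (c * y * x))
  (fun x y => Complex 0 c * (rc y * f y) * expi (c * y * x))
  (fun y => (`|c| * K) * maj y)) => //.
- move=> y _; apply: cDext (cDZ (f y) (cD_expi (c * y))) => x //.
  by rewrite -mulrA (_ : Complex 0 (c * y) = Complex 0 c * rc y);
    [ring|apply: complex_ext; rewrite ?ReM ?ImM /=; ring].
- by move=> x; apply: L1dom_integrable; exact: FT_integrand.
- exact: majZ_integrable.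
- move=> x y _; rewrite cabsM cabs_expi mulr1 cabsM -mulrA.
  rewrite ler_pM ?cabs_ge0// (le_trans (cabs_le_ReIm _))//= normr0 add0r//.
Qed.

Lemma ubdd_expi T (a : T -> R) (K : R) : (forall t, `|a t| <= K) ->
  uchain (@ubdd R T) (fun t y => expi (a t * y)).
Proof.
move=> aK; apply: (@uchain_coind _ _ _ (fun Phi => exists z : T -> C,
  (exists L, forall t, cabs (z t) <= L) /\ Phi = fun t y => z t * expi (a t * y))).
  move=> _ [z [[L zL] ->]]; split.
    exists (Num.max L 0); first by rewrite le_max lexx orbT.
    by move=> t x; rewrite cabsM cabs_expi mulr1 le_max zL.
  exists (fun t y => z t * (Complex 0 (a t) * expi (a t * y))).
    by move=> t; apply: cDZ; exact: cD_expi.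
  exists (fun t => z t * Complex 0 (a t)); split.
    exists (L * K) => t; rewrite cabsM ler_pM ?cabs_ge0//.
    by rewrite (le_trans (cabs_le_ReIm _))//= normr0 add0r.
  by apply/funext => t; apply/funext => x; rewrite mulrA.
exists (fun=> 1); split; first by exists 1 => t; rewrite cabs1.
by apply/funext => t; apply/funext => x; rewrite mul1r.
Qed.

(** Integration by parts: the integral of the derivative of a Schwartz function
    vanishes. *)
Lemma FT_deriv c f f' : sch f -> cD f f' -> sch f' ->
  forall x, FT c f' x = - (Complex 0 (c * x) * FT c f x).
Proof.
move=> sf df sf' x.
have E : uchain (@ubdd R unit) (fun _ y => expi (c * y * x)).
  have -> : (fun (_ : unit) (y : R) => expi (c * y * x)) = fun _ y => expi (c * x * y).
    by apply/funext => _; apply/funext => y; rewrite mulrAC.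
  exact: (@ubdd_expi unit (fun=> c * x) `|c * x|).
have S g : sch g -> sch (fun y => g y * expi (c * y * x)).
  move=> sg; rewrite (_ : (fun y => _) = fun y => expi (c * y * x) * g y).
    exact: (usch_mul (uchain_sub (@ubdd_umod _ _) E) sg).
  by apply/funext => y; rewrite mulrC.
have d := cDM df (cD_expi_lin c x).
have S2 : sch (fun y => Complex 0 (c * x) * (f y * expi (c * y * x))).
  by apply: usch_mulz; exact: S.
have := sch_int_deriv (S _ sf) d.
have -> : (fun y => f' y * expi (c * y * x) + f y * (Complex 0 (c * x) * expi (c * y * x)))
  = (fun y => f' y * expi (c * y * x) + Complex 0 (c * x) * (f y * expi (c * y * x))).
  by apply/funext => y; congr (_ + _); ring.
rewrite cintD//; try by apply: sch_integrable => //; exact: S.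
rewrite cintZ//; last by apply: sch_integrable; exact: S.
move=> H; apply/eqP; rewrite -addr_eq0; apply/eqP; apply: H.
by apply: usch_add => //; exact: S.
Qed.

(** Differentiating [FT c f] multiplies [f] by the coordinate, and multiplying [FT c f]
    by the coordinate differentiates [f], so that smoothness and decay trade places.
    The family version says that the transform is continuous on Schwartz functions. *)
Lemma usch_FT T c (Phi : T -> R -> C) : c != 0 -> usch Phi ->
  usch (fun t => FT c (Phi t)).
Proof.
move=> c0 hPhi.
apply: (@uchain_coind _ _ _ (fun Psi => exists2 Phi : T -> R -> C, usch Phi &
  Psi = fun t => FT c (Phi t))); last by exists Phi.
move=> _ [{hPhi}{}Phi hPhi ->]; split; last first.
  exists (fun t => FT c (fun y => Complex 0 c * (rc y * Phi t y))).
    move=> t; apply: FT_cD; first exact/sch_L1dom/(usch_sch t hPhi).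
    exact/sch_L1dom/(usch_sch t (usch_mulrc hPhi)).
  exists (fun t y => Complex 0 c * (rc y * Phi t y)) => //.
  by apply: usch_mulz; exact: usch_mulrc.
have bd m : exists2 K, 0 <= K & forall t x, `|x| ^+ m * cabs (FT c (Phi t) x) <= K.
  elim: m Phi hPhi => [|m IH] Phi hPhi.
    have [K K0 k] := uchain_bound hPhi 2%N.
    exists (2 * (K * Rintegral mu setT (@maj R))).
      by rewrite !mulr_ge0// Rintegral_ge0// => x _; exact: maj_ge0.
    move=> t x; rewrite expr0 mul1r; apply: FT_bound => [|y].
      exact: sch_cmeas (usch_sch t hPhi).
    exact: wt_le_maj.
  have [Phi' d hPhi'] := uchain_deriv hPhi; have [K K0 k] := IH _ hPhi'.
  exists (`|c|^-1 * K) => [|t x]; first by rewrite mulr_ge0 ?invr_ge0.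
  have := k t x; rewrite (FT_deriv c (usch_sch t hPhi) (d t) (usch_sch t hPhi')).
  rewrite cabsN cabsM (_ : cabs (Complex 0 (c * x)) = `|c| * `|x|).
    by move=> H; rewrite ler_pdivlMl ?normr_gt0// exprSr; apply: le_trans H;
      rewrite le_eqVlt; apply/orP; left; apply/eqP; ring.
  by rewrite /cabs /= expr0n add0r sqrtr_sqr normrM.
move=> m; have [K0 K00 k0] := bd 0%N; have [Km Km0 km] := bd m.
exists (2 ^+ m * (K0 + Km)); first by rewrite mulr_ge0 ?addr_ge0 ?exprn_ge0.
move=> t x; apply: le_trans (ler_wpM2r (cabs_ge0 _) (wtX_le x m)) _.
rewrite -mulrA ler_wpM2l ?exprn_ge0// mulrDl lerD//.
by have := k0 t x; rewrite expr0.
Qed.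

Lemma sch_FT c f : c != 0 -> sch f -> sch (FT c f).
Proof. by move=> c0 sf; exact: (usch_FT c0 sf). Qed.

Lemma FT_D c f g : L1dom f -> L1dom g ->
  FT c (fun x => f x + g x) = fun x => FT c f x + FT c g x.
Proof.
move=> Lf Lg; apply/funext => x; rewrite /FT -cintD//; last 2 first.
- exact/L1dom_integrable/FT_integrand.
- exact/L1dom_integrable/FT_integrand.
by apply: eq_cint => y _; rewrite mulrDl.
Qed.

Lemma FT_Z c z f : L1dom f -> FT c (fun x => z * f x) = fun x => z * FT c f x.
Proof.
move=> Lf; apply/funext => x; rewrite /FT -cintZ//; last first.
  exact/L1dom_integrable/FT_integrand.
by apply: eq_cint => y _; rewrite mulrA.
Qed.

Lemma measurable_pair_fst (f : R -> C) : cmeas setT f ->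
  cmeas setT (fun z : R * R => f z.1).
Proof. by move=> [m1 m2]; split; [exact: (measurableT_comp m1)|exact: (measurableT_comp m2)]. Qed.

Lemma measurable_pair_snd (f : R -> C) : cmeas setT f ->
  cmeas setT (fun z : R * R => f z.2).
Proof. by move=> [m1 m2]; split; [exact: (measurableT_comp m1)|exact: (measurableT_comp m2)]. Qed.

Lemma cmeas_expi_pair (u : R * R -> R) : measurable_fun setT u ->
  cmeas setT (fun z : R * R => expi (u z)).
Proof.
move=> mu_; split.
- exact: (measurableT_comp (continuous_measurable_fun (@continuous_cos R)) mu_).
- exact: (measurableT_comp (continuous_measurable_fun (@continuous_sin R)) mu_).
Qed.

(** The multiplication formula, by Fubini's theorem. *)
Lemma FT_mult c f g : L1dom f -> L1dom g ->
  cint setT (fun x => f x * FT c g x) = cint setT (fun x => FT c f x * g x).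
Proof.
move=> Lf Lg; have [mf [K K0 k]] := Lf; have [mg [L L0 l]] := Lg.
transitivity (cint setT (fun x => cint setT (fun y => f x * (g y * expi (c * y * x))))).
  apply: eq_cint => x _; rewrite /FT cintZ//.
  exact/L1dom_integrable/FT_integrand.
transitivity (cint setT (fun y => cint setT (fun x => f x * (g y * expi (c * y * x))))).
  refine (proj2 (cint_fubini (H := fun z => f z.1 * (g z.2 * expi (c * z.2 * z.1)))
    (G1 := fun x => K * maj x) (G2 := fun x => L * maj x) _ _ _ _)).
  - apply: cmeasM; first exact: measurable_pair_fst.
    apply: cmeasM; first exact: measurable_pair_snd.
    apply: cmeas_expi_pair; apply: measurable_funM => //.
    exact: measurable_funM.
  - exact: majZ_integrable.
  - exact: majZ_integrable.
  - by move=> x y /=; rewrite !cabsM cabs_expi mulr1 ler_pM ?cabs_ge0.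
apply: eq_cint => y _; rewrite /FT -cintZr//.
  by apply: eq_cint => x _; rewrite [c * x * y]mulrAC; ring.
exact/L1dom_integrable/FT_integrand.
Qed.

End FourierTransform.

(** * Division by the coordinate *)

Section Hadamard.
Variable R : realType.
Local Notation C := R[i].
Local Notation mu := (@lebesgue_measure R).
Implicit Types (f g : R -> C).

(** The space usually written [C_b^oo]. *)
Definition bddC f := uchain (@ubdd R unit) (fun=> f).

Lemma sch_bddC f : sch f -> bddC f.
Proof.
apply: uchain_sub => Phi /(_ 0%N)[K K0 k]; exists K => // t x.
by have := k t x; rewrite expr0 mul1r.
Qed.

Lemma bddC_bound f : bddC f -> exists2 K : R, 0 <= K & forall x, cabs (f x) <= K.
Proof. by move=> /uchain_bound[K K0 k]; exists K => // x; exact: k tt x. Qed.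

(** [f x - f 0 = x * int_0^1 f' (t x) dt], and the integral may be differentiated
    under the integral sign. *)
Lemma hadamard f : bddC f ->
  exists2 q, bddC q & forall x, f x - f 0 = rc x * q x.
Proof.
move=> [G [G0 H]]; pose g n := G n tt.
have dg n : cD (g n) (g n.+1) by have [d _] := H n; exact: d.
have gK n : exists2 K : R, 0 <= K & forall x, cabs (g n x) <= K.
  by have [_ [K K0 k]] := H n; exists K => // x; exact: k.
pose Q n x : C := cint `[0, 1] (fun t => rc t ^+ n * g n.+1 (t * x)).
have m01 : measurable (`[0, 1]%classic : set R) by [].
have ic (K : R) : mu.-integrable `[0, 1] (EFin \o (fun=> K)).
  apply: continuous_compact_integrable; first exact: segment_compact.
  by apply: continuous_subspaceT => x; exact: cst_continuous.
have bI n m x (K : R) : (forall x, cabs (g m x) <= K) ->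
    forall t, `[0, 1]%classic t -> cabs (rc t ^+ n * g m (t * x)) <= K.
  move=> k t /=; rewrite in_itv /= => /andP[t0 t1].
  rewrite cabsM -rcX cabs_rc ger0_norm ?exprn_ge0//.
  apply: le_trans (k (t * x)); rewrite ler_piMl ?cabs_ge0//.
  by rewrite exprn_ile1.
have mI n m x : cmeas (`[0, 1]%classic : set R) (fun t => rc t ^+ n * g m (t * x)).
  apply: cmeasM.
    have -> : (fun t : R => rc t ^+ n) = (fun t => rc (t ^+ n)).
      by apply/funext => t; rewrite rcX.
    by apply: cmeas_rc; exact: measurable_funX.
  have := cD_cmeas (cD_affine x 0 (dg m)).
  under eq_fun do rewrite addr0 mulrC.
  by move=> [m1 m2]; split; exact: measurable_funTS.
have iI n m x : cintegrable `[0, 1] (fun t => rc t ^+ n * g m (t * x)).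
  have [K K0 k] := gK m.
  by apply: (cintegrable_dom _ (mI n m x) (ic K)) => //; exact: bI.
have dQ n : cD (Q n) (Q n.+1).
  have [K K0 k] := gK n.+2.
  apply: (@cD_cint _ `[0, 1] (fun x t => rc t ^+ n * g n.+1 (t * x))
    (fun x t => rc t ^+ n.+1 * g n.+2 (t * x)) (fun=> K)) => //.
  + move=> t _.
    have d := cDZ (rc t ^+ n) (cD_affine t 0 (dg n.+1)).
    apply: cDext d => x; first by rewrite addr0.
    by rewrite addr0 mulrA -exprSr.
  + by move=> x t t01; exact: bI.
exists (Q 0%N).
  exists (fun n _ => Q n); split=> // n; split=> [_|]; first exact: dQ.
  have [K K0 k] := gK n.+1.
  exists (2 * Rintegral mu `[0, 1] (fun=> K)).
    by rewrite mulr_ge0// Rintegral_ge0.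
  move=> _ x; apply: cabs_cint_le => //; exact: bI.
have -> : f = g 0%N by rewrite /g G0.
move=> x.
have d := cD_affine x 0 (dg 0%N).
have d1 := cD_affine x 0 (dg 1%N).
have := cint_FTC ltr01 d (cD_continuous (cDZ (rc x) d1)).
rewrite mulr1 mulr0 !addr0 => <-.
rewrite -cintZ//; apply: eq_cint => t _.
by rewrite expr0 mul1r addr0 [x * t]mulrC.
Qed.

(** By [hadamard] the quotient has bounded derivatives.  Away from the origin its
    derivatives decay because [f^(m+1) = x q^(m+1) + (m+1) q^(m)]. *)
Lemma hadamard_sch f : sch f -> f 0 = 0 ->
  exists2 q, sch q & forall x, f x = rc x * q x.
Proof.
move=> sf f0; have [q [Q [Q0 HQ]] fq] := hadamard (sch_bddC sf).
have {}fq x : f x = rc x * q x by rewrite -fq f0 subr0.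
exists q => //; exists Q; split=> // n; have [dQ bQ] := HQ n; split=> //.
have [F [F0 HF]] := sf.
pose h n := Q n tt; pose g n := F n tt.
have dh m : cD (h m) (h m.+1) by have [d _] := HQ m; exact: d.
have dg m : cD (g m) (g m.+1) by have [d _] := HF m; exact: d.
have rec m x : g m.+1 x = rc x * h m.+1 x + m.+1%:R * h m x.
  have E0 y : g 0%N y = rc y * h 0%N y.
    by rewrite /g /h F0 Q0 fq.
  elim: m x => [|m IH] x.
    have /(congr1 (@^~ x)) := cD_unique (dg 0%N)
      (cDext (fun y => esym (E0 y)) (frefl _) (cDM (@cD_rc R) (dh 0%N))).
    by move=> ->; ring.
  have d := cDD (cDM (@cD_rc R) (dh m.+1)) (cDZ m.+1%:R (dh m)).
  have /(congr1 (@^~ x)) := cD_unique (dg m.+1)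
    (cDext (fun y => esym (IH y)) (frefl _) d).
  by move=> ->; rewrite -[m.+2%:R]natr1; ring.
have key m p : exists2 K : R, 0 <= K & forall x, wt x ^+ p * cabs (h m x) <= K.
  elim: m p => [|m IH] p.
  - have [_ [K K0 k]] := HQ 0%N; have [_ /(_ p)[L L0 l]] := HF 0%N.
    exists (2 ^+ p * K + L); first by rewrite addr_ge0// mulr_ge0 ?exprn_ge0.
    move=> x; have [x1|x1] := leP `|x| 1.
      rewrite ler_wpDr// ler_pM ?wtX_ge0 ?cabs_ge0//; last exact: k.
      by rewrite lerXn2r ?nnegrE ?wt_ge0// /wt; lra.
    rewrite ler_wpDl ?mulr_ge0 ?exprn_ge0//; apply: le_trans (l tt x).
    rewrite ler_wpM2l ?wtX_ge0// F0 fq cabsM cabs_rc /h Q0.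
    by rewrite ler_peMl ?cabs_ge0// ltW.
  - have [_ [K K0 k]] := HQ m.+1; have [_ /(_ p)[L L0 l]] := HF m.+1.
    have [M M0 h1] := IH p.
    exists (2 ^+ p * K + (L + m.+1%:R * M)).
      by rewrite !addr_ge0// mulr_ge0 ?exprn_ge0.
    move=> x; have [x1|x1] := leP `|x| 1.
      rewrite ler_wpDr//; first by rewrite addr_ge0// mulr_ge0.
      rewrite ler_pM ?wtX_ge0 ?cabs_ge0//; last exact: k.
      by rewrite lerXn2r ?nnegrE ?wt_ge0// /wt; lra.
    rewrite ler_wpDl ?mulr_ge0 ?exprn_ge0//.
    apply: (@le_trans _ _ (wt x ^+ p * (cabs (g m.+1 x) + m.+1%:R * cabs (h m x)))).
      rewrite ler_wpM2l ?wtX_ge0//.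
      apply: (@le_trans _ _ (cabs (rc x * h m.+1 x))).
        by rewrite cabsM cabs_rc ler_peMl ?cabs_ge0// ltW.
      have -> : rc x * h m.+1 x = g m.+1 x - m.+1%:R * h m x by rewrite rec; ring.
      apply: (le_trans (cabsB _ _)); rewrite lerD2l cabsM.
      by rewrite -rc_nat cabs_rc ger0_norm.
    rewrite mulrDr lerD//; first exact: l.
    rewrite mulrCA ler_wpM2l//; exact: h1.
by move=> p; have [K K0 k] := key n p; exists K => // -[] x; exact: k.
Qed.

End Hadamard.

(** * Fourier inversion *)

Section Inversion.
Variable R : realType.
Local Notation C := R[i].
Local Notation mu := (@lebesgue_measure R).
Implicit Types (f g : R -> C).

(** Normalized so as to be its own Fourier transform. *)
Definition gauss (x : R) : C := rc (expR (- (pi * x ^+ 2))).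

Lemma cD_gauss : cD gauss (fun x => rc (- (2 * pi * x)) * gauss x).
Proof.
move=> x; split; last first.
  by rewrite /im ImM /= mulr0 mul0r addr0; exact: is_derive_cst.
rewrite /re ReM /= mul0r subr0.
have d : is_derive x (1:R) (fun y : R => - (pi * y ^+ 2)) (- (2 * pi * x)).
  rewrite (_ : (fun y : R => _) = - (pi \*: (id ^+ 2)))//.
  have e := is_deriveN (is_deriveZ pi (is_deriveX 2 (is_derive_id x (1:R)))).
  by apply: (is_derive_eq e); rewrite /GRing.scale /= expr1; ring.
apply: (is_derive_eq (is_derive1_comp (is_derive_expR _) d)).
by rewrite mulrC.
Qed.

Lemma gauss_dec m : exists2 K : R, 0 <= K & forall x, wt x ^+ m * cabs (gauss x) <= K.
Proof.
(* from [exp y >= (1 + y / (m + 1)) ^ (m + 1)] at [y = pi * x ^ 2] *)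
exists ((2 * m.+1%:R) ^+ m.+1); first by rewrite exprn_ge0.
move=> x; rewrite cabs_rc ger0_norm ?expR_ge0// expRN.
rewrite ler_pdivrMr ?expR_gt0//.
have m0 : 0 < (m.+1%:R : R) by rewrite ltr0n.
have p2 : 2 <= pi :> R by exact: pi_ge2.
apply: (@le_trans _ _ ((2 * m.+1%:R) ^+ m.+1 * (1 + x ^+ 2 / m.+1%:R) ^+ m.+1)); last first.
  rewrite ler_wpM2l ?exprn_ge0//.
  rewrite (_ : pi * x ^+ 2 = m.+1%:R * (pi * x ^+ 2 / m.+1%:R)); last first.
    by rewrite [RHS]mulrC divfK ?gt_eqF.
  rewrite expRM_natl lerXn2r ?nnegrE ?expR_ge0//; first by rewrite addr_ge0// divr_ge0// sqr_ge0.
  apply: le_trans (expR_ge1Dx _); rewrite lerD2l ler_wpM2r ?invr_ge0//.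
  by have := sqr_ge0 x; nra.
rewrite -exprMn.
apply: (@le_trans _ _ (wt x ^+ m.+1)); first by rewrite exprSr ler_peMr ?wtX_ge0 ?wt_ge1.
rewrite lerXn2r ?nnegrE ?wt_ge0//.
  by rewrite mulr_ge0// addr_ge0// divr_ge0// sqr_ge0.
have -> : 2 * m.+1%:R * (1 + x ^+ 2 / m.+1%:R) = 2 * (m.+1%:R + x ^+ 2).
  by field; rewrite gt_eqF.
have m1 : 1 <= (m.+1%:R : R) by rewrite ler1n.
rewrite /wt -(real_normK (num_real x)); have := sqr_ge0 (`|x| - 1); nra.
Qed.

Lemma umodD T (Phi Psi : T -> R -> C) : umod Phi -> umod Psi ->
  umod (fun t x => Phi t x + Psi t x).
Proof.
move=> [p [K1 K10 k1]] [r [K2 K20 k2]]; exists (p + r)%N, (K1 + K2).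
  exact: addr_ge0.
move=> t x; rewrite mulrDl (le_trans (cabsD _ _))// lerD//.
- apply: le_trans (k1 t x) _; rewrite ler_wpM2l// exprD ler_peMr ?wtX_ge0 ?wtX_ge1//.
- apply: le_trans (k2 t x) _; rewrite ler_wpM2l// exprD ler_peMl ?wtX_ge0 ?wtX_ge1//.
Qed.

Lemma umodM T (Phi Psi : T -> R -> C) : umod Phi -> umod Psi ->
  umod (fun t x => Phi t x * Psi t x).
Proof.
move=> [p [K1 K10 k1]] [r [K2 K20 k2]]; exists (p + r)%N, (K1 * K2).
  exact: mulr_ge0.
move=> t x; rewrite cabsM exprD mulrACA ler_pM ?cabs_ge0//.
Qed.

(** The derivatives are products of the Gaussian with functions of moderate growth, a
    class stable under differentiation. *)
Lemma sch_gauss : sch gauss.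
Proof.
apply: (@uchain_coind _ _ _ (fun Phi => exists2 A : unit -> R -> C,
  uchain (@umod R unit) A & Phi = fun t x => A t x * gauss x)); last first.
  exists (fun _ _ => 1); first exact: umod_cst.
  by apply/funext => t; apply/funext => x; rewrite mul1r.
move=> _ [A hA ->]; split.
  apply: umod_udec (uchain_bound hA) _ => m.
  by have [K K0 k] := gauss_dec m; exists K.
have [A' dA hA'] := uchain_deriv hA.
exists (fun t x => A' t x * gauss x + A t x * (rc (- (2 * pi * x)) * gauss x)).
  by move=> t; apply: cDM (dA t) cD_gauss.
exists (fun t x => A' t x + (A t x) * (rc (- (2 * pi)) * rc x)); last first.
  apply/funext => t; apply/funext => x; rewrite (_ : - (2 * pi * x) = - (2 * pi) * x).
    by rewrite rcM; ring.
  by ring.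
apply: uchain_add => //; first exact: umodD.
apply: (uchain_mul (@umodD _) (@umodM _)) => //.
by apply: (uchain_mul (@umodD _) (@umodM _)); [exact: umod_cst|exact: umod_rc].
Qed.

Lemma cint_gauss : cint setT gauss = 1.
Proof.
have p0 : 0 < Num.sqrt (pi : R) by rewrite sqrtr_gt0 pi_gt0.
rewrite /cint; apply: complex_ext => /=; last first.
  by rewrite (_ : im gauss = cst 0)// Rintegral_cst// mul0r.
rewrite /Rintegral.
have := ge0_integral_affine 0 p0 (@continuous_gauss_fun R) (@gauss_fun_ge0 R).
rewrite integralT_gauss -EFinM mulVf ?gt_eqF// => E.
rewrite -[RHS]/(fine 1%:E) -E; congr fine; apply: eq_integral => x _.
by rewrite /re /= /gauss_fun addr0 exprMn sqr_sqrtr// pi_ge0.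
Qed.

(** Both sides solve [y' = - 2 pi x y], so the quotient is constant, and it is [1] at
    the origin. *)
Lemma FT_gauss (c : R) : c ^+ 2 = (2 * pi) ^+ 2 -> FT c gauss = gauss.
Proof.
move=> cE; have sg := sch_gauss.
have d1 := FT_cD c (sch_L1dom sg) (sch_L1dom (usch_mulrc sg)).
have p0 : (2 * pi : R) != 0 by rewrite mulf_neq0// gt_eqF// pi_gt0.
have s2 : sch (fun x => rc (- (2 * pi * x)) * gauss x).
  rewrite (_ : (fun x => _) = fun x => rc (- (2 * pi)) * (rc x * gauss x)).
    by apply: usch_mulz; exact: usch_mulrc.
  by apply/funext => x; rewrite -mulNr rcM mulrA.
have E x : FT c (fun y => Complex 0 c * (rc y * gauss y)) x =
    rc (- (2 * pi * x)) * FT c gauss x.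
  have -> : (fun y => Complex 0 c * (rc y * gauss y)) =
      fun y => (Complex 0 c / rc (- (2 * pi))) * (rc (- (2 * pi * y)) * gauss y).
    apply/funext => y; rewrite (_ : - (2 * pi * y) = - (2 * pi) * y); last by ring.
    by rewrite rcM; field; rewrite rc_eq0 oppr_eq0.
  rewrite FT_Z; last exact: sch_L1dom.
  rewrite (FT_deriv c sg cD_gauss s2).
  have -> : Complex 0 (c * x) = Complex 0 c * rc x.
    by apply: complex_ext; rewrite ?ReM ?ImM /=; ring.
  have ii : Complex 0 c * Complex 0 c = - rc ((2 * pi) ^+ 2).
    by rewrite -cE; apply: complex_ext; rewrite ?ReM ?ImM ?ReN ?ImN /=; ring.
  rewrite mulrN -mulNr.
  have -> : - (Complex 0 c / rc (- (2 * pi))) * (Complex 0 c * rc x * FT c gauss x) =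
    - (Complex 0 c * Complex 0 c) / rc (- (2 * pi)) * (rc x * FT c gauss x) by ring.
  rewrite ii opprK (_ : - (2 * pi * x) = - (2 * pi) * x); last by ring.
  by rewrite -(sqrrN (2 * pi)) rcX rcM; field; rewrite rc_eq0 oppr_eq0.
pose e x : C := rc (expR (pi * x ^+ 2)).
have de : cD e (fun x => rc (2 * pi * x) * e x).
  move=> x; split; last first.
    by rewrite /im ImM /= mulr0 mul0r addr0; exact: is_derive_cst.
  rewrite /re ReM /= mul0r subr0.
  have d : is_derive x (1:R) (fun y : R => pi * y ^+ 2) (2 * pi * x).
    rewrite (_ : (fun y : R => _) = pi \*: (id ^+ 2))//.
    have e1 := is_deriveZ pi (is_deriveX 2 (is_derive_id x (1:R))).
    by apply: (is_derive_eq e1); rewrite /GRing.scale /= expr1; ring.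
  apply: (is_derive_eq (is_derive1_comp (is_derive_expR _) d)).
  by rewrite mulrC.
have ge x : gauss x * e x = 1 by rewrite /gauss /e -rcM -expRD addNr expR0.
have d0 : cD (fun x => FT c gauss x * e x) (fun=> 0).
  apply: cDext (cDM d1 de) => // x.
  by rewrite E rcN; ring.
have cst x : FT c gauss x * e x = 1.
  have <- : FT c gauss 0 * e 0 = 1.
    rewrite /e expr0n mulr0 expR0 mulr1 -cint_gauss; apply: eq_cint => y _.
    by rewrite mulr0 expi0 mulr1.
  apply: complex_ext.
  - by apply: (is_derive_0_is_cst (f := re (fun x => FT c gauss x * e x))) => y; case: (d0 y).
  - by apply: (is_derive_0_is_cst (f := im (fun x => FT c gauss x * e x))) => y; case: (d0 y).
apply/funext => x; rewrite -[LHS]mulr1 -(ge x) [gauss x * e x]mulrC mulrA cst.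
by rewrite mul1r.
Qed.

(** Fourier inversion at the origin.  For [f 0 = 0] write [f = x * q]: then [FT c f] is
    the derivative of a Schwartz function up to a constant factor, so its integral
    vanishes.  Subtracting a multiple of the Gaussian reduces the general case to this
    one. *)
Lemma cint_FT c f : c ^+ 2 = (2 * pi) ^+ 2 -> sch f -> cint setT (FT c f) = f 0.
Proof.
move=> cE sf.
have c0 : c != 0.
  apply/eqP => c0; move: cE; rewrite c0 expr0n => /esym/eqP.
  by rewrite expf_eq0 /= mulf_eq0 pnatr_eq0 /= gt_eqF// pi_gt0.
have sg := usch_mulz (f 0) sch_gauss.
have g0 : gauss 0 = 1 by rewrite /gauss expr0n mulr0 oppr0 expR0.
have [|q sq fq] := hadamard_sch (usch_sub sf sg); first by rewrite g0 mulr1 subrr.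
have sq' := sch_FT c0 sq.
have sxq := usch_mulrc sq.
have d := FT_cD c (sch_L1dom sq) (sch_L1dom sxq).
have sd : sch (FT c (fun y => Complex 0 c * (rc y * q y))).
  by apply: sch_FT => //; exact: usch_mulz.
have ic0 : Complex 0 c != 0 by rewrite eq_complex /= negb_and c0 orbT.
have Z : cint setT (FT c (fun y => rc y * q y)) = 0.
  have := sch_int_deriv sq' d sd; rewrite FT_Z; last exact: sch_L1dom.
  rewrite cintZ//; last exact/sch_integrable/sch_FT.
  by move/eqP; rewrite mulf_eq0 (negbTE ic0) /= => /eqP.
have -> : f = fun x => rc x * q x + f 0 * gauss x.
  by apply/funext => x; rewrite -fq subrK.
rewrite FT_D; [|exact: sch_L1dom..].
rewrite cintD//; [|exact/sch_integrable/sch_FT..].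
rewrite Z add0r FT_Z; last exact: (sch_L1dom sch_gauss).
rewrite cintZ//; last exact/sch_integrable/(sch_FT c0 sch_gauss).
by rewrite FT_gauss// cint_gauss g0 rc0 mul0r add0r.
Qed.

(** Translation reduces inversion at [x] to inversion at the origin. *)
Lemma FT_inversion c f : c ^+ 2 = (2 * pi) ^+ 2 -> sch f -> FT (- c) (FT c f) = f.
Proof.
move=> cE sf; apply/funext => x.
rewrite -[RHS]/((fun y => f y) x) -(add0r x).
rewrite -(cint_FT cE (sch_shift x sf)); apply: eq_cint => y _.
rewrite /FT -cintZr//; last exact/L1dom_integrable/FT_integrand/sch_L1dom.
have [c1 c2] : ccont (fun z => f z * expi (c * (z - x) * y)).
  have [f' df _] := sch_deriv sf.
  have d2 : cD (fun z => expi (c * (z - x) * y)) (fun z => rc 1 * (Complex 0 (c * y) * expi (c * (1 * z - x) * y))).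
    by apply: cDext (cD_affine 1 (- x) (cD_expi_lin c y)) => z //; rewrite mul1r.
  exact: cD_continuous (cDM df d2).
transitivity (cint setT (fun z => f z * expi (c * (z - x) * y))).
  apply: eq_cint => z _; rewrite -mulrA -expiD; congr (_ * expi _).
  by ring.
rewrite -(cint_shift (f := fun z => f z * expi (c * (z - x) * y)) x)//; last first.
  apply: L1dom_integrable; apply: (@L1domM _ _ _ 1); [|by move=> z; rewrite cabs_expi|exact: sch_L1dom].
  have d2 : cD (fun z => expi (c * (z - x) * y)) (fun z => rc 1 * (Complex 0 (c * y) * expi (c * (1 * z - x) * y))).
    by apply: cDext (cD_affine 1 (- x) (cD_expi_lin c y)) => z //; rewrite mul1r.
  exact: cD_cmeas d2.
by apply: eq_cint => z _; rewrite addrK.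
Qed.

End Inversion.

(** * Cutoff functions and smooth approximations of indicator functions *)

Section Cutoff.
Variable R : realType.
Local Notation C := R[i].
Local Notation mu := (@lebesgue_measure R).
Implicit Types (f g : R -> C).

(** The assumptions on the cutoff in the form in which they are used. *)
Definition cutoff f := [/\ bddC f, (forall x, 3 / 4 <= `|x| -> f x = 0) &
  (forall x, `|x| <= 1 / 2 -> f x = 1)].

Lemma ccont_cabs f : ccont f -> continuous (fun x => cabs (f x)).
Proof.
move=> [c1 c2] x.
rewrite (_ : (fun x => _) = (fun x => Num.sqrt ((re f x) ^+ 2 + (im f x) ^+ 2))).
  apply: continuous_comp; last exact: sqrt_continuous.
  by apply: cvgD; apply: cvgM; (exact: c1 || exact: c2).
by apply/funext => y; rewrite /cabs /re /im; case: (f y).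
Qed.

Lemma Ccinfty_bddC (A : R) f : csmooth f -> (forall x, A < `|x| -> f x = 0) -> bddC f.
Proof.
move=> sm v.
have d n := csmooth_cD n sm.
have vn n : forall x, A < `|x| -> cderiv n f x = 0.
  elim: n => [|n IH]; last exact: cD_vanish (d n) IH.
  by move=> x Ax; rewrite -(v x Ax) /cderiv /= /re /im; case: (f x).
exists (fun n _ => cderiv n f); split.
  by apply/funext => _; apply/funext => x; rewrite /cderiv /= /re /im; case: (f x).
move=> n; split=> [_|]; first exact: d.
have cn := ccont_cabs (cD_continuous (d n)).
have A0 : - `|A| <= `|A| by have := normr_ge0 A; lra.
have [c _ hc] := EVT_max A0 (continuous_subspaceT cn).
exists (cabs (cderiv n f c)); first exact: cabs_ge0.
move=> _ x; have [Ax|xA] := ltP A `|x|; first by rewrite vn// cabs0 cabs_ge0.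
by apply: hc; rewrite in_itv /= -ler_norml (le_trans xA)// ler_norm.
Qed.

Lemma cutoff_Ccinfty f : Ccinfty f -> supp f `<=` [set xi | `|xi| < 3 / 4] ->
  (forall xi : R, `|xi| <= 1 / 2 -> f xi = 1) -> cutoff f.
Proof.
move=> [sm _] sf f1.
have f0 x : 3 / 4 <= `|x| -> f x = 0.
  move=> x34; apply/eqP/negPn/negP => fx.
  have /sf : supp f x by apply: subset_closure.
  by rewrite /= ltNge x34.
split=> //; apply: (@Ccinfty_bddC (3 / 4)) => // x /ltW; exact: f0.
Qed.

Lemma bddC_affine f (a b : R) : bddC f -> bddC (fun x => f (a * x + b)).
Proof. by move=> bf; exact: (@ubdd_affine _ unit f (fun=> a) (fun=> b) `|a|). Qed.

Lemma bddC_scale f (a : R) : bddC f -> bddC (fun x => f (a * x)).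
Proof. by move=> /(bddC_affine a 0); under eq_fun do rewrite addr0. Qed.

Lemma bddCD f g : bddC f -> bddC g -> bddC (fun x => f x + g x).
Proof. by apply: uchain_add; exact: ubddD. Qed.

Lemma bddC_cst (z : C) : bddC (fun=> z).
Proof. exact: (@ubdd_cst _ unit (fun=> z) (cabs z)). Qed.

Lemma bddCB f g : bddC f -> bddC g -> bddC (fun x => f x - g x).
Proof.
move=> bf bg; rewrite (_ : (fun x => _) = fun x => f x + (-1) * g x).
  by apply: bddCD => //; apply: ubdd_mul => //; exact: bddC_cst.
by apply/funext => x; rewrite mulN1r.
Qed.

Lemma bddC_sch f g : bddC f -> sch g -> sch (fun x => f x * g x).
Proof. by move=> bf sg; apply: usch_mul => //; exact: uchain_sub (@ubdd_umod _ _) bf. Qed.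

Lemma bddC_cmeas f : bddC f -> cmeas setT f.
Proof. by move=> /uchain_deriv[f' d _]; exact: cD_cmeas (d tt). Qed.

Lemma sch_scale f (a : R) : a != 0 -> sch f -> sch (fun x => f (a * x)).
Proof.
move=> a0 [G [G0 H]]; exists (fun n t x => rc a ^+ n * G n t (a * x)); split.
  by apply/funext => t; apply/funext => x; rewrite expr0 mul1r G0.
move=> n; have [dG PG] := H n; split.
  move=> t; apply: cDext (cDZ (rc a ^+ n) (cD_affine a 0 (dG t))) => x.
    by rewrite addr0.
  by rewrite addr0 mulrA -exprSr.
have wa x : wt x <= (1 + `|a|^-1) * wt (a * x).
  rewrite /wt normrM.
  have -> : (1 + `|a|^-1) * (1 + `|a| * `|x|) = 1 + `|a| * `|x| + `|a|^-1 + `|x|.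
    by field; rewrite normr_eq0.
  have h1 : 0 <= `|a|^-1 by rewrite invr_ge0.
  have h2 : 0 <= `|a| * `|x| by rewrite mulr_ge0.
  lra.
move=> m; have [K K0 k] := PG m.
exists (`|a| ^+ n * ((1 + `|a|^-1) ^+ m * K)).
  by rewrite !mulr_ge0 ?exprn_ge0// addr_ge0// invr_ge0.
move=> t x; rewrite cabsM -rcX cabs_rc normrX mulrCA ler_wpM2l ?exprn_ge0//.
apply: (@le_trans _ _ (((1 + `|a|^-1) * wt (a * x)) ^+ m * cabs (G n t (a * x)))).
  rewrite ler_wpM2r ?cabs_ge0// lerXn2r ?nnegrE ?wt_ge0//.
  by rewrite mulr_ge0 ?wt_ge0// addr_ge0// invr_ge0.
rewrite exprMn -mulrA ler_wpM2l ?k// exprn_ge0// addr_ge0// invr_ge0//.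
Qed.

Definition L1norm f : R := Rintegral mu setT (fun x => cabs (f x)).

Lemma L1norm_ge0 f : 0 <= L1norm f.
Proof. by apply: Rintegral_ge0 => x _; exact: cabs_ge0. Qed.

Lemma sch_cabs_integrable f : sch f ->
  mu.-integrable setT (EFin \o (fun x => cabs (f x))).
Proof. by move=> sf; apply: cintegrable_cabs => //; exact: sch_integrable. Qed.

Lemma L1norm_affine f (a b : R) : 0 < a -> sch f -> L1norm (fun x => f (a * x + b)) = a^-1 * L1norm f.
Proof.
move=> a0 sf; have [_ E] := Rintegral_affine b a0 (ccont_cabs (sch_ccont sf)) (sch_cabs_integrable sf).
exact: E.
Qed.

Section WithCutoff.
Variables (eta : R -> C) (heta : cutoff eta).

(** Flattening a cutoff on the left gives a smooth step from 1 to 0. *)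
Definition smooth_step (x : R) : C := if x < 0 then 1 else eta x.

(** The induction runs over functions that are constant near the origin and have been
    replaced on the left by that constant. *)
Lemma smooth_step_bddC : bddC smooth_step.
Proof.
have [be _ e1] := heta.
apply: (@uchain_coind _ unit (@ubdd R unit) (fun Phi => exists2 f, bddC f &
  exists2 z, (forall x, `|x| < 1 / 2 -> f x = z) &
  Phi = fun _ x => if x < 0 then z else f x)); last first.
  exists eta => //; exists 1 => //.
  by move=> x /ltW; exact: e1.
move=> _ [f bf [z fz ->]]; split.
  have [K K0 k] := bddC_bound bf; exists (Num.max K (cabs z)).
    by rewrite le_max K0.
  by move=> _ x; case: ifP => _; rewrite le_max ?k// lexx orbT.
have [F' d bf'] := uchain_deriv bf.
pose f' := F' tt; have df : cD f f' by exact: d.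
have bf'' : bddC f'.
  by rewrite /bddC (_ : (fun=> f') = F')//; apply/funext => -[].
have f'0 x : `|x| < 1 / 2 -> f' x = 0.
  move=> x2.
  have d0 : cD (fun=> z) (fun y => if `|y| < 1 / 2 then f' y else 0).
    apply: cD_near => y; case: ifPn => y2; last first.
      by exists (fun=> z), (fun=> 0); split; [exact: cD_cst|by near=> w|by []].
    exists f, f'; split=> //.
    have : \forall z \near y, `|z| < 1 / 2.
      have cn : {for y, continuous (fun z : R => `|z|)} by exact: norm_continuous.
      exact: (cvgr_lt _ cn).
    by apply: filterS => w; exact: fz.
  by have /(congr1 (@^~ x)) := cD_unique d0 (cD_cst z); rewrite x2.
exists (fun _ x => if x < 0 then 0 else f' x); last first.
  by exists f' => //; exists 0.
move=> _; apply: cD_near => x; have [x2|x2] := ltP x (1 / 4).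
- exists (fun=> z), (fun=> 0); split; first exact: cD_cst; last first.
    by case: ifPn => //; rewrite -leNgt => x0; rewrite f'0// ger0_norm//; lra.
  have : \forall y \near x, y < 1 / 4 by exact: lt_nbhsl.
  apply: filterS => y y4; case: ifPn => //; rewrite -leNgt => y0.
  by rewrite fz// ger0_norm//; lra.
- exists f, f'; split=> //; last by rewrite ltNge (le_trans _ x2).
  have : \forall y \near x, 0 < y by apply: lt_nbhsr; lra.
  by apply: filterS => y y0; rewrite ltNge ltW.
Unshelve. all: by end_near. Qed.

Lemma smooth_step1 x : x <= 0 -> smooth_step x = 1.
Proof.
rewrite /smooth_step; case: ifPn => // x0 x0'; have [_ _ ->//] := heta.
by rewrite (_ : x = 0) ?normr0//; apply/eqP; rewrite eq_le x0' leNgt.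
Qed.

Lemma smooth_step0 x : 1 <= x -> smooth_step x = 0.
Proof.
move=> x1; rewrite /smooth_step ltNge (le_trans _ x1)//=; have [_ -> //] := heta.
by rewrite ger0_norm; lra.
Qed.

(** These test functions tend boundedly to the indicator function of [`]a, b]]. *)
Definition approx_indic (a b : R) (n : nat) (x : R) : C :=
  smooth_step (n.+1%:R * x + - (n.+1%:R * b)) -
  smooth_step (n.+1%:R * x + - (n.+1%:R * a)).

Lemma approx_indic_out a b n x : a <= b -> ~~ (a <= x <= b + 1) ->
  approx_indic a b n x = 0.
Proof.
move=> ab; have n1 : (1 <= n.+1%:R :> R) by rewrite ler1n.
rewrite /approx_indic -!mulrBr negb_and -!ltNge => /orP[xa|bx].
- by rewrite !smooth_step1 ?subrr//; nra.
- by rewrite !smooth_step0 ?subrr//; nra.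
Qed.

Lemma approx_indic_bddC a b n : bddC (approx_indic a b n).
Proof. by apply: bddCB; apply: bddC_affine; exact: smooth_step_bddC. Qed.

Lemma approx_indic_sch a b n : a <= b -> sch (approx_indic a b n).
Proof.
move=> ab; apply: (usch_compact (A := `|a| + `|b| + 1)); first exact: approx_indic_bddC.
move=> _ x xA; apply: approx_indic_out => //; apply/negP => /andP[ax xb].
move: xA; rewrite ltNge => /negP; apply; rewrite ler_norml.
have := ler_norm a; have := ler_norm (- a); rewrite normrN.
have := ler_norm b; have := normr_ge0 b; have := normr_ge0 a; lra.
Qed.

Lemma approx_indic_cvg a b x : a <= b ->
  ccvg (fun n => approx_indic a b n x) (rc (\1_(`]a, b]%classic : set R) x)).
Proof.
move=> ab.
have L c : x <= c -> forall n, smooth_step (n.+1%:R * x + - (n.+1%:R * c)) = 1.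
  by move=> xc n; rewrite -mulrBr smooth_step1// mulr_ge0_le0// subr_le0.
have U c : c < x -> \forall n \near \oo, smooth_step (n.+1%:R * x + - (n.+1%:R * c)) = 0.
  move=> cx; have xc0 : 0 < x - c by rewrite subr_gt0.
  near=> n; rewrite -mulrBr smooth_step0// -ler_pdivrMr// mul1r.
  apply: (@le_trans _ _ n%:R); last by rewrite ler_nat.
  by near: n; exact: nbhs_infty_ger.
apply: cvg_near_cst; rewrite indicE; have [xa|ax] := leP x a.
  apply: nearW => n; rewrite /approx_indic !L ?(le_trans xa)// subrr memNset ?subrr ?cabs0//.
  by rewrite /= in_itv /= ltNge xa.
have [xb|bx] := leP x b.
- have := U a ax; apply: filterS => n na.
  by rewrite /approx_indic na L// subr0 mem_set ?subrr ?cabs0//= in_itv /= ax xb.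
- have := U a ax; have := U b bx; apply: filterS2 => n nb na.
  rewrite /approx_indic na nb subr0 memNset ?subrr ?cabs0//= in_itv /=.
  by rewrite [x <= b]leNgt bx andbF.
Unshelve. all: by end_near. Qed.

Lemma approx_indic_bound : exists2 K : R, 0 <= K &
  forall a b n x, cabs (approx_indic a b n x) <= K.
Proof.
have [K K0 k] := bddC_bound smooth_step_bddC; exists (K + K); first exact: addr_ge0.
by move=> a b n x; rewrite (le_trans (cabsB _ _))// lerD.
Qed.

(** The [L^1] norm of the derivative of a step does not change under affine
    substitution.  So the total variation of the approximations is bounded
    independently of the interval and of [n]: this is why the length of an interval
    does not enter the estimates for positive frequencies. *)
Lemma approx_indic_deriv : exists2 B : R, 0 <= B & forall a b n, a <= b ->
  exists2 phi', cD (approx_indic a b n) phi' & sch phi' /\ L1norm phi' <= B.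
Proof.
have [F' d bF'] := uchain_deriv smooth_step_bddC.
pose s' := F' tt; have ds : cD smooth_step s' by exact: d.
have bs : bddC s' by rewrite /bddC (_ : (fun=> s') = F')//; apply/funext => -[].
have s'0 x : 1 < `|x| -> s' x = 0.
  rewrite ltNge ler_norml negb_and -!ltNge => /orP[x1|x1].
  - have d0 : cD (fun=> 1) (fun y => if y < 0 then s' y else 0).
      apply: cD_near => y; case: ifPn => y2; last first.
        by exists (fun=> 1), (fun=> 0); split; [exact: cD_cst|by near=> w|by []].
      exists smooth_step, s'; split=> //.
      have : \forall z \near y, z < 0 by exact: lt_nbhsl.
      by apply: filterS => w /ltW; exact: smooth_step1.
    have /(congr1 (@^~ x)) := cD_unique d0 (cD_cst 1).
    by rewrite (lt_trans x1)//; lra.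
  - have d0 : cD (fun=> 0) (fun y => if 1 < y then s' y else 0).
      apply: cD_near => y; case: ifPn => y2; last first.
        by exists (fun=> 0), (fun=> 0); split; [exact: cD_cst|by near=> w|by []].
      exists smooth_step, s'; split=> //.
      have : \forall z \near y, 1 < z by exact: lt_nbhsr.
      by apply: filterS => w /ltW; exact: smooth_step0.
    by have /(congr1 (@^~ x)) := cD_unique d0 (cD_cst 0); rewrite x1.
have ss : sch s' by apply: (usch_compact bs) => _; exact: s'0.
exists (L1norm s' + L1norm s'); first by rewrite addr_ge0 ?L1norm_ge0.
move=> a b n ab; have n0 : 0 < (n.+1%:R : R) by rewrite ltr0n.
pose p (c x : R) : C := rc n.+1%:R * s' (n.+1%:R * x + - (n.+1%:R * c)).
have dp c : cD (fun x => smooth_step (n.+1%:R * x + - (n.+1%:R * c))) (p c) by exact: cD_affine.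
have bp c : bddC (p c) by apply: ubdd_mul; [exact: bddC_cst|exact: bddC_affine].
have sp c : sch (p c).
  apply: (usch_compact (A := 1 + `|c|) (bp c)) => _ x xc.
  rewrite /p -mulrBr s'0 ?mulr0// normrM ger0_norm ?ltW//.
  have n1 : (1 <= n.+1%:R :> R) by rewrite ler1n.
  have : `|x| - `|c| <= `|x - c| by rewrite lerB_dist.
  by nra.
have Np c : L1norm (p c) = L1norm s'.
  rewrite (_ : L1norm (p c) = n.+1%:R * L1norm (fun x => s' (n.+1%:R * x + - (n.+1%:R * c)))).
    by rewrite L1norm_affine// mulrA divff ?gt_eqF// mul1r.
  rewrite /L1norm -RintegralZl//; last first.
    by have [i _] := Rintegral_affine (- (n.+1%:R * c)) n0 (ccont_cabs (sch_ccont ss)) (sch_cabs_integrable ss).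
  by apply: eq_Rintegral => x _; rewrite /p cabsM cabs_rc ger0_norm// ltW.
exists (fun x => p b x - p a x); first exact: cDB.
have sba := usch_sub (sp b) (sp a).
split; first exact: sba.
rewrite -{2}(Np a) -(Np b) /L1norm -RintegralD//; last 2 first.
- exact: sch_cabs_integrable.
- exact: sch_cabs_integrable.
apply: le_Rintegral => //.
- exact: (sch_cabs_integrable sba).
- exact: (integrableD (mu := mu) measurableT (sch_cabs_integrable (sp b)) (sch_cabs_integrable (sp a))).
- by move=> x _; exact: cabsB.
Unshelve. all: by end_near. Qed.

End WithCutoff.
End Cutoff.

(** * Densities of distributions *)

Section Density.
Variable R : realType.
Local Notation C := R[i].
Local Notation mu := (@lebesgue_measure R).
Implicit Types (f g h : R -> C) (u v : distr R).

Lemma has_density_cmeas u g : has_density u g -> cmeas setT g.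
Proof. by case. Qed.

Lemma densityP u g : has_density u g -> has_density u (density u).
Proof. by move=> ug; rewrite /density; apply: (xgetPex (fun=> 0)); exists g. Qed.

Lemma has_density_dlin (a : C) u v g h : has_density u g -> has_density v h ->
  has_density (Defs.dlin a u v) (fun x => a * g x + h x).
Proof.
move=> [m1 m2 ig eu] [n1 n2 ih ev].
have [M1 M2] : cmeas setT (fun x => a * g x + h x).
  by apply: cmeasD => //; apply: cmeasM => //; exact: cmeas_cst.
have E phi : (fun x => (a * g x + h x) * phi x) =
    fun x => a * (g x * phi x) + h x * phi x.
  by apply/funext => x; ring.
split=> //.
- move=> phi sp; rewrite E; apply: cintegrableD => //; last exact: ih.
  by apply: cintegrableZ => //; exact: ig.
- move=> phi sp; rewrite /Defs.dlin /dfun E cintD//; last 2 first.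
  + by apply: cintegrableZ => //; exact: ig.
  + exact: ih.
  by rewrite cintZ//; [rewrite (eu _ sp) (ev _ sp)|exact: ig].
Qed.

(** Change an almost everywhere bounded density on a null set. *)
Lemma dLinfty_density u (M : R) : (dLinfty u < M%:E)%E ->
  exists2 g, has_density u g & forall x, cabs (g x) <= M.
Proof.
move=> /ereal_inf_lt[_ [g ug <-] gM].
have mg := has_density_cmeas ug; have [m1 m2 ig eu] := ug.
have mcg : measurable_fun setT (fun x => cabs (g x)) by exact: cmeas_cabs.
have M0 : 0 <= M by rewrite -lee_fin (le_trans _ (ltW gM))// Lnorm_ge0.
have ae : {ae mu, forall x, cabs (g x) <= M}.
  move: gM; rewrite unlock /=; case: ifPn => [mu0 sM|].
    have /ess_supP := ltW sM; apply: filterS => x.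
    by rewrite /= lee_fin ger0_norm ?cabs_ge0.
  move=> /negP; case; apply: (@lt_le_trans _ _ (mu `[0, 1])).
    by rewrite lebesgue_measure_itv /= lte_fin ltr01 oppr0 adde0 lte_fin.
  by apply: le_measure; rewrite ?inE.
pose B : set R := [set x | cabs (g x) <= M].
have mB : measurable B.
  rewrite -[B]setTI; apply: measurable_fun_le => //; exact: measurable_cst.
pose g' x := g x * rc (\1_B x).
have mg' : cmeas setT g'.
  by apply: cmeasM => //; apply: cmeas_rc; exact/measurable_indicP.
have g'E : {ae mu, forall x, g' x = g x}.
  by apply: (@filterS _ _ (ae_filter_ringOfSetsType mu) _ _ _ ae) => x xM; rewrite /g' indicE mem_set// rc1 mulr1.
exists g'; last first.
  move=> x; rewrite /g' indicE cabsM cabs_rc.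
  have [/set_mem xB|_] := boolP (x \in B); first by rewrite normr1 mulr1.
  by rewrite normr0 mulr0.
have ig' phi : schwartz phi -> cintegrable setT (fun x => g' x * phi x).
  move=> sp; have mp : cmeas setT phi by apply: sch_cmeas; exact/schP.
  apply: (cintegrable_dom _ _ (cintegrable_cabs measurableT (ig phi sp))) => //.
    exact: cmeasM.
  move=> x _; rewrite !cabsM ler_wpM2r ?cabs_ge0// cabs_rc ler_piMr ?cabs_ge0//.
  by rewrite indicE; case: (_ \in _); rewrite ?normr1 ?normr0.
case: (mg') => m1' m2'; split=> // phi sp; rewrite (eu _ sp) /dfun /cint.
have [i1 i2] := ig phi sp; have [j1 j2] := ig' phi sp.
congr Complex; rewrite /Rintegral; congr fine; apply: ae_eq_integral => //.
- exact: measurable_int i1.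
- exact: measurable_int j1.
- by apply: (@filterS _ _ (ae_filter_ringOfSetsType mu) _ _ _ g'E) => x E _; rewrite /= /re E.
- exact: measurable_int i2.
- exact: measurable_int j2.
- by apply: (@filterS _ _ (ae_filter_ringOfSetsType mu) _ _ _ g'E) => x E _; rewrite /= /im E.
Qed.

Section WithCutoff.
Variables (eta : R -> C) (heta : cutoff eta).

(** Test against a Schwartz function that is [1] on the interval, a dilated cutoff. *)
Lemma has_density_locint u g (a b : R) : has_density u g -> cintegrable `[a, b] g.
Proof.
move=> [_ _ ig _]; have [be e0 e1] := heta.
pose A : R := `|a| + `|b| + 1.
have A0 : 0 < A by rewrite /A; have := normr_ge0 a; have := normr_ge0 b; lra.
pose bump x := eta ((2 * A)^-1 * x).
have sb : sch bump.
  apply: (usch_compact (A := 2 * A)); first exact: bddC_scale.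
  move=> _ x xA; apply: e0; rewrite normrM gtr0_norm ?invr_gt0 ?mulr_gt0//.
  by rewrite ler_pdivlMl ?mulr_gt0//; lra.
have /schP sb' := sb.
apply: (@eq_cintegrable _ _ (fun x => g x * bump x)) => //; last first.
  exact: cintegrableS (ig _ sb').
move=> x /=; rewrite in_itv /= => /andP[ax xb]; rewrite /bump e1 ?mulr1//.
rewrite normrM gtr0_norm ?invr_gt0 ?mulr_gt0// ler_pdivrMl ?mulr_gt0//.
have : `|x| <= A.
  rewrite ler_norml /A; have := ler_norm a; have := ler_norm (- a); rewrite normrN.
  have := ler_norm b; have := normr_ge0 b; have := normr_ge0 a; lra.
lra.
Qed.

(** The integral of a density over an interval is determined by the distribution
    alone. *)
Lemma has_density_lim u g (a b : R) : a <= b -> has_density u g ->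
  ccvg (fun n => u (approx_indic eta a b n)) (cint `]a, b] g).
Proof.
move=> ab ug; have [_ _ ig eu] := ug; have mg := has_density_cmeas ug.
have [K K0 k] := approx_indic_bound heta.
have s n : schwartz (approx_indic eta a b n) by apply/schP; exact: approx_indic_sch.
under eq_fun do rewrite (eu _ (s _)) /dfun.
rewrite cint_setT_restrict//.
have iR := cintegrable_setT_restrict (measurable_itv `[a, b + 1]) (has_density_locint a (b + 1) ug).
apply: (cint_dct (F := fun n x => g x * approx_indic eta a b n x) measurableT _ _
  (integrableZR K measurableT (cintegrable_cabs measurableT iR)) _).2.
- move=> n; apply: cmeasM => //; apply: bddC_cmeas; exact: approx_indic_bddC.
- move=> x _; apply: ccvgZ; exact: approx_indic_cvg.
- move=> n x _; have [xI|xI] := boolP (a <= x <= b + 1).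
    rewrite indicE mem_set ?rc1 ?mulr1; last by rewrite /= in_itv.
    by rewrite cabsM mulrC ler_wpM2r ?cabs_ge0.
  by rewrite approx_indic_out// mulr0 cabs0 mulr_ge0 ?cabs_ge0.
Qed.

Lemma cint_density u g (a b : R) : a <= b -> has_density u g ->
  cint `]a, b] (density u) = cint `]a, b] g.
Proof.
move=> ab ug; apply: ccvg_unique (has_density_lim ab (densityP ug)) _.
exact: has_density_lim.
Qed.

End WithCutoff.
End Density.

(** * Littlewood-Paley operators on test functions *)

Section Multiplier.
Variable R : realType.
Local Notation C := R[i].
Local Notation mu := (@lebesgue_measure R).
Implicit Types (f g m phi : R -> C).

Definition c2pi : R := 2 * pi.

Lemma c2pi_neq0 : c2pi != 0.
Proof. by rewrite mulf_neq0// gt_eqF// pi_gt0. Qed.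

Lemma fourierE f : fourier f = FT (- c2pi) f.
Proof.
by apply/funext => x; apply: eq_cint => y _; congr (_ * expi _); rewrite /c2pi; ring.
Qed.

Lemma ifourierE f : ifourier f = FT c2pi f.
Proof. by apply/funext => x; apply: eq_cint => y _; congr (_ * expi _); rewrite /c2pi; ring. Qed.

Lemma sch_fourier f : sch f -> sch (fourier f).
Proof. by rewrite fourierE; apply: sch_FT; rewrite oppr_eq0 c2pi_neq0. Qed.

Lemma sch_ifourier f : sch f -> sch (ifourier f).
Proof. by rewrite ifourierE; apply: sch_FT; exact: c2pi_neq0. Qed.

Lemma fourierK f : sch f -> ifourier (fourier f) = f.
Proof.
by move=> sf; rewrite ifourierE fourierE -{1}(opprK c2pi) FT_inversion// sqrrN.
Qed.

Lemma ifourierK f : sch f -> fourier (ifourier f) = f.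
Proof. by move=> sf; rewrite ifourierE fourierE FT_inversion. Qed.

(** By duality [lp_piece eta k f] sends [phi] to [f (multiplier (lp_symbol eta k) phi)]. *)
Definition multiplier m phi := fourier (fun xi => m xi * ifourier phi xi).

Lemma sch_multiplier m phi : bddC m -> sch phi -> sch (multiplier m phi).
Proof. by move=> bm sp; apply/sch_fourier/bddC_sch => //; exact: sch_ifourier. Qed.

Lemma multiplier_comp m m' phi : bddC m' -> sch phi ->
  multiplier m (multiplier m' phi) = multiplier (fun xi => m xi * m' xi) phi.
Proof.
move=> bm' sp; rewrite /multiplier fourierK; last first.
  by apply: bddC_sch => //; exact: sch_ifourier.
by congr fourier; apply/funext => xi; rewrite mulrA.
Qed.

Lemma multiplierD m m' phi : bddC m -> bddC m' -> sch phi ->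
  multiplier (fun xi => m xi + m' xi) phi =
  fun x => multiplier m phi x + multiplier m' phi x.
Proof.
move=> bm bm' sp; have si := sch_ifourier sp.
rewrite /multiplier !fourierE -FT_D; [|by apply: sch_L1dom; exact: bddC_sch..].
by congr FT; apply/funext => xi; rewrite mulrDl.
Qed.

(** Young's inequality, for a function dominated by a convolution. *)
Lemma L1norm_convolution (psi F Q : R -> C) (B : R) : 0 <= B -> sch psi -> sch F -> sch Q ->
  (forall x, cabs (psi x) <=
     B * Rintegral mu setT (fun y => cabs (F y) * cabs (Q (x - y)))) ->
  L1norm psi <= B * (L1norm F * L1norm Q).
Proof.
move=> B0 sp sF sQ H.
have mF : measurable_fun setT (fun y => cabs (F y)) by apply: cmeas_cabs => //; exact: sch_cmeas.
have mQ : measurable_fun setT (fun y => cabs (Q y)) by apply: cmeas_cabs => //; exact: sch_cmeas.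
have iF := sch_cabs_integrable sF.
have [K K0 k] := bddC_bound (sch_bddC sQ).
have L1normE f : sch f -> ((L1norm f)%:E = \int[mu]_x (cabs (f x))%:E)%E.
  move=> sf; rewrite fineK//; exact: (integrable_fin_num _ (sch_cabs_integrable sf)).
pose H2 (z : R * R) : R := cabs (F z.2) * cabs (Q (z.1 - z.2)).
have H20 z : (0 <= (H2 z)%:E)%E by rewrite lee_fin mulr_ge0 ?cabs_ge0.
have mH2r : measurable_fun setT H2.
  apply: measurable_funM; first exact: (measurableT_comp mF).
  apply: (measurableT_comp mQ); exact: measurable_funB.
have mH2 : measurable_fun setT (EFin \o H2) by exact/measurable_EFinP.
have iy x : mu.-integrable setT (EFin \o (fun y => H2 (x, y))).
  apply: (@le_integrable _ _ _ mu setT _ _ (EFin \o (fun y => K * cabs (F y)))).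
  - exact: measurableT.
  - apply/measurable_EFinP; exact: (measurableT_comp mH2r (pair1_measurable x)).
  - move=> y _; rewrite lee_fin !ger0_norm ?mulr_ge0 ?cabs_ge0//.
    by rewrite /H2 mulrC ler_wpM2r ?cabs_ge0.
  - exact: integrableZR.
rewrite -lee_fin EFinM EFinM !L1normE//.
apply: (@le_trans _ _ (\int[mu]_x (B%:E * \int[mu]_y (H2 (x, y))%:E))%E).
  apply: ge0_le_integral => //.
  - by move=> x _; rewrite lee_fin cabs_ge0.
  - by apply/measurable_EFinP; apply: cmeas_cabs => //; exact: sch_cmeas.
  - apply: emeasurable_funM; first exact: measurable_cst.
    exact: (@measurable_fun_fubini_tonelli_F _ _ _ _ _ mu (EFin \o H2)).
  - move=> x _; have := H x; rewrite -lee_fin EFinM => /le_trans; apply.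
    rewrite lee_wpmul2l ?lee_fin// fineK//.
    exact: (integrable_fin_num _ (iy x)).
rewrite ge0_integralZl//; last 2 first.
- exact: (@measurable_fun_fubini_tonelli_F _ _ _ _ _ mu (EFin \o H2)).
- by move=> x _; exact: integral_ge0.
rewrite lee_wpmul2l ?lee_fin//.
rewrite (@fubini_tonelli _ _ _ _ R mu mu (EFin \o H2))//.
rewrite -(L1normE Q)// -ge0_integralZr//; last 3 first.
- exact/measurable_EFinP.
- by move=> x _; rewrite lee_fin cabs_ge0.
- by rewrite lee_fin L1norm_ge0.
rewrite le_eqVlt; apply/orP; left; apply/eqP; apply: eq_integral => y _.
rewrite /= /H2 /=; under eq_integral do rewrite EFinM.
rewrite ge0_integralZl//; last 3 first.
- apply/measurable_EFinP; apply: (measurableT_comp mQ); exact: measurable_funB.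
- by move=> x _; rewrite lee_fin cabs_ge0.
- by rewrite lee_fin cabs_ge0.
congr (_ * _)%E; rewrite L1normE//.
have := ge0_integral_affine (- y) ltr01 (ccont_cabs (sch_ccont sQ)) (fun x => cabs_ge0 _).
rewrite invr1 mul1e => <-; apply: eq_integral => x _; by rewrite mul1r.
Qed.

(** A multiplier that vanishes at the origin acts on [phi] as a convolution
    operator on [phi'], and rescaling by [2 ^- k] gains the factor [2 ^- k]. *)
Lemma L1norm_multiplier (q : R -> C) : sch q -> exists2 A : R, 0 <= A &
  forall (k : nat) phi phi', sch phi -> cD phi phi' -> sch phi' ->
  L1norm (multiplier (fun xi => rc (xi / 2 ^+ k) * q (xi / 2 ^+ k)) phi) <=
  A * 2 ^- k * L1norm phi'.
Proof.
move=> sq; have c0 := c2pi_neq0.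
have nc0 : - c2pi != 0 by rewrite oppr_eq0.
exists (2 * `|c2pi|^-1 * L1norm (FT (- c2pi) q)).
  by rewrite !mulr_ge0 ?L1norm_ge0 ?invr_ge0.
move=> k phi phi' sp dp sp'.
have e0 : 0 < (2 ^- k : R) by rewrite invr_gt0 exprn_gt0.
pose qk xi := q (2 ^- k * xi).
have bqk : bddC qk by apply: bddC_scale; exact: sch_bddC.
have sqk : sch qk by apply: sch_scale => //; rewrite gt_eqF.
pose z : C := rc (2 ^- k) * - (Complex 0 c2pi)^-1.
have ic0 : Complex 0 c2pi != 0 by rewrite eq_complex /= negb_and c0 orbT.
have icM (x : R) : Complex 0 (c2pi * x) = Complex 0 c2pi * rc x.
  by apply: complex_ext; rewrite ?ReM ?ImM /=; ring.
have cz : cabs z = 2 ^- k * `|c2pi|^-1.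
  rewrite /z cabsM cabs_rc cabsN ger0_norm ?ltW// /cabs Normc.normcV.
  by rewrite /= expr0n add0r sqrtr_sqr.
have sF := sch_FT c0 sp; have sF' := sch_FT c0 sp'.
have sqF : sch (fun xi => qk xi * FT c2pi phi' xi) by exact: bddC_sch.
set psi := multiplier _ _.
have psiE : psi = fun x => z * FT (- c2pi) (fun xi => qk xi * FT c2pi phi' xi) x.
  rewrite -FT_Z; last exact: sch_L1dom.
  rewrite /psi /multiplier fourierE ifourierE; congr FT; apply/funext => xi.
  rewrite (FT_deriv c2pi sp dp sp') icM /qk [xi / _]mulrC rcM /z.
  by field.
pose Q := FT (- c2pi) qk.
have sQ : sch Q by exact: sch_FT.
have QE : Q = fun x => rc (2 ^+ k) * FT (- c2pi) q (2 ^+ k * x + 0).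
  apply/funext => x; rewrite addr0 /Q /FT /qk.
  have [q' dq _] := sch_deriv sq.
  have := cint_affine (f := fun w => q w * expi (- c2pi * w * (2 ^+ k * x))) 0 e0
    (cD_continuous (cDM dq (cD_expi_lin _ _)))
    (L1dom_integrable (FT_integrand _ _ (sch_L1dom sq))).
  rewrite invrK => <-; apply: eq_cint => y _; rewrite addr0; congr (_ * expi _).
  have k0 : (2 ^+ k : R) != 0 by rewrite expf_neq0.
  by field.
have NQ : L1norm Q = L1norm (FT (- c2pi) q).
  have p2 : 0 < (2 ^+ k : R) by rewrite exprn_gt0.
  have sFq := sch_FT nc0 sq.
  have E := L1norm_affine 0 p2 sFq.
  rewrite QE; transitivity (2 ^+ k * L1norm (fun x => FT (- c2pi) q (2 ^+ k * x + 0))).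
    have [ii _] := Rintegral_affine 0 p2 (ccont_cabs (sch_ccont sFq)) (sch_cabs_integrable sFq).
    rewrite /L1norm -RintegralZl//.
    by apply: eq_Rintegral => x _; rewrite cabsM cabs_rc ger0_norm// ltW.
  by rewrite E mulrA divff ?mul1r// gt_eqF.
have spsi : sch psi.
  by rewrite psiE; apply: usch_mulz; exact: sch_FT.
have conv x : FT (- c2pi) (fun xi => qk xi * FT c2pi phi' xi) x =
    cint setT (fun y => phi' y * Q (x - y)).
  transitivity (cint setT (fun xi => qk xi * expi (- c2pi * xi * x) * FT c2pi phi' xi)).
    by apply: eq_cint => xi _; rewrite mulrAC.
  rewrite FT_mult; [|exact/FT_integrand/sch_L1dom|exact: sch_L1dom].
  apply: eq_cint => y _; rewrite mulrC; congr (_ * _); apply: eq_cint => xi _.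
  by rewrite -mulrA -expiD; congr (_ * expi _); ring.
have [K K0 kQ] := bddC_bound (sch_bddC sQ).
have LQ x : L1dom (fun y => phi' y * Q (x - y)).
  apply: (L1domM (K := K)) => [|y|]; [|exact: kQ|exact: sch_L1dom].
  have := bddC_cmeas (bddC_affine (- 1) x (sch_bddC sQ)).
  by under eq_fun do rewrite mulN1r addrC.
clear QE; clearbody psi Q.
apply: (@le_trans _ _ (2 * cabs z * (L1norm phi' * L1norm Q))).
  apply: (L1norm_convolution _ spsi sp' sQ); first by rewrite mulr_ge0 ?cabs_ge0.
  move=> x; rewrite psiE cabsM conv mulrAC mulrC ler_wpM2r ?cabs_ge0//.
  apply: cabs_cint_le => //.
  - exact: L1dom_integrable.
  - have := cintegrable_cabs measurableT (L1dom_integrable (LQ x)).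
    by apply: eq_integrable => // y _; rewrite /= cabsM.
  - by move=> y _; rewrite cabsM.
rewrite NQ cz le_eqVlt; apply/orP; left; apply/eqP; ring.
Qed.

End Multiplier.

(** * Littlewood-Paley pieces and their integrals over intervals *)

Section LittlewoodPaley.
Variable R : realType.
Local Notation C := R[i].
Local Notation mu := (@lebesgue_measure R).
Variables (eta : R -> C) (heta : cutoff eta).
Implicit Types (f : distr R) (g phi : R -> C) (I : interval R).

Lemma lp_symbol_bddC k : bddC (lp_symbol eta k).
Proof.
have [be _ _] := heta.
have h n : bddC (fun xi => eta (xi / 2 ^+ n)).
  by under eq_fun do rewrite mulrC; exact: bddC_scale.
by case: k => [|k] //=; exact: bddCB.
Qed.

Lemma lp_symbol_sum n xi : \sum_(k < n.+1) lp_symbol eta k xi = eta (xi / 2 ^+ n).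
Proof.
elim: n => [|n IH]; first by rewrite big_ord1 /= expr0 divr1.
by rewrite big_ord_recr /= IH addrC subrK.
Qed.

(** A dyadic symbol equal to [1] on the support of [eta x - eta (2 * x)], and vanishing
    near the origin. *)
Definition theta (y : R) : C := eta (2^-1 * y) - eta (4 * y).

Lemma theta_sch : sch theta.
Proof.
have [be e0 _] := heta.
apply: (usch_compact (A := 3 / 2)); first by apply: bddCB; exact: bddC_scale.
move=> _ x xA; rewrite /theta !e0 ?subrr// normrM gtr0_norm ?invr_gt0//; lra.
Qed.

Lemma lp_symbol_fat k xi :
  lp_symbol eta k.+1 xi * theta (xi / 2 ^+ k.+1) = lp_symbol eta k.+1 xi.
Proof.
have [_ e0 e1] := heta; rewrite /=.
set y := xi / 2 ^+ k.+1.
have -> : xi / 2 ^+ k = 2 * y.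
  have k0 : (2 ^+ k : R) != 0 by rewrite expf_neq0.
  by rewrite /y exprS; field.
have n2 (c : R) : 0 < c -> `|c * y| = c * `|y| by move=> c0; rewrite normrM gtr0_norm.
have [y1|y1] := leP `|y| (1 / 4).
  by rewrite !e1 ?subrr ?mul0r// ?n2//; lra.
have [y2|y2] := leP (3 / 4) `|y|.
  by rewrite !e0 ?subrr ?mul0r// ?n2//; lra.
rewrite /theta (e1 (2^-1 * y)) ?n2 ?invr_gt0//; last by lra.
by rewrite (e0 (4 * y)) ?n2//; [rewrite subr0 mulr1|lra].
Qed.

Lemma theta_div : exists2 q, sch q & forall x, theta x = rc x * q x.
Proof.
have [_ _ e1] := heta.
apply: hadamard_sch; first exact: theta_sch.
by rewrite /theta !mulr0 subrr.
Qed.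

Lemma cabs_cint_mul_le g psi (M : R) : cintegrable setT (fun x => g x * psi x) ->
  (forall x, cabs (g x) <= M) -> sch psi ->
  cabs (cint setT (fun x => g x * psi x)) <= 2 * (M * L1norm psi).
Proof.
move=> ig gM sp; have ip := sch_cabs_integrable sp.
rewrite /L1norm -RintegralZl//.
apply: cabs_cint_le; [exact: measurableT|exact: ig|exact: integrableZR|].
by move=> x _; rewrite cabsM ler_wpM2r ?cabs_ge0.
Qed.

(** The key estimate.  Test the piece against smooth approximations of the indicator
    function of the interval.  Since [theta (xi / 2 ^+ k)] reproduces the symbol of the
    piece, it may first be applied to the test function; it vanishes at the origin, so
    it acts as a convolution on the derivative and gains [2 ^- k], while the derivative
    is bounded in [L^1] whatever the length of the interval. *)
Lemma lp_piece_cint : exists2 K : R, 0 <= K & forall k f g (M a b : R),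
  has_density (lp_piece eta k.+1 f) g -> (forall x, cabs (g x) <= M) -> a <= b ->
  cabs (cint `]a, b] g) <= K * 2 ^- k.+1 * M.
Proof.
have [q sq tq] := theta_div.
have [A A0 hA] := L1norm_multiplier sq.
have hA' k phi phi' : sch phi -> cD phi phi' -> sch phi' ->
    L1norm (multiplier (fun xi => theta (xi / 2 ^+ k)) phi) <= A * 2 ^- k * L1norm phi'.
  have -> : (fun xi => theta (xi / 2 ^+ k)) = fun xi => rc (xi / 2 ^+ k) * q (xi / 2 ^+ k).
    by apply/funext => xi; rewrite tq.
  exact: hA.
have [B B0 hB] := approx_indic_deriv heta.
exists (2 * A * B); first by rewrite !mulr_ge0.
move=> k f g M a b dg gM ab.
have M0 : 0 <= M by apply: le_trans (gM 0); exact: cabs_ge0.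
apply: (ccvg_le (has_density_lim heta ab dg)) => n.
set phi := approx_indic eta a b n.
have sp : sch phi by exact: approx_indic_sch.
have [phi' dphi [sp' Np]] := hB a b n ab.
have bth : bddC (fun xi => theta (xi / 2 ^+ k.+1)).
  by under eq_fun do rewrite mulrC; apply: bddC_scale; apply: sch_bddC; exact: theta_sch.
pose psi := multiplier (fun xi => theta (xi / 2 ^+ k.+1)) phi.
have spsi : sch psi by exact: sch_multiplier.
have E : lp_piece eta k.+1 f phi = lp_piece eta k.+1 f psi.
  rewrite -[LHS]/(f (multiplier (lp_symbol eta k.+1) phi)).
  rewrite -[RHS]/(f (multiplier (lp_symbol eta k.+1) psi)).
  rewrite /psi (multiplier_comp _ bth sp); congr (f (multiplier _ phi)).
  by apply/funext => xi; rewrite lp_symbol_fat.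
have e0 : 0 <= (2 ^- k.+1 : R) by rewrite invr_ge0 exprn_ge0.
have Npsi : L1norm psi <= A * 2 ^- k.+1 * B.
  apply: (@le_trans _ _ (A * 2 ^- k.+1 * L1norm phi')).
    exact: hA' sp dphi sp'.
  by apply: ler_wpM2l Np; exact: mulr_ge0.
have [_ _ ig eu] := dg; have /schP spsi' := spsi.
rewrite E (eu _ spsi') /dfun.
clearbody psi.
apply: (@le_trans _ _ (2 * (M * L1norm psi))); first exact: cabs_cint_mul_le (ig _ spsi') gM spsi.
have -> : 2 * A * B * 2 ^- k.+1 * M = 2 * (M * (A * 2 ^- k.+1 * B)) by ring.
exact: (ler_wpM2l (ler0n R 2) (ler_wpM2l M0 Npsi)).
Qed.

Lemma cint_itv_bounded g (M a b : R) : cintegrable `[a, b] g ->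
  (forall x, cabs (g x) <= M) -> a <= b -> cabs (cint `]a, b] g) <= 2 * (M * (b - a)).
Proof.
move=> ig gM ab.
have ic : mu.-integrable `]a, b] (EFin \o (fun=> M)).
  apply: (@integrableS _ _ _ mu `[a, b]) => //.
    exact: subset_itv_oc_cc.
  apply: continuous_compact_integrable; first exact: segment_compact.
  by apply: continuous_subspaceT => x; exact: cst_continuous.
have -> : M * (b - a) = Rintegral mu `]a, b] (fun=> M).
  rewrite Rintegral_cst//= lebesgue_measure_itv /= lte_fin.
  case: ltP => [//|ba]; rewrite (_ : b = a) ?subrr//.
  by apply/eqP; rewrite eq_le ba ab.
apply: cabs_cint_le => //.
by apply: cintegrableS ig => //; exact: subset_itv_oc_cc.
Qed.

Lemma cint_itv_sides (b1 b2 : bool) (a b : R) g :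
  (forall a b : R, cintegrable `[a, b] g) -> a <= b ->
  cint [set` Interval (BSide b1 a) (BSide b2 b)] g = cint `]a, b] g.
Proof.
move=> ig ab; have [i1 i2] := ig a b.
have H (u : R -> R) : mu.-integrable `[a, b] (EFin \o u) ->
    Rintegral mu [set` Interval (BSide b1 a) (BSide b2 b)] u = Rintegral mu `]a, b] u.
  move=> iu.
  have iu' b1' b2' : mu.-integrable [set` Interval (BSide b1' a) (BSide b2' b)] (EFin \o u).
    apply: (@integrableS _ _ _ mu `[a, b]) => //.
    apply: subset_itv; [by case: b1'; rewrite bnd_simp|by case: b2'; rewrite bnd_simp].
  have R1 b1' : Rintegral mu [set` Interval (BSide b1' a) (BSide b2 b)] u =
      Rintegral mu [set` Interval (BSide b1' a) (BRight b)] u.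
    by case: (b2) => //; rewrite Rintegral_itv_bndo_bndc.
  rewrite R1; case: (b1) => //.
  by rewrite Rintegral_itv_obnd_cbnd.
by apply: complex_ext; rewrite /cint /= H.
Qed.

(** Endpoints are null sets, and an empty interval is as good as [`]0, 0]]. *)
Lemma bounded_itvP I : bounded_itv I -> exists a b : R, [/\ a <= b,
  itv_length I = b - a & forall g, (forall a b, cintegrable `[a, b] g) ->
    cint [set` I] g = cint `]a, b] g].
Proof.
have [I0 _|] := eqVneq ([set` I] : set R) set0.
  exists 0, 0; split=> //; first by rewrite /itv_length I0 measure0 subrr.
  move=> g _; rewrite I0 /cint !Rintegral_set0.
  by rewrite set_itvoc0 !Rintegral_set0.
move=> /set0P[x xI] [M [_ HM]].
have bnd y : y \in I -> `|y| <= `|M| + 1.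
  by move=> yI; apply: (HM (`|M| + 1)) => //; rewrite (le_lt_trans (ler_norm M))// ltrDl.
have absurd P y : y \in I -> `|M| + 1 < y -> P.
  by move=> /bnd h; rewrite ltNge (le_trans _ h)// ler_norm.
have absurdN P y : y \in I -> `|M| + 1 < - y -> P.
  by move=> /bnd h; rewrite ltNge (le_trans _ h)// -normrN ler_norm.
have hM := normr_ge0 M.
have {}xI : x \in I := xI.
case: I xI HM bnd absurd absurdN => [[b1 a|[]] [b2 b|[]]] xI _ bnd absurd absurdN.
- have ab : a <= b.
    by move: xI; rewrite in_itv => /andP[/lteifW h1 /lteifW h2]; exact: le_trans h1 h2.
  exists a, b; split=> //; last by move=> g ig; exact: cint_itv_sides.
  rewrite /itv_length lebesgue_measure_itv /= lte_fin; case: ltP => [//|ba].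
  by rewrite (_ : b = a) ?subrr//; apply/eqP; rewrite eq_le ba ab.
- by move: xI; rewrite in_itv /= andbF.
- have ha := normr_ge0 a; have ha' := ler_norm a.
  apply: (absurd _ (`|a| + `|M| + 2)); last by lra.
  by rewrite in_itv /= andbT; case: (b1) => /=; lra.
- have hb := normr_ge0 b; have hb' := ler_norm (- b); rewrite normrN in hb'.
  apply: (absurdN _ (- (`|b| + `|M| + 2))); last by lra.
  by rewrite in_itv /=; case: (b2) => /=; lra.
- by move: xI; rewrite in_itv.
- by apply: (absurd _ (`|M| + 2)); [rewrite in_itv|lra].
- by move: xI; rewrite in_itv.
- by move: xI; rewrite in_itv.
- by move: xI; rewrite in_itv.
Qed.

End LittlewoodPaley.

(** * The functionals on the Besov space *)

Section Series.
Variable R : realType.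
Local Notation C := R[i].

Lemma cseries_dominated (z : nat -> C) (s : nat -> R) (B : R) :
  (forall k, cabs (z k) <= s k) -> (forall n, \sum_(k < n) s k <= B) ->
  [/\ cis_cvg_series z, ccvg (fun n => \sum_(k < n) z k) (cseries z) &
      cabs (cseries z) <= B].
Proof.
move=> zs sB.
have s0 k : 0 <= s k by apply: le_trans (zs k); exact: cabs_ge0.
have cs : cvgn (series s).
  apply: nondecreasing_is_cvgn.
    by apply: nondecreasing_series => n _ _; exact: s0.
  by exists B => _ [n _ <-]; rewrite /series /= big_mkord.
have cz (u : nat -> R) : (forall k, `|u k| <= cabs (z k)) -> cvgn (series u).
  move=> uz; apply: normed_cvg; apply: series_le_cvg cs => //= k.
  exact: le_trans (uz k) (zs k).
have c1 := cz _ (fun k => cabs_Re (z k)); have c2 := cz _ (fun k => cabs_Im (z k)).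
have cc : ccvg (fun n => \sum_(k < n) z k) (cseries z).
  apply: ccvg_ReIm.
  - under eq_fun do rewrite Re_sum.
    have -> : (fun n => \sum_(i < n) complex.Re (z i)) = series (fun k => complex.Re (z k)).
      by rewrite seriesEord.
    exact: c1.
  - under eq_fun do rewrite Im_sum.
    have -> : (fun n => \sum_(i < n) complex.Im (z i)) = series (fun k => complex.Im (z k)).
      by rewrite seriesEord.
    exact: c2.
split=> //; apply: (ccvg_le cc) => n.
apply: le_trans (cabs_sum _ _) _; apply: le_trans (sB n).
by apply: ler_sum => k _; exact: zs.
Qed.

End Series.

Section Besov.
Variable R : realType.
Local Notation C := R[i].
Local Notation mu := (@lebesgue_measure R).
Variables (eta : R -> C) (heta : cutoff eta).
Implicit Types (f g : distr R) (I : interval R).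

Definition lp_norm f k : R := fine (dLinfty (lp_piece eta k f)).

Lemma dLinfty_ge0 f : (0 <= dLinfty f)%E.
Proof. by apply: le_ereal_inf_tmp => _ [g _ <-]; exact: Lnorm_ge0. Qed.

Lemma lp_norm_ge0 f k : 0 <= lp_norm f k.
Proof. by apply: fine_ge0; exact: dLinfty_ge0. Qed.

Lemma besov_term_ge0 f k : (0 <= (2 ^- k)%:E * dLinfty (lp_piece eta k f))%E.
Proof. by rewrite mule_ge0 ?dLinfty_ge0// lee_fin invr_ge0 exprn_ge0. Qed.

Lemma besov_norm_ge0 f : (0 <= besov_norm eta f)%E.
Proof. by apply: nneseries_ge0 => k _ _; exact: besov_term_ge0. Qed.

Lemma besov_norm_fin f : besov eta f -> besov_norm eta f \is a fin_num.
Proof. by move=> [_ h]; rewrite ge0_fin_numE// besov_norm_ge0. Qed.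

Lemma besov_dLinfty f k : besov eta f -> dLinfty (lp_piece eta k f) = (lp_norm f k)%:E.
Proof.
move=> [_ h]; rewrite fineK// ge0_fin_numE ?dLinfty_ge0// ltey.
apply/eqP => E; move: h.
have := @nneseries_lim_ge R (fun k => (2 ^- k)%:E * dLinfty (lp_piece eta k f))%E
  xpredT 0%N k.+1 (fun k _ _ => besov_term_ge0 f k).
rewrite big_nat_recr//= E mulry gtr0_sg ?invr_gt0 ?exprn_gt0// mul1e.
rewrite addey; last first.
  rewrite -ltNye; apply: (@lt_le_trans _ _ 0%E); first exact: ltNy0.
  by apply: sume_ge0 => i _; exact: besov_term_ge0.
rewrite leye_eq => /eqP; rewrite /besov_norm => ->.
by rewrite ltxx.
Qed.

Lemma besov_sum f n : besov eta f ->
  \sum_(k < n) 2 ^- k * lp_norm f k <= fine (besov_norm eta f).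
Proof.
move=> bf; rewrite -lee_fin fineK; last exact: besov_norm_fin.
have := @nneseries_lim_ge R (fun k => (2 ^- k)%:E * dLinfty (lp_piece eta k f))%E
  xpredT 0%N n (fun k _ _ => besov_term_ge0 f k).
apply: le_trans; rewrite big_mkord -sumEFin.
by rewrite le_eqVlt; apply/orP; left; apply/eqP; apply: eq_bigr => k _;
  rewrite besov_dLinfty// -EFinM.
Qed.

Lemma besov_density f k (e : R) : 0 < e -> besov eta f ->
  exists2 g, has_density (lp_piece eta k f) g & forall x, cabs (g x) <= lp_norm f k + e.
Proof.
move=> e0 bf; apply: dLinfty_density.
by rewrite besov_dLinfty// lte_fin ltrDl.
Qed.

Definition lp_density f k := density (lp_piece eta k f).

Lemma lp_densityP f k : besov eta f -> has_density (lp_piece eta k f) (lp_density f k).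
Proof. by move=> bf; have [g dg _] := besov_density k ltr01 bf; exact: densityP dg. Qed.

Lemma lp_density_locint f k (a b : R) : besov eta f ->
  cintegrable `[a, b] (lp_density f k).
Proof. by move=> bf; have d := lp_densityP k bf; exact: (has_density_locint heta a b d). Qed.

Lemma lp_density_cint0 f k (a b : R) : besov eta f -> a <= b ->
  cabs (cint `]a, b] (lp_density f k)) <= 2 * (lp_norm f k * (b - a)).
Proof.
move=> bf ab; apply/ler_addgt0Pr => e e0.
pose d := e / (2 * (b - a) + 1).
have d0 : 0 < d by rewrite divr_gt0//; lra.
have [g dg gM] := besov_density k d0 bf.
rewrite (cint_density heta ab dg).
apply: le_trans (cint_itv_bounded (has_density_locint heta a b dg) gM ab) _.
have : d * (2 * (b - a) + 1) = e by rewrite /d divfK// gt_eqF//; lra.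
by nra.
Qed.

Lemma lp_density_cint : exists2 K : R, 0 <= K & forall f k (a b : R),
  besov eta f -> a <= b ->
  cabs (cint `]a, b] (lp_density f k.+1)) <= K * (2 ^- k.+1 * lp_norm f k.+1).
Proof.
have [K K0 hK] := lp_piece_cint heta; exists K => // f k a b bf ab.
apply/ler_addgt0Pr => e e0.
have p0 : 0 < (2 ^- k.+1 : R) by rewrite invr_gt0 exprn_gt0.
have Kp : 0 <= K * 2 ^- k.+1 by rewrite mulr_ge0// ltW.
pose d := e / (K * 2 ^- k.+1 + 1).
have d0 : 0 < d by rewrite divr_gt0//; lra.
have [g dg gM] := besov_density k.+1 d0 bf.
rewrite (cint_density heta ab dg).
apply: le_trans (hK _ _ _ _ _ _ dg gM ab) _.
have : d * (K * 2 ^- k.+1 + 1) = e by rewrite /d divfK// gt_eqF//; lra.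
move=> dE; have -> : K * (2 ^- k.+1 * lp_norm f k.+1) + e =
    K * 2 ^- k.+1 * (lp_norm f k.+1 + d) + d by rewrite -dE; ring.
by rewrite lerDl ltW.
Qed.

Definition same_integrals I (a b : R) := forall g : R -> C,
  (forall a b : R, cintegrable `[a, b] g) -> cint [set` I] g = cint `]a, b] g.

Lemma lambda_term_itv f I k (a b : R) : besov eta f ->
  same_integrals I a b ->
  lambda_term eta I f k = cint `]a, b] (lp_density f k).
Proof. by move=> bf; apply => a' b'; exact: lp_density_locint. Qed.

(** The trivial bound serves for [k = 0], where it costs the factor [b - a]; the key
    estimate serves for [k > 0]. *)
Lemma cint_lp_density : exists2 K : R, 0 <= K & forall f k (a b : R),
  besov eta f -> a <= b ->
  cabs (cint `]a, b] (lp_density f k)) <= K * (1 + (b - a)) * (2 ^- k * lp_norm f k).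
Proof.
have [K K0 hK] := lp_density_cint; exists (2 + K); first exact: addr_ge0.
move=> f k a b bf ab; have n0 := lp_norm_ge0 f k.
have ba : 0 <= b - a by rewrite subr_ge0.
case: k n0 => [|k] n0.
  apply: le_trans (lp_density_cint0 0 bf ab) _.
  rewrite expr0 invr1 mul1r mulrCA mulrC.
  by rewrite ler_wpM2r//; nra.
apply: le_trans (hK f k a b bf ab) _.
have p0 : 0 <= 2 ^- k.+1 * lp_norm f k.+1 by rewrite mulr_ge0// invr_ge0 exprn_ge0.
by rewrite ler_wpM2r//; nra.
Qed.

(** [lambda] for [`]a, b]], to which every bounded interval reduces by [bounded_itvP]. *)
Definition itv_functional f (a b : R) : C := cseries (fun k => cint `]a, b] (lp_density f k)).

Lemma itv_functionalP : exists2 K : R, 0 <= K & forall f (a b : R), besov eta f -> a <= b ->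
  [/\ cis_cvg_series (fun k => cint `]a, b] (lp_density f k)),
      ccvg (fun n => \sum_(k < n) cint `]a, b] (lp_density f k)) (itv_functional f a b) &
      cabs (itv_functional f a b) <= K * (1 + (b - a)) * fine (besov_norm eta f)].
Proof.
have [K K0 hK] := cint_lp_density; exists K => // f a b bf ab.
apply: (cseries_dominated (fun k => hK f k a b bf ab)) => n.
rewrite -mulr_sumr ler_wpM2l//; last exact: besov_sum.
by rewrite mulr_ge0//; lra.
Qed.

Lemma lambda_itv f I (a b : R) : besov eta f ->
  same_integrals I a b ->
  lambda eta I f = itv_functional f a b.
Proof.
move=> bf h; rewrite /lambda /itv_functional; congr cseries; apply/funext => k.
exact: lambda_term_itv.
Qed.

Lemma lambdaP : exists2 K : R, 0 <= K & forall f I, besov eta f -> bounded_itv I ->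
  [/\ cis_cvg_series (lambda_term eta I f),
      ccvg (fun n => \sum_(k < n) lambda_term eta I f k) (lambda eta I f) &
      cabs (lambda eta I f) <= K * (1 + itv_length I) * fine (besov_norm eta f)].
Proof.
have [K K0 hK] := itv_functionalP; exists K => // f I bf bI.
have [a [b [ab -> hI]]] := bounded_itvP bI.
have E : lambda_term eta I f = fun k => cint `]a, b] (lp_density f k).
  by apply/funext => k; exact: lambda_term_itv.
by rewrite (lambda_itv bf hI) E; exact: hK.
Qed.

Lemma lp_density_dlin (z : C) f g k (a b : R) : besov eta f -> besov eta g -> a <= b ->
  cint `]a, b] (lp_density (Defs.dlin z f g) k) =
  z * cint `]a, b] (lp_density f k) + cint `]a, b] (lp_density g k).
Proof.
move=> bf bg ab.
have d := has_density_dlin z (lp_densityP k bf) (lp_densityP k bg).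
have -> := cint_density heta ab (d : has_density (lp_piece eta k (Defs.dlin z f g)) _).
have i h : besov eta h -> cintegrable `]a, b] (lp_density h k).
  move=> bh; apply: cintegrableS (lp_density_locint k a b bh) => //.
  exact: subset_itv_oc_cc.
rewrite cintD//; [|by apply: cintegrableZ => //; exact: i|exact: i].
by rewrite cintZ//; exact: i.
Qed.

Lemma lambda_linear I : bounded_itv I -> linear_on_besov eta (lambda eta I).
Proof.
move=> bI z f g bf bg; have [K _ hK] := lambdaP.
have [_ cf _] := hK f I bf bI; have [_ cg _] := hK g I bg bI.
have [a [b [ab _ hI]]] := bounded_itvP bI.
have E k : lambda_term eta I (Defs.dlin z f g) k =
    z * lambda_term eta I f k + lambda_term eta I g k.
  rewrite (lambda_term_itv _ bf hI) (lambda_term_itv _ bg hI) -(lp_density_dlin _ _ bf bg ab).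
  apply: hI => a' b'; apply: (has_density_locint heta).
  exact: densityP (has_density_dlin z (lp_densityP k bf) (lp_densityP k bg)).
have cc : ccvg (fun n => \sum_(k < n) lambda_term eta I (Defs.dlin z f g) k)
    (z * lambda eta I f + lambda eta I g).
  under eq_fun do under eq_bigr do rewrite E.
  under eq_fun do rewrite big_split /= -mulr_sumr.
  exact: (ccvgD (ccvgZ z cf) cg).
apply: complex_ext.
- apply/cvg_lim => //; have := ccvg_Re cc; under eq_fun do rewrite Re_sum.
  by rewrite seriesEord.
- apply/cvg_lim => //; have := ccvg_Im cc; under eq_fun do rewrite Im_sum.
  by rewrite seriesEord.
Qed.

End Besov.

(** * Schwartz functions in the Besov space *)

Section SchwartzBesov.
Variable R : realType.
Local Notation C := R[i].
Local Notation mu := (@lebesgue_measure R).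
Variables (eta : R -> C) (heta : cutoff eta).
Implicit Types (f : distr R) (phi psi g : R -> C) (I : interval R).

Definition lp_function k phi : R -> C :=
  ifourier (fun xi => lp_symbol eta k xi * fourier phi xi).

Lemma lp_function_sch k phi : sch phi -> sch (lp_function k phi).
Proof.
by move=> sp; apply/sch_ifourier/bddC_sch; [exact: lp_symbol_bddC|exact: sch_fourier].
Qed.

(** Two applications of the multiplication formula. *)
Lemma lp_function_density k phi : sch phi ->
  has_density (lp_piece eta k (dfun phi)) (lp_function k phi).
Proof.
move=> sp; have sl := lp_function_sch k sp.
have [m1 m2] := sch_cmeas sl; split=> //.
- move=> psi /schP spsi; apply: L1dom_integrable.
  have [K K0 kK] := bddC_bound (sch_bddC spsi).
  exact: L1domM (sch_cmeas spsi) kK (sch_L1dom sl).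
- move=> psi /schP spsi.
  rewrite -[LHS]/(cint setT (fun x => phi x * multiplier (lp_symbol eta k) psi x)).
  have bl := lp_symbol_bddC heta k.
  have si := sch_ifourier spsi.
  have L1 : L1dom (fun xi => lp_symbol eta k xi * ifourier psi xi).
    by apply: sch_L1dom; exact: bddC_sch.
  have L2 : L1dom (fun xi => lp_symbol eta k xi * fourier phi xi).
    by apply: sch_L1dom; apply: bddC_sch => //; exact: sch_fourier.
  rewrite /multiplier fourierE (FT_mult _ (sch_L1dom sp) L1) -fourierE.
  transitivity (cint setT (fun x => lp_symbol eta k x * fourier phi x * ifourier psi x)).
    by apply: eq_cint => x _; ring.
  by rewrite ifourierE (FT_mult _ L2 (sch_L1dom spsi)) -ifourierE.
Qed.

Lemma Lnorm_oo_le g (M : R) : (forall x, cabs (g x) <= M) ->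
  (Lnorm mu +oo%E (EFin \o cabs (R:=R) \o g) <= M%:E)%E.
Proof.
move=> gM; have M0 : 0 <= M by apply: le_trans (gM 0); exact: cabs_ge0.
rewrite unlock /=; case: ifPn => _; last by rewrite lee_fin.
apply/ess_supP; apply: aeW => x; rewrite /= lee_fin ger0_norm ?cabs_ge0//.
Qed.

Lemma lp_symbol_bound : exists2 K : R, 0 <= K & forall k xi, cabs (lp_symbol eta k xi) <= K.
Proof.
have [be _ _] := heta; have [K K0 kK] := bddC_bound be.
exists (K + K); first exact: addr_ge0.
case=> [|k] xi /=; first by rewrite (le_trans (kK _))// lerDl.
by rewrite (le_trans (cabsB _ _))// lerD.
Qed.

Lemma tempered_dfun phi : sch phi -> tempered (dfun phi).
Proof.
move=> sp; have L psi : schwartz psi -> cintegrable setT (fun x => phi x * psi x).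
  move=> /schP spsi; apply: L1dom_integrable.
  have [K K0 kK] := bddC_bound (sch_bddC spsi).
  exact: L1domM (sch_cmeas spsi) kK (sch_L1dom sp).
split.
- move=> a f g sf sg; rewrite /dfun -cintZ//; last exact: L.
  rewrite -cintD//; [|by apply: cintegrableZ => //; exact: L|exact: L].
  by apply: eq_cint => x _; ring.
- exists 1%N, (2 * L1norm phi) => psi spsi; rewrite !big_ord1.
  have [ssm /(_ 0%N 0%N)] := spsi.
  set S := seminorm 0 0 psi => Soo.
  have le x : ((cabs (psi x))%:E <= S)%E.
    apply: ereal_sup_ubound; exists x => //.
    by rewrite expr0 mul1r /cderiv /= /re /im; case: (psi x).
  have S0 : (0 <= S)%E by apply: le_trans (le 0); rewrite lee_fin cabs_ge0.
  have Sfin : S \is a fin_num by rewrite ge0_fin_numE.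
  have bd x : cabs (psi x) <= fine S by rewrite -lee_fin fineK.
  rewrite -(fineK Sfin) -EFinM lee_fin /dfun.
  rewrite (_ : (fun x => phi x * psi x) = fun x => psi x * phi x); last first.
    by apply/funext => x; rewrite mulrC.
  apply: le_trans (cabs_cint_mul_le _ bd sp) _.
    by have := L psi spsi; under eq_fun do rewrite mulrC.
  by rewrite le_eqVlt; apply/orP; left; apply/eqP; ring.
Qed.

Lemma lp_symbol_fourier_bound phi : sch phi -> exists2 K : R, 0 <= K &
  forall (m : R -> C) (L : R), cmeas setT m -> (forall xi, cabs (m xi) <= L) ->
  forall x, cabs (ifourier (fun xi => m xi * fourier phi xi) x) <= L * K.
Proof.
move=> sp; have [mF [K K0 kK]] := sch_L1dom (sch_fourier sp).
exists (2 * (K * Rintegral mu setT (@maj R))).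
  by rewrite !mulr_ge0// Rintegral_ge0// => x _; exact: maj_ge0.
move=> m L mm mL x; have L0 : 0 <= L by apply: le_trans (mL 0); exact: cabs_ge0.
rewrite ifourierE; apply: (le_trans (FT_bound (K := L * K) _ _ _ _)).
- exact: cmeasM.
- by move=> y; rewrite cabsM -mulrA ler_pM ?cabs_ge0.
- by rewrite le_eqVlt; apply/orP; left; apply/eqP; ring.
Qed.

Lemma sum_half n : \sum_(k < n) (2 ^- k : R) <= 2.
Proof.
suff -> : \sum_(k < n) (2 ^- k : R) = 2 - 2 * 2 ^- n.
  by rewrite gerBl mulr_ge0// invr_ge0 exprn_ge0.
elim: n => [|n IH]; first by rewrite big_ord0 expr0 invr1 mulr1 subrr.
rewrite big_ord_recr /= IH exprS.
have n0 : (2 ^+ n : R) != 0 by rewrite expf_neq0.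
by field.
Qed.

(** The Fourier transform of [phi] is integrable and the symbols are bounded uniformly
    in [k], so the pieces are bounded by one constant and the dyadic weights sum. *)
Lemma besov_dfun phi : sch phi -> besov eta (dfun phi).
Proof.
move=> sp; split; first exact: tempered_dfun.
have [K K0 hK] := lp_symbol_fourier_bound sp; have [L L0 hL] := lp_symbol_bound.
have D k : (dLinfty (lp_piece eta k (dfun phi)) <= (L * K)%:E)%E.
  apply: ge_ereal_inf; exists (Lnorm mu +oo%E (EFin \o cabs (R:=R) \o lp_function k phi)).
    by exists (lp_function k phi) => //; exact: lp_function_density.
  apply: Lnorm_oo_le => x; apply: hK => //.
  by apply: bddC_cmeas; exact: lp_symbol_bddC.
apply: (@le_lt_trans _ _ (2 * (L * K))%:E); last exact: ltry.
apply: lime_le; first by apply: is_cvg_nneseries => k _ _; exact: besov_term_ge0.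
apply: nearW => n; rewrite big_mkord.
apply: (@le_trans _ _ (\sum_(k < n) (2 ^- k * (L * K))%:E)%E).
  by apply: lee_sum => k _; rewrite EFinM lee_wpmul2l.
rewrite sumEFin lee_fin -mulr_suml ler_wpM2r ?sum_half//.
exact: mulr_ge0.
Qed.

(** The symbols telescope. *)
Lemma lp_function_sum phi n x : sch phi -> \sum_(k < n.+1) lp_function k phi x =
  ifourier (fun xi => eta (xi / 2 ^+ n) * fourier phi xi) x.
Proof.
move=> sp; have sF := sch_fourier sp.
under eq_bigr do rewrite /lp_function ifourierE.
rewrite ifourierE /FT -cint_sum//; last first.
  move=> k; apply: L1dom_integrable; apply: FT_integrand.
  by apply: sch_L1dom; apply: bddC_sch => //; exact: lp_symbol_bddC.
apply: eq_cint => xi _; rewrite -!mulr_suml.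
by rewrite lp_symbol_sum.
Qed.

Lemma cutoff_dilate_cvg xi : ccvg (fun n => eta (xi / 2 ^+ n)) 1.
Proof.
have [_ _ e1] := heta; apply: cvg_near_cst; near=> n.
have h : `|xi| * 2 <= 2 ^+ n.
  apply: (@le_trans _ _ n%:R); last by rewrite -natrX ler_nat ltnW// ltn_expl.
  by near: n; exact: nbhs_infty_ger.
have p0 : 0 < (2 ^+ n : R) by rewrite exprn_gt0.
rewrite e1; first by rewrite subrr cabs0.
by rewrite normrM normfV (gtr0_norm p0) ler_pdivrMr//; lra.
Unshelve. all: by end_near. Qed.

Lemma lp_function_cvg phi x : sch phi ->
  ccvg (fun n => ifourier (fun xi => eta (xi / 2 ^+ n) * fourier phi xi) x) (phi x).
Proof.
move=> sp; have sF := sch_fourier sp; rewrite -{2}(fourierK sp).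
under eq_fun do rewrite ifourierE.
rewrite ifourierE /FT.
have [be _ _] := heta; have [K K0 kK] := bddC_bound be.
have iG := integrableZR K measurableT (sch_cabs_integrable sF).
have mF n : cmeas setT (fun xi : R => eta (xi / 2 ^+ n) * fourier phi xi * expi (c2pi R * xi * x)).
  apply: cmeasM; last exact: cmeas_expi.
  apply: cmeasM; last exact: sch_cmeas.
  by under eq_fun do rewrite mulrC; apply: bddC_cmeas; exact: bddC_scale.
have cF (xi : R) : setT xi -> ccvg (fun n => eta (xi / 2 ^+ n) * fourier phi xi * expi (c2pi R * xi * x))
    (fourier phi xi * expi (c2pi R * xi * x)).
  move=> _; apply: ccvgZr; rewrite -[X in ccvg _ X]mul1r.
  by apply: ccvgZr; exact: cutoff_dilate_cvg.
have bF n (xi : R) : setT xi ->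
    cabs (eta (xi / 2 ^+ n) * fourier phi xi * expi (c2pi R * xi * x)) <= K * cabs (fourier phi xi).
  by move=> _; rewrite !cabsM cabs_expi mulr1 ler_wpM2r ?cabs_ge0.
exact: (cint_dct measurableT mF cF iG bF).2.
Qed.

(** The partial sums of the Littlewood-Paley decomposition tend to [phi] pointwise and
    boundedly, so that their integrals over the interval converge. *)
Lemma lambda_dfun I phi : bounded_itv I -> sch phi ->
  lambda eta I (dfun phi) = cint [set` I] phi.
Proof.
move=> bI sp; have bp := besov_dfun sp.
have [a [b [ab _ hI]]] := bounded_itvP bI.
rewrite (lambda_itv heta bp hI) hI; last first.
  by move=> a' b'; apply: cintegrableS (sch_integrable sp).
have [K' _ hL] := itv_functionalP heta; have [_ cL _] := hL _ a b bp ab.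
apply: ccvg_unique (cvg_comp _ _ (@cvg_addnr 1) cL) _ => /=.
have [K K0 hK] := lp_symbol_fourier_bound sp.
have [be _ _] := heta; have [M M0 kM] := bddC_bound be.
have i k : cintegrable `]a, b] (lp_function k phi).
  by apply: cintegrableS (sch_integrable (lp_function_sch k sp)).
have E n : \sum_(k < n.+1) cint `]a, b] (lp_density eta (dfun phi) k) =
    cint `]a, b] (ifourier (fun xi => eta (xi / 2 ^+ n) * fourier phi xi)).
  under eq_bigr do rewrite (cint_density heta ab (lp_function_density _ sp)).
  rewrite -cint_sum//; apply: eq_cint => x _; exact: lp_function_sum.
under eq_fun do rewrite addn1 E.
have ic : mu.-integrable `]a, b] (EFin \o (fun=> M * K)).
  apply: (@integrableS _ _ _ mu `[a, b]) => //; first exact: subset_itv_oc_cc.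
  apply: continuous_compact_integrable; first exact: segment_compact.
  by apply: continuous_subspaceT => x; exact: cst_continuous.
have bn n : bddC (fun xi => eta (xi / 2 ^+ n)).
  by under eq_fun do rewrite mulrC; exact: bddC_scale.
have mF n : cmeas `]a, b] (ifourier (fun xi => eta (xi / 2 ^+ n) * fourier phi xi)).
  have /sch_cmeas[h1 h2] : sch (ifourier (fun xi => eta (xi / 2 ^+ n) * fourier phi xi)).
    by apply: sch_ifourier; apply: bddC_sch => //; exact: sch_fourier.
  by split; exact: measurable_funTS.
have bF n x : `]a, b]%classic x ->
    cabs (ifourier (fun xi => eta (xi / 2 ^+ n) * fourier phi xi) x) <= M * K.
  by move=> _; apply: hK => //; exact: bddC_cmeas.
exact: (cint_dct (measurable_itv _) mF (fun x _ => lp_function_cvg x sp) ic bF).2.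
Qed.

End SchwartzBesov.

(** * Step functions and the extended Haar system *)

Section Pairing.
Variable R : realType.
Local Notation C := R[i].
Local Notation mu := (@lebesgue_measure R).
Variables (eta : R -> C) (heta : cutoff eta).
Implicit Types (f : distr R) (h : R -> C) (I : interval R) (s : seq (C * interval R)).

Lemma rc_indic (A : set R) (x : R) : rc (\1_A x : R) = \1_A x.
Proof. by rewrite !indicE rc_nat. Qed.

Lemma step_fun_cons p s x :
  step_fun (p :: s) x = p.1 * \1_([set` p.2] : set R) x + step_fun s x.
Proof. by rewrite /step_fun big_cons. Qed.

Lemma bounded_itv_cintegrable I (g : R -> C) : bounded_itv I ->
  (forall a b : R, cintegrable `[a, b] g) -> cintegrable [set` I] g.
Proof.
move=> [M [_ HM]] ig; apply: cintegrableS (ig (- (`|M| + 1)) (`|M| + 1)) => //.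
move=> y yI; rewrite /= in_itv /= -ler_norml.
by apply: (HM (`|M| + 1)) => //; rewrite (le_lt_trans (ler_norm M))// ltrDl.
Qed.

Lemma step_fun_cint (g : R -> C) s : (forall a b : R, cintegrable `[a, b] g) ->
  (forall p, p \in s -> bounded_itv p.2) ->
  cintegrable setT (fun x => g x * step_fun s x) /\
  cint setT (fun x => g x * step_fun s x) = \sum_(p <- s) p.1 * cint [set` p.2] g.
Proof.
move=> ig; elim: s => [|p s IH] bs.
  have E : (fun x => g x * step_fun [::] x) = fun=> 0 * 0.
    by apply/funext => x; rewrite /step_fun big_nil mulr0 mul0r.
  have i0 : cintegrable setT (fun=> 0 : C).
    by split; exact: integrable0.
  rewrite E big_nil; split; first exact: (cintegrableZ 0 measurableT i0).
  by rewrite (cintZ 0 measurableT i0) mul0r.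
have bp : bounded_itv p.2 by apply: bs; exact: mem_head.
have [i1 e1] := IH (fun q qs => bs q (mem_behead (s := p :: s) qs)).
have i2 := cintegrable_setT_restrict (measurable_itv _) (bounded_itv_cintegrable bp ig).
have E : (fun x => g x * step_fun (p :: s) x) =
    fun x => p.1 * (g x * rc (\1_([set` p.2] : set R) x)) + g x * step_fun s x.
  by apply/funext => x; rewrite step_fun_cons rc_indic; ring.
have i3 := cintegrableZ p.1 measurableT i2.
rewrite E big_cons (cint_setT_restrict _ (measurable_itv _)); split.
  exact: (cintegrableD measurableT i3 i1).
by rewrite (cintD measurableT i3 i1) (cintZ _ measurableT i2) e1.
Qed.

(** The partial sums on the left see only the function [h], so they show that the
    value on the right is the same for all representations of [h]. *)
Lemma step_repr_cvg f h s : besov eta f -> step_repr h s ->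
  ccvg (fun n => \sum_(k < n) cint setT (fun x => lp_density eta f k x * h x))
       (\sum_(p <- s) p.1 * lambda eta p.2 f).
Proof.
move=> bf [bs ->]; have [K _ hK] := lambdaP heta.
have -> : (fun n => \sum_(k < n) cint setT (fun x => lp_density eta f k x * step_fun s x)) =
    fun n => \sum_(p <- s) p.1 * \sum_(k < n) lambda_term eta p.2 f k.
  apply/funext => n; under [RHS]eq_bigr do rewrite mulr_sumr.
  rewrite [RHS]exchange_big /=; apply: eq_bigr => k _.
  exact: (step_fun_cint (fun a b => lp_density_locint heta k a b bf) bs).2.
elim: s bs => [|p s IH] bs.
  by under eq_fun do rewrite big_nil; rewrite big_nil; exact: ccvg_cst.
under eq_fun do rewrite big_cons; rewrite big_cons.
have [_ cp _] := hK f p.2 bf (bs p (mem_head _ _)).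
exact: (ccvgD (ccvgZ _ cp) (IH (fun q qs => bs q (mem_behead (s := p :: s) qs)))).
Qed.

Lemma pairing_repr f h s : besov eta f -> step_repr h s ->
  pairing eta f h = \sum_(p <- s) p.1 * lambda eta p.2 f.
Proof.
move=> bf hs; have hx : step_repr h (xget [::] [set s | step_repr h s]).
  by apply: (@xgetPex _ [::] [set s | step_repr h s]); exists s.
exact: ccvg_unique (step_repr_cvg bf hx) (step_repr_cvg bf hs).
Qed.

Lemma pairing_linear h s : step_repr h s ->
  linear_on_besov eta (fun f => pairing eta f h).
Proof.
move=> hs z f g bf bg; rewrite /pairing.
have : step_repr h (xget [::] [set s | step_repr h s]).
  by apply: (@xgetPex _ [::] [set s | step_repr h s]); exists s.
move: (xget _ _) => {hs}s [bs _]; rewrite mulr_sumr -big_split /=.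
apply: eq_big_seq => p ps.
by rewrite (lambda_linear heta (bs p ps) z bf bg) mulrDr mulrCA.
Qed.

Lemma bounded_itv_BSide (b1 b2 : bool) (a b : R) :
  bounded_itv (Interval (BSide b1 a) (BSide b2 b)).
Proof.
exists (`|a| + `|b|); split; first exact: num_real.
move=> M hM x /=; rewrite in_itv => /andP[/lteifW h1 /lteifW h2].
have := ler_norm a; have := ler_norm b; have := ler_norm (- a); have := ler_norm (- b).
rewrite !normrN ler_norml; lra.
Qed.

Lemma itv_length_co (a b : R) : a <= b -> itv_length `[a, b[ = b - a.
Proof.
move=> ab; rewrite /itv_length lebesgue_measure_itv /= lte_fin.
by case: ltP => [//|ba]; rewrite (_ : b = a) ?subrr//; apply/eqP; rewrite eq_le ba ab.
Qed.

Lemma haar_father_repr (m : int) :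
  step_repr (haar_father m) [:: (1 : C, `[m%:~R, (m%:~R : R) + 1[)].
Proof.
split; first by move=> p; rewrite inE => /eqP ->; exact: bounded_itv_BSide.
by apply/funext => x; rewrite step_fun_cons /step_fun big_nil mul1r addr0.
Qed.

Lemma haar_mother_repr (A B : R) : 0 < A ->
  step_repr (fun x => haar_mother (A * x - B))
    [:: (1, `[B / A, (B + 2^-1) / A[); (- 1, `[(B + 2^-1) / A, (B + 1) / A[)].
Proof.
move=> A0; split.
  by move=> p; rewrite !inE => /orP[] /eqP ->; exact: bounded_itv_BSide.
have E (b c x : R) : \1_(`[b, c[%classic : set R) (A * x - B) =
    \1_(`[(B + b) / A, (B + c) / A[%classic : set R) x :> C.
  rewrite !indicE; congr (_%:R); congr nat_of_bool; apply/idP/idP.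
    rewrite !inE /= !in_itv /= ler_pdivrMr// ltr_pdivlMr// => /andP[h1 h2].
    by apply/andP; split; lra.
  rewrite !inE /= !in_itv /= ler_pdivrMr// ltr_pdivlMr// => /andP[h1 h2].
  by apply/andP; split; lra.
apply/funext => x; rewrite !step_fun_cons /step_fun big_nil /haar_mother !E !addr0.
by rewrite mul1r mulN1r.
Qed.

(** The dilation factor [2 ^ j] is at least [1], so it only shortens the intervals. *)
Lemma haar_ext_repr h : haar_ext_system h -> exists s,
  [/\ step_repr h s, (size s <= 2)%N &
      forall p, p \in s -> cabs p.1 <= 1 /\ itv_length p.2 <= 1].
Proof.
move=> [j [nu [j1 ->]]]; rewrite /haar_ext; case: eqVneq => [_|jN].
  exists [:: (1 : C, `[nu%:~R, (nu%:~R : R) + 1[)]; split=> //; first exact: haar_father_repr.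
  move=> p; rewrite inE => /eqP ->; split; first by rewrite [cabs _](cabs1 R).
  by rewrite [itv_length _]itv_length_co ?lerDl// [X in X - _]addrC addrK.
have j0 : 0 <= j by move: j1 jN; rewrite -[X in _ != X]/(-1); case: j => [j|[|j]].
have A1 : 1 <= (2 ^ j : R).
  by case: j j0 {j1 jN} => // n _; rewrite -exprnP exprn_ege1// ler1n.
set A := 2 ^ j : R in A1 *; have A0 : 0 < A by apply: lt_le_trans A1.
clearbody A; set B : R := nu%:~R / 2.
have Ai : A^-1 <= 1 by rewrite invf_le1.
have Ai0 : 0 < A^-1 by rewrite invr_gt0.
eexists; split; [exact: (haar_mother_repr B A0)|by []|].
have l (b c : R) : 0 <= b -> b <= c -> c <= 1 ->
    itv_length `[(B + b) / A, (B + c) / A[ <= 1.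
  move=> b0 bc c1; rewrite itv_length_co; last by apply: ler_wpM2r; lra.
  by rewrite -mulrBl; nra.
move=> p; rewrite !inE => /orP[] /eqP ->; split.
- by rewrite [cabs _](cabs1 R).
- by rewrite -{1}(addr0 B); apply: l; lra.
- by rewrite [cabs _](cabsN 1) cabs1.
- by apply: l; lra.
Qed.

Lemma operator_norm_le (L : distr R -> C) (K : R) : 0 <= K ->
  (forall f, besov eta f -> cabs (L f) <= K * fine (besov_norm eta f)) ->
  (operator_norm eta L <= K%:E)%E.
Proof.
move=> K0 hL; apply: ge_ereal_sup => _ [f [bf f1] <-]; rewrite lee_fin.
apply: le_trans (hL f bf) _.
have h : fine (besov_norm eta f) <= 1 by rewrite -lee_fin fineK ?(besov_norm_fin bf).
by rewrite -[leRHS]mulr1 ler_wpM2l.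
Qed.

Lemma pairing_haar_ext : exists K : R, forall h, haar_ext_system h ->
  linear_on_besov eta (fun f => pairing eta f h) /\
  (operator_norm eta (fun f => pairing eta f h) <= K%:E)%E.
Proof.
have [K K0 hK] := lambdaP heta; exists (4 * K) => h /haar_ext_repr[s [hs s2 ls]].
split; first exact: pairing_linear hs.
apply: operator_norm_le; first exact: mulr_ge0.
move=> f bf; rewrite (pairing_repr bf hs); have [bs _] := hs.
set N := fine _; have N0 : 0 <= N by apply: fine_ge0; exact: besov_norm_ge0.
have le1 p : p \in s -> cabs (p.1 * lambda eta p.2 f) <= 2 * K * N.
  move=> ps; have [c1 l1] := ls p ps; have [_ _ hp] := hK f p.2 bf (bs p ps).
  have KN : 0 <= K * N by exact: mulr_ge0.
  rewrite cabsM -[leRHS]mul1r ler_pM ?cabs_ge0//.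
  apply: (le_trans hp); rewrite -/N; nra.
apply: le_trans (cabs_sum _ _) _.
apply: (@le_trans _ _ (\sum_(p <- s) 2 * K * N)).
  by rewrite big_seq [leRHS]big_seq; apply: ler_sum => p ps; exact: le1.
rewrite big_const_seq count_predT iter_addr addr0.
have KN : 0 <= 2 * K * N by rewrite !mulr_ge0.
apply: (@le_trans _ _ (2 * K * N *+ 2)); first by rewrite ler_wpMn2l.
by rewrite -mulr_natr le_eqVlt; apply/orP; left; apply/eqP; ring.
Qed.

End Pairing.

(** * Vanishing Haar coefficients force vanishing integrals *)

Section HaarVanish.
Variable R : realType.
Local Notation C := R[i].
Local Notation mu := (@lebesgue_measure R).
Variables (eta : R -> C) (heta : cutoff eta).
Variables (f : distr R) (bf : besov eta f).

Local Notation Lam := (itv_functional eta f).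

Lemma itv_functional_cat (a b c : R) : a <= b -> b <= c -> Lam a c = Lam a b + Lam b c.
Proof.
move=> ab bc; have ac := le_trans ab bc; have [K _ hK] := itv_functionalP heta.
have [_ h1 _] := hK f a b bf ab; have [_ h2 _] := hK f b c bf bc.
have [_ h3 _] := hK f a c bf ac.
apply: (ccvg_unique h3).
have E k : cint `]a, c] (lp_density eta f k) =
    cint `]a, b] (lp_density eta f k) + cint `]b, c] (lp_density eta f k).
  have [i1 i2] := lp_density_locint heta k a c bf.
  have H (u : R -> R) : mu.-integrable `[a, c] (EFin \o u) ->
      Rintegral mu `]a, c] u = Rintegral mu `]a, b] u + Rintegral mu `]b, c] u.
    move=> iu; rewrite -(@Rintegral_itvB R u (BRight a) (BRight c) b).
    - by rewrite addrC subrK.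
    - by apply: (integrableS (mu := mu) _ _ _ iu) => //; exact: subset_itv_oc_cc.
    - by rewrite bnd_simp.
    - by rewrite bnd_simp.
  by apply: complex_ext; rewrite ?ReD ?ImD /cint /= H.
under eq_fun do under eq_bigr do rewrite E.
under eq_fun do rewrite big_split /=.
exact: ccvgD h1 h2.
Qed.

Lemma itv_functional_nil (a : R) : Lam a a = 0.
Proof.
have := itv_functional_cat (lexx a) (lexx a).
by move=> /esym/eqP; rewrite -[X in _ == X]addr0 => /eqP/addrI.
Qed.

(** Short intervals: the tail of the series is small uniformly in the interval, and
    each of the finitely many remaining terms has a bounded density. *)
Lemma itv_functional_small (e : R) : 0 < e -> exists2 d : R, 0 < d &
  forall a b : R, a <= b -> b - a <= d -> cabs (Lam a b) <= e.
Proof.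
move=> e0; have [K K0 hK] := cint_lp_density heta.
pose t n := \sum_(k < n) 2 ^- k * lp_norm eta f k.
have t1 n : t n.+1 = t n + 2 ^- n * lp_norm eta f n by rewrite /t big_ord_recr.
have hs : has_sup (range t).
  split; first by exists (t 0%N), 0%N.
  by exists (fine (besov_norm eta f)) => _ [n _ <-]; exact: besov_sum.
pose e' := e / (4 * K + 2).
have e'0 : 0 < e' by rewrite divr_gt0//; lra.
have Ke' : 4 * K * e' + 2 * e' = e.
  by rewrite -mulrDl mulrC divfK// gt_eqF//; lra.
have [_ [N _ <-] hN] := sup_adherent e'0 hs.
pose M := \sum_(k < N) 2 * lp_norm eta f k.
have M0 : 0 <= M by apply: sumr_ge0 => k _; rewrite mulr_ge0// lp_norm_ge0.
exists (Num.min 1 (e' / (M + 1))); first by rewrite lt_min ltr01 divr_gt0//; lra.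
move=> a b ab; rewrite le_min => /andP[d1]; rewrite ler_pdivlMr; last by lra.
move=> d2; have ba : 0 <= b - a by lra.
have [K' _ hP] := itv_functionalP heta; have [_ cL _] := hP f a b bf ab.
pose S n := \sum_(k < n) cint `]a, b] (lp_density eta f k).
have S1 n : S n.+1 = S n + cint `]a, b] (lp_density eta f n) by rewrite /S big_ord_recr.
have head : cabs (S N) <= M * (b - a).
  apply: le_trans (cabs_sum _ _) _; rewrite mulr_suml; apply: ler_sum => k _.
  by rewrite -mulrA; exact: lp_density_cint0.
have tail n : cabs (S (n + N)%N - S N) <= 2 * K * (t (n + N)%N - t N).
  elim: n => [|n IH]; first by rewrite add0n !subrr cabs0 mulr0.
  rewrite addSn S1 t1 -addrA [X in S (n + N)%N + X]addrC addrA.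
  apply: le_trans (cabsD _ _) _; have := hK f (n + N)%N a b bf ab.
  set u := 2 ^- (n + N) * _.
  have u0 : 0 <= u by rewrite mulr_ge0 ?lp_norm_ge0// invr_ge0 exprn_ge0.
  have : K * (1 + (b - a)) * u <= 2 * K * u by rewrite ler_wpM2r//; nra.
  by move: IH; clearbody u; lra.
have tN n : t (n + N)%N - t N <= e'.
  have : t (n + N)%N <= sup (range t) by apply: (sup_upper_bound hs); exists (n + N)%N.
  by move: hN; lra.
have cL' : ccvg (fun n => S (n + N)%N - S N) (Lam a b - S N).
  apply: ccvgD; last exact: ccvg_cst.
  exact: (cvg_comp _ _ (@cvg_addnr N) cL).
have T : cabs (Lam a b - S N) <= 2 * K * e'.
  apply: (ccvg_le cL') => n; apply: le_trans (tail n) _.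
  by rewrite ler_wpM2l// mulr_ge0.
rewrite -[Lam a b](subrK (S N)); apply: le_trans (cabsD _ _) _.
have : M * (b - a) <= e' by nra.
have : 0 <= K * e' by rewrite mulr_ge0// ltW.
by move: T head Ke'; lra.
Qed.

Hypothesis f_haar : forall h, haar_system h -> pairing eta f h = 0.

Lemma lambda_co (a b : R) : a <= b -> lambda eta `[a, b[ f = Lam a b.
Proof. by move=> ab; apply: (lambda_itv heta bf) => g ig; exact: cint_itv_sides. Qed.

Definition dyadic (j : nat) (m : int) : R := m%:~R / 2 ^+ j.

Lemma dyadic_double j (m : int) : dyadic j.+1 (2 * m) = dyadic j m.
Proof.
have j0 : (2 ^+ j : R) != 0 by rewrite expf_neq0.
by rewrite /dyadic exprS intrM; field.
Qed.

Lemma dyadic_S j (m : int) : dyadic j (m + 1) = dyadic j m + 2 ^- j.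
Proof. by rewrite /dyadic intrD mulrDl mul1r. Qed.

Lemma int_parity (m : int) : exists q : int, m = 2 * q \/ m = 2 * q + 1.
Proof.
exists (m %/ 2)%Z; have := divz_eq m 2; have := modz_ge0 m (isT : (2 : int) != 0).
have := ltz_pmod m (isT : 0 < (2 : int)); rewrite mulrC.
case: (m %% 2)%Z => [[|[|r]]|r] // _ _ mE; [left|right] => //.
by rewrite [LHS]mE addr0.
Qed.

(** On a dyadic interval the Haar coefficient is the difference of the values on the
    two halves, and their sum is the value on the interval. *)
Lemma dyadic_vanish j (m : int) : Lam (dyadic j m) (dyadic j (m + 1)) = 0.
Proof.
have le j' (m' : int) : dyadic j' m' <= dyadic j' (m' + 1).
  by rewrite dyadic_S lerDl invr_ge0 exprn_ge0.
elim: j m => [|j IH] m.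
  have : pairing eta f (haar_father m) = 0.
    by apply: f_haar; exists (-1), m; rewrite lexx /haar eqxx.
  rewrite (pairing_repr heta bf (haar_father_repr _ m)) big_seq1 mul1r.
  rewrite lambda_co; last by rewrite lerDl.
  by rewrite /dyadic expr0 !divr1 intrD.
have halves (q : int) : Lam (dyadic j.+1 (2 * q)) (dyadic j.+1 (2 * q + 1)) = 0 /\
    Lam (dyadic j.+1 (2 * q + 1)) (dyadic j.+1 (2 * q + 1 + 1)) = 0.
  set x := Lam _ _; set y := Lam _ _.
  have xy : x + y = 0.
    rewrite -itv_functional_cat//.
    have -> : 2 * q + 1 + 1 = 2 * (q + 1) by ring.
    by rewrite !dyadic_double; exact: IH.
  have xy' : x - y = 0.
    have A0 : 0 < (2 ^ (j : int) : R) by rewrite -exprnP exprn_gt0.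
    have : pairing eta f (fun x => haar_mother (2 ^ (j : int) * x - q%:~R)) = 0.
      by apply: f_haar; exists (j : int), q; split.
    rewrite (pairing_repr heta bf (haar_mother_repr q%:~R A0)) big_cons big_seq1.
    rewrite mul1r mulN1r.
    have E1 : q%:~R / 2 ^ (j : int) = dyadic j.+1 (2 * q) by rewrite dyadic_double.
    have E2 : (q%:~R + 2^-1) / 2 ^ (j : int) = dyadic j.+1 (2 * q + 1).
      rewrite dyadic_S dyadic_double /dyadic -exprnP exprS invfM.
      by rewrite mulrDl.
    have E3 : (q%:~R + 1) / 2 ^ (j : int) = dyadic j.+1 (2 * q + 1 + 1).
      have -> : 2 * q + 1 + 1 = 2 * (q + 1) by ring.
      by rewrite dyadic_double /dyadic intrD.
    by rewrite E1 E2 E3 !lambda_co.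
  have xE : x = y by apply/eqP; rewrite -subr_eq0 xy'.
  move: xy; rewrite xE => /eqP; rewrite -mulr2n mulrn_eq0 /= => /eqP ->.
  by split.
have [q mE] := int_parity m; have [h0 h1] := halves q.
by case: mE => ->; [exact: h0|exact: h1].
Qed.

Lemma dyadic_itv_vanish j (m : int) (k : nat) :
  Lam (dyadic j m) (dyadic j (m + k%:Z)) = 0.
Proof.
elim: k => [|k IH]; first by rewrite addr0 itv_functional_nil.
have le (n : int) : dyadic j n <= dyadic j (n + 1).
  by rewrite dyadic_S lerDl invr_ge0 exprn_ge0.
rewrite -addn1 PoszD addrA (@itv_functional_cat _ (dyadic j (m + k%:Z)))//.
  by rewrite IH dyadic_vanish addr0.
by rewrite /dyadic ler_pM2r ?invr_gt0 ?exprn_gt0// ler_int lerDl.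
Qed.

Lemma itv_functional_vanish (a b : R) : a <= b -> Lam a b = 0.
Proof.
move=> ab; apply: cabs_eq0; apply/eqP; rewrite eq_le cabs_ge0 andbT.
apply/ler_addgt0Pr => e e0; rewrite add0r.
have e20 : 0 < e / 2 by rewrite divr_gt0.
have [d d0 hd] := itv_functional_small e20.
have [j hj] : exists j : nat, (2 ^- j : R) <= d.
  pose n := (Num.truncn d^-1).+1.
  exists n; rewrite -[d]invrK lef_pV2 ?posrE ?invr_gt0 ?exprn_gt0//.
  apply: (@le_trans _ _ n%:R); first by apply: ltW; exact: truncnS_gt.
  by rewrite -natrX ler_nat ltnW// ltn_expl.
pose D (x : R) : R := dyadic j (Num.floor (2 ^+ j * x)).
have p0 : 0 < (2 ^+ j : R) by rewrite exprn_gt0.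
have D1 x : D x <= x /\ x - D x <= d.
  have /andP[h1 h2] := floor_itv (2 ^+ j * x).
  have e1 : D x * 2 ^+ j = (Num.floor (2 ^+ j * x))%:~R by rewrite /D /dyadic divfK// gt_eqF.
  have e2 : 2 ^- j * 2 ^+ j = 1 :> R by rewrite mulVf// gt_eqF.
  clearbody D; split; first by rewrite -(ler_pM2r p0) e1 [x * _]mulrC.
  apply: le_trans hj; rewrite -(ler_pM2r p0) mulrBl e1 e2.
  by move: h2; rewrite intrD mulrC; lra.
have fl : Num.floor (2 ^+ j * a) <= Num.floor (2 ^+ j * b).
  by apply: le_floor; rewrite ler_pM2l.
have Dab : D a <= D b by rewrite /D /dyadic ler_pM2r ?invr_gt0// ler_int.
have LD : Lam (D a) (D b) = 0.
  rewrite /D; have -> : Num.floor (2 ^+ j * b) = Num.floor (2 ^+ j * a) +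
     `|Num.floor (2 ^+ j * b) - Num.floor (2 ^+ j * a)|%N%:Z.
    by rewrite gez0_abs ?subr_ge0// addrCA subrr addr0.
  exact: dyadic_itv_vanish.
have [a1 a2] := D1 a; have [b1 b2] := D1 b.
have E : Lam a b = Lam (D b) b - Lam (D a) a.
  rewrite -[Lam (D b) b]add0r -LD -(itv_functional_cat Dab b1) (itv_functional_cat a1 ab).
  by rewrite addrC addrA addNr add0r.
rewrite E (splitr e); apply: le_trans (cabsB _ _) _.
by apply: lerD; exact: hd.
Qed.

End HaarVanish.

(** * Recovering a tempered distribution from its Littlewood-Paley pieces *)

Section Recovery.
Variable R : realType.
Local Notation C := R[i].
Local Notation mu := (@lebesgue_measure R).
Variables (eta : R -> C) (heta : cutoff eta).
Implicit Types (f : distr R) (phi psi g : R -> C).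

Lemma seminorm_ge0 m n phi : (0 <= seminorm m n phi)%E.
Proof.
apply: (@le_trans _ _ (`|0 : R| ^+ m * cabs (cderiv n phi 0))%:E).
  by rewrite lee_fin mulr_ge0 ?exprn_ge0 ?cabs_ge0.
by apply: ereal_sup_ubound; exists 0.
Qed.

(** The finitely many seminorms that control [f] are bounded over the family. *)
Lemma tempered_usch T f (Phi : T -> R -> C) : tempered f -> usch Phi ->
  exists2 K : R, 0 <= K & forall t, cabs (f (Phi t)) <= K.
Proof.
move=> [_ [N [M fM]]] /usch_schwartz[sPhi bPhi].
have [K hK] : exists K : nat -> nat -> R, forall m n, 0 <= K m n /\
    forall t, (seminorm m n (Phi t) <= (K m n)%:E)%E.
  have h m n : {K : R | 0 <= K /\ forall t, (seminorm m n (Phi t) <= K%:E)%E}.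
    by apply: cid; have [K K0 kK] := bPhi m n; exists K.
  by exists (fun m n => sval (h m n)) => m n; exact: svalP (h m n).
exists (`|M| * \sum_(m < N) \sum_(n < N) K m n).
  by rewrite mulr_ge0// sumr_ge0// => m _; rewrite sumr_ge0// => n _; case: (hK m n).
move=> t; rewrite -lee_fin; apply: le_trans (fM _ (sPhi t)) _.
have S0 : (0 <= \sum_(m < N) \sum_(n < N) seminorm m n (Phi t))%E.
  by apply: sume_ge0 => m _; apply: sume_ge0 => n _; exact: seminorm_ge0.
apply: (@le_trans _ _ (`|M|%:E * \sum_(m < N) \sum_(n < N) seminorm m n (Phi t))%E).
  by apply: lee_wpmul2r => //; rewrite lee_fin ler_norm.
rewrite EFinM; apply: lee_wpmul2l; first by rewrite lee_fin.
rewrite -sumEFin; apply: lee_sum => m _; rewrite -sumEFin; apply: lee_sum => n _.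
by case: (hK m n).
Qed.

(** By Hadamard's lemma [eta (xi / 2 ^+ n) - 1] is [2 ^- n] times the product of [xi]
    with symbols bounded uniformly in [n], together with their derivatives.  Hence the
    difference of the two test functions is [2 ^- n] times a family on which [f] is
    bounded. *)
Lemma tempered_multiplier_cvg f phi : tempered f -> sch phi ->
  ccvg (fun n => f (multiplier (fun xi => eta (xi / 2 ^+ n)) phi)) (f phi).
Proof.
move=> tf sp; have [be _ e1] := heta.
have [ka bka ekaE] := hadamard be.
have p0 n : 0 <= (2 ^- n : R) by rewrite invr_ge0 exprn_ge0.
have p1 n : `|2 ^- n : R| <= 1.
  by rewrite ger0_norm// invf_le1 ?exprn_gt0// exprn_ege1// ler1n.
pose Psi (n : nat) (xi : R) := ka (2 ^- n * xi + 0) * (rc xi * ifourier phi xi).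
have sPsi : usch Psi.
  apply: usch_mul.
    apply: (uchain_sub (P := @ubdd R nat)); first exact: ubdd_umod.
    exact: (ubdd_affine (fun=> 0) bka p1).
  apply: usch_mulrc; exact: (usch_at (fun=> tt) (sch_ifourier sp)).
have sPhi : usch (fun n => FT (- c2pi R) (Psi n)).
  by apply: usch_FT => //; rewrite oppr_eq0; exact: c2pi_neq0.
have [K K0 hK] := tempered_usch tf sPhi.
have E n : multiplier (fun xi => eta (xi / 2 ^+ n)) phi =
    fun x => rc (2 ^- n) * FT (- c2pi R) (Psi n) x + phi x.
  have L1 : L1dom (Psi n) by apply: sch_L1dom; exact: (usch_sch n sPsi).
  have L2 : L1dom (fun x => rc (2 ^- n) * Psi n x).
    by apply: sch_L1dom; apply: usch_mulz; exact: (usch_sch n sPsi).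
  have L3 : L1dom (ifourier phi) by apply: sch_L1dom; exact: sch_ifourier.
  rewrite /multiplier fourierE.
  have -> : (fun xi => eta (xi / 2 ^+ n) * ifourier phi xi) =
      fun xi => rc (2 ^- n) * Psi n xi + ifourier phi xi.
    apply/funext => xi; have := ekaE (2 ^- n * xi).
    rewrite (e1 0) ?normr0 ?divr_ge0// => /eqP; rewrite subr_eq => /eqP.
    by rewrite [xi / _]mulrC /Psi addr0 => ->; rewrite rcM; ring.
  rewrite (FT_D _ L2 L3) (FT_Z _ _ L1) -[FT _ (ifourier phi)]fourierE.
  by rewrite (ifourierK sp).
apply: (@ccvg_bound _ _ _ (fun n => geometric K 2^-1 n)); last first.
  by apply: cvg_geometric; rewrite ger0_norm ?invr_ge0// invf_lt1// ltr1n.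
move=> n; rewrite E (proj1 tf); [|exact/schP/(usch_sch n sPhi)|exact/schP].
rewrite addrK cabsM cabs_rc ger0_norm// mulrC /= exprVn.
by rewrite ler_wpM2r.
Qed.

Lemma lp_piece_cvg f phi : tempered f -> sch phi ->
  ccvg (fun n => \sum_(k < n.+1) lp_piece eta k f phi) (f phi).
Proof.
move=> tf sp; have [be _ _] := heta.
have E n : \sum_(k < n.+1) lp_piece eta k f phi =
    f (multiplier (fun xi => eta (xi / 2 ^+ n)) phi).
  elim: n => [|n IH].
    rewrite big_ord1 -[LHS]/(f (multiplier (lp_symbol eta 0) phi)).
    by congr (f (multiplier _ phi)); apply/funext => xi; rewrite expr0 divr1.
  rewrite big_ord_recr /= IH.
  rewrite -[X in _ + X]/(f (multiplier (lp_symbol eta n.+1) phi)).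
  have bn : bddC (fun xi => eta (xi / 2 ^+ n)).
    by under eq_fun do rewrite mulrC; exact: bddC_scale.
  have bl := lp_symbol_bddC heta n.+1.
  have -> : (fun xi => eta (xi / 2 ^+ n.+1)) =
      fun xi => eta (xi / 2 ^+ n) + lp_symbol eta n.+1 xi.
    by apply/funext => xi /=; rewrite addrC subrK.
  rewrite (multiplierD bn bl sp).
  have s1 : schwartz (multiplier (fun xi => eta (xi / 2 ^+ n)) phi).
    by apply/schP/sch_multiplier.
  have s2 : schwartz (multiplier (lp_symbol eta n.+1) phi).
    by apply/schP/sch_multiplier.
  have := (proj1 tf) 1 _ _ s1 s2; rewrite mul1r => <-.
  by congr f; apply/funext => x; rewrite mul1r.
by under eq_fun do rewrite E; exact: tempered_multiplier_cvg.
Qed.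

(** The oriented integral from [0] to [t]. *)
Definition primitive g (t : R) : C :=
  if 0 <= t then cint `]0, t] g else - cint `]t, 0] g.

(** The oriented indicator function of the interval between [0] and [t], see [osignE].
    In this form it is clear that it is jointly measurable and that its integral
    against a derivative in [t] is elementary. *)
Definition osign (x t : R) : C :=
  rc (\1_([set z : R * R | z.1 <= z.2]) (x, t)) - rc (\1_(`]-oo, 0]%classic : set R) x).

Lemma osignE x t : osign x t = if 0 <= t then rc (\1_(`]0, t]%classic : set R) x)
  else - rc (\1_(`]t, 0]%classic : set R) x).
Proof.
have E (A : set R) (b : bool) : (A x <-> b) -> \1_A x = b%:R :> R.
  move=> h; rewrite indicE; congr (nat_of_bool _)%:R.
  by apply/idP/idP; rewrite inE => /h.
rewrite /osign.
have -> : \1_([set z : R * R | z.1 <= z.2]) (x, t) = ((x <= t)%R : nat)%:R :> R.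
  by rewrite indicE; congr (nat_of_bool _)%:R; apply/idP/idP; rewrite inE.
rewrite (E `]-oo, 0]%classic (x <= 0)); last by rewrite /= in_itv.
rewrite (E `]0, t]%classic ((0 < x) && (x <= t))); last by rewrite /= in_itv.
rewrite (E `]t, 0]%classic ((t < x) && (x <= 0))); last by rewrite /= in_itv.
rewrite !rc_nat.
by case: (leP 0 t) => t0; case: (leP x t) => xt; case: (leP x 0) => x0 /=;
  rewrite ?subr0 ?sub0r ?subrr ?oppr0//; exfalso; lra.
Qed.

Lemma osign_cabs x t : cabs (osign x t) <= 1 /\ (`|t| < `|x| -> osign x t = 0).
Proof.
have b01 (A : set R) : cabs (rc (\1_A x : R)) <= 1.
  by rewrite cabs_rc ger0_norm ?indicE; case: (_ \in _); rewrite ?ler01 ?lexx.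
rewrite osignE; split; first by case: ifP => _; rewrite ?cabsN.
have h (A : set R) : ~ A x -> rc (\1_A x : R) = 0.
  by move=> Ax; rewrite indicE memNset ?rc0.
move=> tx; case: ifPn => [t0|]; last rewrite -ltNge => t0.
  apply: h => /=; rewrite in_itv /= => /andP[x0 xt].
  by move: tx; rewrite !ger0_norm ?ltNge ?xt// ltW.
rewrite h ?oppr0//= in_itv /= => /andP[x0 xt].
by move: tx; rewrite (ltr0_norm t0) ler0_norm// ltrN2 ltNge ltW.
Qed.

Lemma osign_cint g t : (forall a b : R, cintegrable `[a, b] g) ->
  cintegrable setT (fun x => g x * osign x t) /\
  cint setT (fun x => g x * osign x t) = primitive g t.
Proof.
move=> ig; rewrite /primitive.
have i (a b : R) : cintegrable setT (fun x => g x * rc (\1_(`]a, b]%classic : set R) x)).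
  apply: cintegrable_setT_restrict => //; apply: cintegrableS (ig a b) => //.
  exact: subset_itv_oc_cc.
have -> : (fun x => g x * osign x t) = if 0 <= t
    then fun x => g x * rc (\1_(`]0, t]%classic : set R) x)
    else fun x => - 1 * (g x * rc (\1_(`]t, 0]%classic : set R) x)).
  by apply/funext => x; rewrite osignE; case: ifP => _ //; rewrite mulrN mulN1r.
case: ifP => _; first by split; [exact: i|rewrite [RHS]cint_setT_restrict].
split; first exact: (cintegrableZ (- 1) measurableT (i t 0)).
by rewrite (cintZ _ measurableT (i t 0)) mulN1r [cint `]t, 0] g]cint_setT_restrict.
Qed.

Lemma osign_cint_deriv phi phi' x : sch phi -> cD phi phi' -> sch phi' ->
  cint setT (fun t => phi' t * osign x t) = - phi x.
Proof.
move=> sp dp sp'; have ip := sch_integrable sp'.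
have E : (fun t => phi' t * osign x t) = fun t =>
    phi' t * rc (\1_(`[x, +oo[%classic : set R) t) -
    rc (\1_(`]-oo, 0]%classic : set R) x) * phi' t.
  apply/funext => t; rewrite /osign mulrBr; congr (_ - _); last exact: mulrC.
  congr (_ * rc _).
  rewrite !indicE; congr (nat_of_bool _)%:R.
  by apply/idP/idP; rewrite !inE /= in_itv /= andbT.
have i1 : cintegrable setT (fun t => phi' t * rc (\1_(`[x, +oo[%classic : set R) t)).
  by apply: cintegrable_setT_restrict => //; exact: cintegrableS ip.
rewrite E cintB//; last exact: cintegrableZ.
rewrite -cint_setT_restrict// (cintZ _ measurableT ip).
by rewrite (sch_int_right x sp dp sp') (sch_int_deriv sp dp sp') mulr0 subr0.
Qed.

Lemma osign_cmeas : cmeas setT (fun z : R * R => osign z.1 z.2).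
Proof.
have m1 : measurable [set z : R * R | z.1 <= z.2].
  have : measurable_fun setT (fun z : R * R => z.1 <= z.2).
    by apply: measurable_fun_ler; [exact: measurable_fst|exact: measurable_snd].
  move=> /(_ measurableT [set true]); rewrite setTI; apply=> //.
have -> : (fun z : R * R => osign z.1 z.2) = fun z =>
    rc (\1_([set z : R * R | z.1 <= z.2]) z) + - 1 * rc (\1_(`]-oo, 0]%classic : set R) z.1).
  by apply/funext => -[x t]; rewrite /osign mulN1r.
apply: cmeasD; first by apply: cmeas_rc; exact: measurable_indic.
apply: cmeasM; first exact: cmeas_cst.
apply: (measurable_pair_fst (f := fun x => rc (\1_(`]-oo, 0]%classic : set R) x))).
by apply: cmeas_rc; exact: measurable_indic.
Qed.

(** Integration by parts for a merely bounded function [g], by Fubini's theorem: the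
    kernel [osign x t] vanishes for [`|t| < `|x|], so the decay of the derivative
    in [t] is also decay in [x]. *)
Lemma cint_primitive g phi phi' (M : R) : cmeas setT g -> (forall x, cabs (g x) <= M) ->
  (forall a b : R, cintegrable `[a, b] g) -> sch phi -> cD phi phi' -> sch phi' ->
  cmeas setT (fun t => phi' t * primitive g t) /\
  cint setT (fun x => g x * phi x) = - cint setT (fun t => phi' t * primitive g t).
Proof.
move=> mg gM ig sp dp sp'; have M0 : 0 <= M by apply: le_trans (gM 0); exact: cabs_ge0.
have [K K0 hK] := sch_bound 4 sp'.
pose H (z : R * R) := g z.1 * (phi' z.2 * osign z.1 z.2).
have mH : cmeas setT H.
  apply: cmeasM; first exact: measurable_pair_fst.
  apply: cmeasM; last exact: osign_cmeas.
  by apply: measurable_pair_snd; exact: sch_cmeas.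
have bH x t : cabs (H (x, t)) <= M * maj x * (K * maj t).
  rewrite /H /= !cabsM; have [s1 s0] := osign_cabs x t.
  have [xt|tx] := leP `|x| `|t|; last first.
    rewrite (s0 tx) cabs0 !mulr0.
    by rewrite !mulr_ge0 ?maj_ge0.
  rewrite -mulrA ler_pM ?cabs_ge0 ?mulr_ge0 ?cabs_ge0//.
  apply: (@le_trans _ _ (cabs (phi' t))); first by rewrite ler_piMr ?cabs_ge0.
  apply: (@le_trans _ _ (K * ((wt t ^+ 2)^-1 * (wt t ^+ 2)^-1))).
    rewrite -invfM -exprD ler_pdivlMr ?wtX_gt0// mulrC; exact: hK.
  have -> : maj x * (K * maj t) = K * (maj x * maj t) by ring.
  rewrite ler_wpM2l// ler_pM ?invr_ge0 ?wtX_ge0 ?wt2_maj//.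
  apply: le_trans (wt2_maj x); rewrite lef_pV2 ?posrE ?wtX_gt0//.
  by rewrite ler_pXn2r ?nnegrE ?wt_ge0// lerD2l.
have [mF eF] := cint_fubini mH (majZ_integrable M) (majZ_integrable K) bH.
have E : (fun t => cint setT (fun x => H (x, t))) = fun t => phi' t * primitive g t.
  apply/funext => t; have [i <-] := osign_cint t ig.
  rewrite -(cintZ _ measurableT i); apply: eq_cint => x _.
  by rewrite /H /=; ring.
rewrite -E; split; first exact: mF.
rewrite -eF.
have iL x : cintegrable setT (fun t => phi' t * osign x t).
  apply: L1dom_integrable; apply: (L1domM (K := 1)).
  - have [m1 m2] := osign_cmeas.
    by split; [exact: (measurableT_comp m1 (pair1_measurable x))
              |exact: (measurableT_comp m2 (pair1_measurable x))].
  - by move=> t; case: (osign_cabs x t).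
  - exact: sch_L1dom.
have iphi : cintegrable setT (fun x => g x * phi x).
  have := L1dom_integrable (L1domM mg gM (sch_L1dom sp)).
  move=> h; rewrite (_ : (fun x => g x * phi x) = fun x => phi x * g x); first exact: h.
  by apply/funext => x; exact: mulrC.
apply: oppr_inj; rewrite opprK -[LHS]mulN1r -(cintZ _ measurableT iphi).
apply: eq_cint => x _; rewrite /H /= (cintZ _ measurableT (iL x)).
by rewrite (osign_cint_deriv x sp dp sp') mulrN mulN1r.
Qed.

(** Test the partial sums of the Littlewood-Paley decomposition against [phi] and
    integrate by parts: their primitives tend to [itv_functional] of the interval
    between [0] and [t], that is to [0], and grow at most linearly in [t] uniformly in
    [n], so dominated convergence applies against the derivative of [phi]. *)
Lemma besov_vanish f phi : besov eta f ->
  (forall a b : R, a <= b -> itv_functional eta f a b = 0) -> sch phi -> f phi = 0.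
Proof.
move=> bf f0 sp; have [tf _] := bf; have cf := lp_piece_cvg tf sp.
have [phi' dp sp'] := sch_deriv sp; have ssp : schwartz phi by apply/schP.
have [g hg] : exists g : nat -> R -> C, forall k,
    has_density (lp_piece eta k f) (g k) /\ forall x, cabs (g k x) <= lp_norm eta f k + 1.
  have h k : {g | has_density (lp_piece eta k f) g /\
      forall x, cabs (g x) <= lp_norm eta f k + 1}.
    by apply: cid; have [g dg gM] := besov_density k ltr01 bf; exists g.
  by exists (fun k => sval (h k)) => k; exact: svalP (h k).
pose S n x := \sum_(k < n.+1) g k x.
have lg k (a b : R) : cintegrable `[a, b] (g k).
  by apply: (has_density_locint heta); exact: (hg k).1.
have mS n : cmeas setT (S n).
  have m k : cmeas setT (g k) by exact: has_density_cmeas (hg k).1.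
  rewrite /S; elim: n => [|n IH]; first by under eq_fun do rewrite big_ord1; exact: m.
  by under eq_fun do rewrite big_ord_recr /=; exact: cmeasD IH (m _).
have bS n x : cabs (S n x) <= \sum_(k < n.+1) (lp_norm eta f k + 1).
  by apply: le_trans (cabs_sum _ _) _; apply: ler_sum => k _; exact: (hg k).2.
have lS n (a b : R) : cintegrable `[a, b] (S n) by exact: cintegrable_sum.
have E1 n : \sum_(k < n.+1) lp_piece eta k f phi = cint setT (fun x => S n x * phi x).
  have -> : (fun x => S n x * phi x) = fun x => \sum_(k < n.+1) g k x * phi x.
    by apply/funext => x; rewrite mulr_suml.
  rewrite (@cint_sum _ _ _ _ (fun (k : 'I_n.+1) x => g k x * phi x) measurableT); last first.
    by move=> k; have [_ _ ig _] := (hg k).1; exact: ig.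
  by apply: eq_bigr => k _; have [_ _ _ eg] := (hg k).1; rewrite (eg _ ssp).
have ibp n := cint_primitive (mS n) (bS n) (lS n) sp dp sp'.
have ES n (a b : R) : a <= b -> cint `]a, b] (S n) =
    \sum_(k < n.+1) cint `]a, b] (lp_density eta f k).
  move=> ab; have i k : cintegrable `]a, b] (g k).
    by apply: cintegrableS (lg k a b) => //; exact: subset_itv_oc_cc.
  rewrite (@cint_sum _ _ _ _ (fun (k : 'I_n.+1) => g k) (measurable_itv _))//.
  by apply: eq_bigr => k _; rewrite (cint_density heta ab (hg k).1).
have [K K0 hK] := cint_lp_density heta; have [K' _ hL] := itv_functionalP heta.
set B := fine (besov_norm eta f) in hL *.
have B0 : 0 <= B by apply: fine_ge0; exact: besov_norm_ge0.
have cS (a b : R) : a <= b -> ccvg (fun n => cint `]a, b] (S n)) 0 /\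
    forall n, cabs (cint `]a, b] (S n)) <= K * (1 + (b - a)) * B.
  move=> ab; have [_ cL _] := hL f a b bf ab; rewrite (f0 a b ab) in cL; split.
    under eq_fun do rewrite (ES _ _ _ ab) -addn1.
    exact: cvg_comp _ _ (@cvg_addnr 1) cL.
  move=> n; rewrite (ES _ _ _ ab); apply: le_trans (cabs_sum _ _) _.
  apply: (@le_trans _ _ (\sum_(k < n.+1) K * (1 + (b - a)) * (2 ^- k * lp_norm eta f k))).
    by apply: ler_sum => k _; exact: hK.
  rewrite -mulr_sumr ler_wpM2l ?besov_sum// mulr_ge0//; lra.
have cP t : ccvg (fun n => primitive (S n) t) 0 /\
    forall n, cabs (primitive (S n) t) <= K * wt t * B.
  rewrite /primitive /wt; case: leP => t0.
    have [c b] := cS 0 t t0; split=> // n.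
    by have := b n; rewrite subr0 (ger0_norm t0).
  have [c b] := cS t 0 (ltW t0); split.
    have := ccvgZ (- 1) c; rewrite mulr0.
    by under eq_fun do rewrite mulN1r.
  by move=> n; rewrite cabsN; have := b n; rewrite sub0r (ltr0_norm t0).
have [L L0 hLphi] := sch_bound 3 sp'.
have dct := @cint_dct _ setT (fun n t => phi' t * primitive (S n) t) (fun=> 0)
  (fun t => K * B * L * maj t) measurableT (fun n => (ibp n).1) _ (majZ_integrable _) _.
have [_ c0] : cintegrable setT (fun=> 0 : C) /\
    ccvg (fun n => cint setT (fun t => phi' t * primitive (S n) t)) (cint setT (fun=> 0)).
  apply: dct.
  - by move=> t _; have := ccvgZ (phi' t) (cP t).1; rewrite mulr0.
  - move=> n t _; rewrite cabsM.
    apply: (@le_trans _ _ (cabs (phi' t) * (K * wt t * B))).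
      by rewrite ler_wpM2l ?cabs_ge0//; exact: (cP t).2.
    have -> : cabs (phi' t) * (K * wt t * B) = K * B * (wt t * cabs (phi' t)) by ring.
    rewrite -(mulrA (K * B)) ler_wpM2l ?mulr_ge0//.
    rewrite -(ger0_norm (wt_ge0 t)) -cabs_rc -cabsM.
    apply: wt_le_maj; rewrite cabsM cabs_rc ger0_norm ?wt_ge0// mulrA -exprSr.
    exact: hLphi.
have z0 : cint setT (fun=> 0 : C) = 0 by rewrite /cint /re /im /= !Rintegral_cst// !mul0r.
apply: (ccvg_unique cf).
under eq_fun do rewrite E1 (ibp _).2.
have := ccvgZ (- 1) c0; rewrite z0 mulr0.
by under eq_fun do rewrite mulN1r.
Qed.

End Recovery.

(** * Boundedness of the functionals and injectivity of the Haar coefficients *)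

Theorem proposition1p1 (R : realType) (eta0 : R -> R[i])
    (eta0_smooth : Ccinfty eta0)
    (eta0_supp : supp eta0 `<=` [set xi | `|xi| < 3 / 4])
    (eta0_one : forall xi : R, `|xi| <= 1 / 2 -> eta0 xi = 1) :
  [/\ (* (i) *)
      exists C : R, forall I : interval R, bounded_itv I ->
        [/\ forall f, besov eta0 f -> cis_cvg_series (lambda_term eta0 I f),
            forall phi, schwartz phi ->
              besov eta0 (dfun phi) /\
              lambda eta0 I (dfun phi) = cint [set` I] phi,
            linear_on_besov eta0 (lambda eta0 I) &
            (operator_norm eta0 (lambda eta0 I)
               <= (C * (1 + itv_length I))%:E)%E],
      (* (ii) *)
      exists C : R, forall h, haar_ext_system h ->
        linear_on_besov eta0 (fun f => pairing eta0 f h) /\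
        (operator_norm eta0 (fun f => pairing eta0 f h) <= C%:E)%E
    & (* (iii) *)
      forall f, besov eta0 f ->
        (forall h, haar_system h -> pairing eta0 f h = 0) ->
        deq f (@dzero R)].
Proof.
have heta := cutoff_Ccinfty eta0_smooth eta0_supp eta0_one.
split.
- have [K K0 hK] := lambdaP heta; exists K => I bI; split.
  + by move=> f bf; have [c _ _] := hK f I bf bI.
  + move=> phi /schP sp; split; first exact: besov_dfun.
    exact: lambda_dfun.
  + exact: lambda_linear.
  + apply: operator_norm_le; last by move=> f bf; have [_ _ b] := hK f I bf bI.
    have [a [b [ab -> _]]] := bounded_itvP bI.
    by rewrite mulr_ge0// addr_ge0// subr_ge0.
- exact: pairing_haar_ext.
- move=> f bf f_haar phi /schP sp; apply: (besov_vanish heta bf) => // a b.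
  exact: (itv_functional_vanish heta bf f_haar).
Qed.
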